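(* Fix real constants as in the context, so that $a_2\in\mathbb R$ is fixed and $a_1=a_1(\mathrm I_2)$ depends on $\mathrm I_2>0$, with $\sigma=\omega_+-3\omega_-$ and $\chi\neq0$. For each of the zones of type $\mathrm I,\mathrm{II},\mathrm{III},\mathrm{IV}$ listed in the context, let $\mathcal A(E;\mathrm I_2)$ be the corresponding normalized area of the $E$-level curve of $F$ in that zone, as defined in the context. Set $$W(x,E,\mathrm I_2):=\frac{1}{\pi\sqrt{(1-x)^3x-\big(E-\frac12a_2x^2-a_1x\big)^2}}=\frac1{\pi\sqrt{-\mathbf P(x)}}.$$ (a) In the zones of type $\mathrm I$, $\mathrm{II}$, $\mathrm{III}$, $$\partial_E\mathcal A(E;\mathrm I_2)=\pm\int_{x_1(E,\mathrm I_2)}^{x_2(E,\mathrm I_2)}W(x,E,\mathrm I_2)\,dx,\qquad \partial_{\mathrm I_2}\mathcal A(E;\mathrm I_2)=\pm\frac{\sigma}{3\chi\mathrm I_2^2}\int_{x_1(E,\mathrm I_2)}^{x_2(E,\mathrm I_2)}x\,W(x,E,\mathrm I_2)\,dx,$$ where the sign is $+$ in all zones of type $\mathrm{III}$ and in $\mathcal P_{01}^{\mathrm{II}},\mathcal P_{21}^{+,\mathrm{II}},\mathcal P_{12}^{+,\mathrm{II}}$, and the sign is $-$ in all zones of type $\mathrm I$ and in $\mathcal P_{10}^{\mathrm{II}},\mathcal P_{21}^{-,\mathrm{II}},\mathcal P_{12}^{-,\mathrm{II}}$. (b) In the zones of type $\mathrm{IV}$, $$\partial_E\mathcal A^{\mathrm{IV}}(E;\mathrm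 I_2)=\pm\int_{x_3(E,\mathrm I_2)}^{x_4(E,\mathrm I_2)}W(x,E,\mathrm I_2)\,dx,\qquad \partial_{\mathrm I_2}\mathcal A^{\mathrm{IV}}(E;\mathrm I_2)=\pm\frac{\sigma}{3\chi\mathrm I_2^2}\int_{x_3(E,\mathrm I_2)}^{x_4(E,\mathrm I_2)}x\,W(x,E,\mathrm I_2)\,dx,$$ where $\mathcal A^{\mathrm{IV}}$ denotes $\mathcal A$ in a type $\mathrm{IV}$ zone, and the sign is $+$ in $\mathcal P_{21}^{\pm,\mathrm{IV}}$ and $-$ in $\mathcal P_{12}^{\pm,\mathrm{IV}}$.
   Context: **Constants.** $0<\omega_-<\omega_+$, and $M_3,N_3,\phi_1^\pm,\phi_2^\pm\in\mathbb R$ are fixed. Set $\sigma:=\omega_+-3\omega_-$, $$G_{20}:=\tfrac{3}{8\omega_-^2}\big((\phi_1^-)^4M_3+(\phi_2^-)^4N_3\big),\quad G_{11}:=\tfrac{3}{2\omega_-\omega_+}\big((\phi_1^-)^2(\phi_1^+)^2M_3+(\phi_2^-)^2(\phi_2^+)^2N_3\big),$$ $$G_{02}:=\tfrac{3}{8\omega_+^2}\big((\phi_1^+)^4M_3+(\phi_2^+)^4N_3\big),\quad f_{3,1}:=(\phi_1^-)^3\phi_1^+M_3+(\phi_2^-)^3\phi_2^+N_3,\quad \chi:=\frac{f_{3,1}}{2\sqrt3\,(\sqrt{\omega_-})^3\sqrt{\omega_+}},$$ with $\chi\neq0$. For $\mathrm I_2>0$ put $$a_1=a_1(\mathrm I_2):=-\frac{2G_{20}}{\chi}+\frac{G_{11}}{3\chi}+\frac{\sigma}{3\mathrm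 I_2\chi},\qquad a_2:=\frac{2G_{20}}\chi-\frac{2G_{11}}{3\chi}+\frac{2G_{02}}{9\chi}.$$ **The function $F$.** On $\mathcal P:=\mathbb T\times(0,1)$, $\mathbb T=\mathbb R/2\pi\mathbb Z$, with coordinates $(\psi,x)$, let $F(\psi,x)=a(x)+b(x)\cos\psi$, $a(x)=\frac12a_2x^2+a_1x$, $b(x)=\sqrt{(1-x)^3x}$ ($F$ and $a$ depend on $\mathrm I_2$ through $a_1$). Let $\mathbf P(x):=(a(x)-E)^2-b(x)^2=(\frac12a_2x^2+a_1x-E)^2-(1-x)^3x$, and let $x_1<x_2<\dots$, $x_i=x_i(E,\mathrm I_2)$, be its real roots in $(0,1)$ in increasing order (at most four); they are the $x$-coordinates of the points where $\{F=E\}$ meets the lines $\{\psi=0\}$ and $\{\psi=\pi\}$. In the half phase space $0\le\psi\le\pi$ the level set $\{F=E\}$ is expressed as a graph over $x$ by $\psi(x)=\psi(x;E,\mathrm I_2):=\arccos\frac{E-a(x)}{b(x)}$. **Regions of parameters.** Let $g(a_1):=\frac1{27}(\sqrt{9+4a_1^2}-2a_1)(9-4a_1^2-4a_1\sqrt{9+4a_1^2})$ and $Z_{10}:=\{a_2<-g(-a_1)\}$, $Z_{12}:=\{-g(-a_1)<a_2<-a_1\}$, $Z_{21}:=\{-a_1<a_2<g(a_1)\}$, $Z_{01}:=\{a_2>g(a_1)\}$. In $Z_{21}$ the critical points of $F$ are a maximum $(0,x_1^{(0)})$, a saddle $(0,x_2^{(0)})$ with $x_1^{(0)}<x_2^{(0)}$,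 and a minimum $(\pi,x_1^{(\pi)})$. In $Z_{12}$ they are a maximum $(0,x_1^{(0)})$, a minimum $(\pi,x_1^{(\pi)})$ and a saddle $(\pi,x_2^{(\pi)})$ with $x_1^{(\pi)}<x_2^{(\pi)}$. (Maxima and minima are local.) In both cases $E_{\rm sad}$ denotes the value of $F$ at the saddle. For $(i,j)\in\{(2,1),(1,2)\}$ let $Z_{ij}^{\pm}:=\{(a_1,a_2)\in Z_{ij}:\pm E_{\rm sad}>0\}$. **Standing assumptions.** $(a_1,a_2)$ lies in one of $Z_{10},Z_{01},Z_{21}^\pm,Z_{12}^\pm$; the energy $E$ is a value taken by $F$ in the zone considered, $E\neq0$, and $E$ is not a critical value of $F$. **Zones**, with, in parentheses, the two points through which the $E$-level curves in that zone pass on the lines $\{\psi=0\}$ and $\{\psi=\pi\}$. Level curves in type $\mathrm I$ zones are loops around the maximum $(0,x_1^{(0)})$, those in type $\mathrm{III}$ zones are loops around the minimum $(\pi,x_1^{(\pi)})$, and those in type $\mathrm{II}$ and $\mathrm{IV}$ zones wrap around the cylinder. - $(a_1,a_2)\in Z_{10}$: $\mathcal P_{10}^{\mathrm I}=\{F>0\}$ ($(0,x_1),(0,x_2)$); $\mathcal P_{10}^{\mathrm{II}}=\{F<0\}$ ($(\pi,x_1),(0,x_2)$). - $(a_1,a_2)\in Z_{01}$: $\mathcal P_{01}^{\mathrm{II}}=\{F>0\}$ ($(0,x_1),(\pi,x_2)$); $\mathcal P_{01}^{\mathrm{III}}=\{F<0\}$ ($(\pi,x_1),(\pi,x_2)$).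 - $(a_1,a_2)\in Z_{21}^+$: $\mathcal P_{21}^{+,\mathrm I}$ = component of $\{F>E_{\rm sad}\}$ containing $(0,x_1^{(0)})$ ($(0,x_1),(0,x_2)$); $\mathcal P_{21}^{+,\mathrm{II}}=\{0<F<E_{\rm sad}\}$ ($(0,x_1),(\pi,x_2)$); $\mathcal P_{21}^{+,\mathrm{III}}=\{F<0\}$ ($(\pi,x_1),(\pi,x_2)$); $\mathcal P_{21}^{+,\mathrm{IV}}$ = component of $\{F>E_{\rm sad}\}$ not containing $(0,x_1^{(0)})$ ($(0,x_3),(\pi,x_4)$). - $(a_1,a_2)\in Z_{21}^-$: $\mathcal P_{21}^{-,\mathrm I}=\{F>0\}$ ($(0,x_1),(0,x_2)$); $\mathcal P_{21}^{-,\mathrm{III}}=\{F<E_{\rm sad}\}$ ($(\pi,x_1),(\pi,x_2)$); $\mathcal P_{21}^{-,\mathrm{II}}$ and $\mathcal P_{21}^{-,\mathrm{IV}}$ are the two open connected components of $\{E_{\rm sad}<F<0\}$, $\mathcal P_{21}^{-,\mathrm{II}}$ being the one with $(\psi,x)=(\pi,0)$ in its closure ($(\pi,x_1),(0,x_2)$ for $\mathrm{II}$; $(0,x_3),(\pi,x_4)$ for $\mathrm{IV}$). - $(a_1,a_2)\in Z_{12}^+$: $\mathcal P_{12}^{+,\mathrm I}=\{F>E_{\rm sad}\}$ ($(0,x_1),(0,x_2)$); $\mathcal P_{12}^{+,\mathrm{III}}=\{F<0\}$ ($(\pi,x_1),(\pi,x_2)$); $\mathcal P_{12}^{+,\mathrm{II}}$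 and $\mathcal P_{12}^{+,\mathrm{IV}}$ are the two open connected components of $\{0<F<E_{\rm sad}\}$, $\mathcal P_{12}^{+,\mathrm{II}}$ being the one with $(\psi,x)=(0,0)$ in its closure ($(0,x_1),(\pi,x_2)$ for $\mathrm{II}$; $(\pi,x_3),(0,x_4)$ for $\mathrm{IV}$). - $(a_1,a_2)\in Z_{12}^-$: $\mathcal P_{12}^{-,\mathrm I}=\{F>0\}$ ($(0,x_1),(0,x_2)$); $\mathcal P_{12}^{-,\mathrm{II}}=\{E_{\rm sad}<F<0\}$ ($(\pi,x_1),(0,x_2)$); $\mathcal P_{12}^{-,\mathrm{III}}$ = component of $\{F<E_{\rm sad}\}$ containing $(\pi,x_1^{(\pi)})$ ($(\pi,x_1),(\pi,x_2)$); $\mathcal P_{12}^{-,\mathrm{IV}}$ = component of $\{F<E_{\rm sad}\}$ not containing $(\pi,x_1^{(\pi)})$ ($(\pi,x_3),(0,x_4)$). **Normalized area $\mathcal A(E;\mathrm I_2)$** (area enclosed by the $E$-level curve in the zone, or below it if it wraps around the cylinder, divided by $2\pi$): - type $\mathrm I$: $\mathcal A=\frac1\pi\int_{x_1}^{x_2}\psi(x)\,dx$; - type $\mathrm{II}$: $\mathcal A=x_1+\frac1\pi\int_{x_1}^{x_2}\psi(x)\,dx$ if $\psi(x_1)=\pi$, and $\mathcal A=x_2-\frac1\pi\int_{x_1}^{x_2}\psi(x)\,dx$ if $\psi(x_1)=0$; - type $\mathrm{III}$: $\mathcal A=\frac1\pi\int_{x_1}^{x_2}(\pi-\psi(x))\,dx$;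 - type $\mathrm{IV}$: $\mathcal A=x_3+\frac1\pi\int_{x_3}^{x_4}\psi(x)\,dx$ if $\psi(x_3)=\pi$, and $\mathcal A=x_4-\frac1\pi\int_{x_3}^{x_4}\psi(x)\,dx$ if $\psi(x_3)=0$.
   Formalization: Added assumption: E is below F at the maximum (0,x_1^(0)) for Z_21 and above F at the minimum (π,x_1^(π)) for Z_12. Otherwise type I/III level curves may wrap the cylinder, making (a) false (e.g. a_1=-10, a_2=100, E=1), or x_3, x_4 may not exist. *)

(* Defs.v *)
From HB Require Import structures.
From mathcomp Require Import all_boot all_order all_algebra.
From mathcomp Require Import all_classical all_reals all_analysis.
From mathcomp Require Import polyrcf.
Set Implicit Arguments.
Unset Strict Implicit.
Unset Printing Implicit Defensive.
Import Order.TTheory GRing.Theory Num.Theory.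
Import numFieldNormedType.Exports.

Local Open Scope classical_set_scope.
Local Open Scope ring_scope.
Local Open Scope quotient_scope.

Record constants (R : realType) := Constants {
  om_m : R; om_p : R;       (* omega_-, omega_+ *)
  M3 : R; N3 : R;
  phi1m : R; phi1p : R;     (* phi_1^-, phi_1^+ *)
  phi2m : R; phi2p : R      (* phi_2^-, phi_2^+ *)
}.

Section Coefficients.
Context {R : realType} (c : constants R).

Definition sigma : R := om_p c - 3 * om_m c.

Definition G20 : R :=
  3 / (8 * om_m c ^+ 2) * (phi1m c ^+ 4 * M3 c + phi2m c ^+ 4 * N3 c).

Definition G11 : R :=
  3 / (2 * om_m c * om_p c) *
  (phi1m c ^+ 2 * phi1p c ^+ 2 * M3 c + phi2m c ^+ 2 * phi2p c ^+ 2 * N3 c).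

Definition G02 : R :=
  3 / (8 * om_p c ^+ 2) * (phi1p c ^+ 4 * M3 c + phi2p c ^+ 4 * N3 c).

Definition f31 : R :=
  phi1m c ^+ 3 * phi1p c * M3 c + phi2m c ^+ 3 * phi2p c * N3 c.

Definition chi : R :=
  f31 / (2 * Num.sqrt 3 * Num.sqrt (om_m c) ^+ 3 * Num.sqrt (om_p c)).

Definition a1 (I2 : R) : R :=
  - (2 * G20 / chi) + G11 / (3 * chi) + sigma / (3 * I2 * chi).

Definition a2 : R :=
  2 * G20 / chi - 2 * G11 / (3 * chi) + 2 * G02 / (9 * chi).

End Coefficients.

Section Circle.
Variable R : realType.

Definition angle_rel (s t : R) : bool := (s - t) / (pi *+ 2) \is a Num.int.

Lemma angle_rel_refl : reflexive angle_rel.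
Proof. by move=> s; rewrite /angle_rel subrr mul0r rpred0. Qed.

Lemma angle_rel_sym : symmetric angle_rel.
Proof. by move=> s t; rewrite /angle_rel -opprB mulNr rpredN. Qed.

Lemma angle_rel_trans : transitive angle_rel.
Proof.
by move=> t s u st tu; rewrite /angle_rel -(subrKA t) mulrDl rpredD.
Qed.

Canonical angle_equiv :=
  EquivRel angle_rel angle_rel_refl angle_rel_sym angle_rel_trans.

(* R / 2 pi Z *)
Definition circle := quotient_topology {eq_quot angle_equiv}.

Definition ang (s : R) : circle := \pi_circle s.

End Circle.

Section Hamiltonian.
Context {R : realType}.

(* In this section [a1] and [a2] are arbitrary real parameters. *)
Variables a1 a2 : R.

Definition afun (x : R) : R := a2 / 2 * x ^+ 2 + a1 * x.

Definition bfun (x : R) : R := Num.sqrt ((1 - x) ^+ 3 * x).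

(* F in the coordinates (psi, x), 2 pi-periodic in psi *)
Definition Flift (p : R * R) : R := afun p.2 + bfun p.2 * cos p.1.

Definition phase_space : set (circle R * R) := [set p | 0 < p.2 < 1].

Definition F (p : circle R * R) : R := Flift (repr p.1, p.2).

(* Critical points, and local extrema, are taken in the coordinates (psi, x). *)
Definition critical (p : R * R) : Prop :=
  [/\ 0 < p.2 < 1,
      is_derive p.1 (1 : R) (fun s : R => Flift (s, p.2)) (0 : R)
    & is_derive p.2 (1 : R) (fun x : R => Flift (p.1, x)) (0 : R)].

Definition loc_max (p : R * R) : Prop := \forall q \near p, Flift q <= Flift p.

Definition loc_min (p : R * R) : Prop := \forall q \near p, Flift p <= Flift q.

Definition saddle (p : R * R) : Prop :=
  [/\ critical p, ~ loc_max p & ~ loc_min p].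

Definition critical_value (E : R) : Prop :=
  exists2 p, critical p & Flift p = E.

(* x_1^(0) and x_1^(pi): the maximum of F is (0, xmax), the minimum is
   (pi, xmin); E_sad is the value of F at the saddle.  [get] picks the unique
   element of the set, and is only used for parameters (a1, a2) for which the
   maximum, the minimum or the saddle exists and is unique. *)
Definition xmax : R := get [set x : R | critical (0, x) /\ loc_max (0, x)].

Definition xmin : R := get [set x : R | critical (pi, x) /\ loc_min (pi, x)].

Definition Esad : R := get [set e : R | exists2 p, saddle p & Flift p = e].

Definition gfun (t : R) : R :=
  27^-1 * (Num.sqrt (9 + 4 * t ^+ 2) - 2 * t) *
  (9 - 4 * t ^+ 2 - 4 * t * Num.sqrt (9 + 4 * t ^+ 2)).

End Hamiltonian.

(* [Zijp] and [Zijm] stand for Z_ij^+ and Z_ij^-. *)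
Inductive region := Z10 | Z01 | Z21p | Z21m | Z12p | Z12m.

Inductive zone_type := TI | TII | TIII | TIV.

Section Zones.
Context {R : realType}.
Variables a1 a2 : R.

Definition in_region (r : region) : Prop :=
  match r with
  | Z10 => a2 < - gfun (- a1)
  | Z01 => a2 > gfun a1
  | Z21p => - a1 < a2 < gfun a1 /\ Esad a1 a2 > 0
  | Z21m => - a1 < a2 < gfun a1 /\ Esad a1 a2 < 0
  | Z12p => - gfun (- a1) < a2 < - a1 /\ Esad a1 a2 > 0
  | Z12m => - gfun (- a1) < a2 < - a1 /\ Esad a1 a2 < 0
  end.

Local Notation F := (F a1 a2).
Local Notation Es := (Esad a1 a2).
Local Notation P := (@phase_space R).

(* The union of the components of A having p in their closure.  The two uses
   below have only one such component; p lies on the boundary x = 0. *)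
Definition comp_at (A : set (circle R * R)) (p : circle R * R) :=
  [set q | A q /\ closure (connected_component A q) p].

Let top : circle R * R := (ang 0, xmax a1 a2).
Let bot : circle R * R := (ang pi, xmin a1 a2).

Definition zone (r : region) (t : zone_type) : set (circle R * R) :=
  match r, t with
  | Z10, TI => [set p | P p /\ F p > 0]
  | Z10, TII => [set p | P p /\ F p < 0]
  | Z01, TII => [set p | P p /\ F p > 0]
  | Z01, TIII => [set p | P p /\ F p < 0]
  | Z21p, TI => connected_component [set p | P p /\ F p > Es] top
  | Z21p, TII => [set p | P p /\ 0 < F p < Es]
  | Z21p, TIII => [set p | P p /\ F p < 0]
  | Z21p, TIV => let A := [set p | P p /\ F p > Es] in
                 A `\` connected_component A top
  | Z21m, TI => [set p | P p /\ F p > 0]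
  | Z21m, TII => comp_at [set p | P p /\ Es < F p < 0] (ang pi, 0)
  | Z21m, TIII => [set p | P p /\ F p < Es]
  | Z21m, TIV => let A := [set p | P p /\ Es < F p < 0] in
                 A `\` comp_at A (ang pi, 0)
  | Z12p, TI => [set p | P p /\ F p > Es]
  | Z12p, TII => comp_at [set p | P p /\ 0 < F p < Es] (ang 0, 0)
  | Z12p, TIII => [set p | P p /\ F p < 0]
  | Z12p, TIV => let A := [set p | P p /\ 0 < F p < Es] in
                 A `\` comp_at A (ang 0, 0)
  | Z12m, TI => [set p | P p /\ F p > 0]
  | Z12m, TII => [set p | P p /\ Es < F p < 0]
  | Z12m, TIII => connected_component [set p | P p /\ F p < Es] bot
  | Z12m, TIV => let A := [set p | P p /\ F p < Es] in
                 A `\` connected_component A bot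
  | _, _ => set0
  end.

(* In Z_21 the value of F on the boundary x = 1 may exceed the value at the
   (local) maximum (0, xmax).  The level curves at the energies in between wrap
   around the cylinder through (0, x_1) and (pi, x_2), the only two roots: there
   are no loops around the maximum, although {F > 0} takes these values
   when E_sad < 0, and there are no x_3, x_4, although F takes these values in
   the zone of type IV when E_sad > 0.  Such energies are left out; those of the
   other zones satisfy this condition automatically.  Z_12 is symmetric. *)
Definition loops_exist (r : region) (E : R) : Prop :=
  match r with
  | Z10 | Z01 => True
  | Z21p | Z21m => E < Flift a1 a2 (0, xmax a1 a2)
  | Z12p | Z12m => Flift a1 a2 (pi, xmin a1 a2) < E
  end.

End Zones.

Section Area.
Context {R : realType} (c : constants R).

Definition Ppoly (E I2 : R) : {poly R} :=
  ((a2 c / 2) *: 'X^2 + a1 c I2 *: 'X - E%:P) ^+ 2 - (1 - 'X) ^+ 3 * 'X.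

(* x_i(E, I_2), i >= 1: [roots p 0 1] is the increasing list, without
   repetitions, of the roots of p in the open interval (0, 1). *)
Definition xroot (i : nat) (E I2 : R) : R := (roots (Ppoly E I2) 0 1)`_i.-1.

Definition psi (E I2 x : R) : R :=
  acos ((E - afun (a1 c I2) (a2 c) x) / bfun x).

Definition psi_integral (i j : nat) (E I2 : R) : R :=
  pi^-1 * \int[lebesgue_measure]_(x in `[xroot i E I2, xroot j E I2])
            psi E I2 x.

(* At a root x_i, psi is either pi or 0. *)
Definition wrap_area (i j : nat) (E I2 : R) : R :=
  if psi E I2 (xroot i E I2) == pi
  then xroot i E I2 + psi_integral i j E I2
  else xroot j E I2 - psi_integral i j E I2.

Definition area (t : zone_type) (E I2 : R) : R :=
  match t with
  | TI => psi_integral 1 2 E I2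
  | TII => wrap_area 1 2 E I2
  | TIII => pi^-1 * \int[lebesgue_measure]_(x in `[xroot 1 E I2, xroot 2 E I2])
                      (pi - psi E I2 x)
  | TIV => wrap_area 3 4 E I2
  end.

Definition W (E I2 x : R) : R :=
  (pi * Num.sqrt ((1 - x) ^+ 3 * x
                  - (E - a2 c / 2 * x ^+ 2 - a1 c I2 * x) ^+ 2))^-1.

Definition zone_sign (r : region) (t : zone_type) : R :=
  match t, r with
  | TI, _ => -1
  | TII, (Z01 | Z21p | Z12p) => 1
  | TII, (Z10 | Z21m | Z12m) => -1
  | TIII, _ => 1
  | TIV, (Z21p | Z21m) => 1
  | TIV, _ => -1
  end.

(* [Rintegral] is 0 by convention for a divergent integral, hence the explicit
   integrability of the functions which are singular at x_i and x_j. *)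
Definition derivative_formulas (t : zone_type) (s : R) (i j : nat) (E I2 : R) :
    Prop :=
  let D := `[xroot i E I2, xroot j E I2]%classic in
  [/\ lebesgue_measure.-integrable D (EFin \o W E I2),
      lebesgue_measure.-integrable D (EFin \o (fun x => x * W E I2 x)),
      is_derive E (1 : R) (fun e => area t e I2)
        (s * \int[lebesgue_measure]_(x in D) W E I2 x)
    & is_derive I2 (1 : R) (fun J => area t E J)
        (s * (sigma c / (3 * chi c * I2 ^+ 2)) *
         \int[lebesgue_measure]_(x in D) (x * W E I2 x))].

End Area.

(* Main.v *)
Require Import Defs.
From mathcomp Require Import all_boot all_order all_algebra.
From mathcomp Require Import all_classical all_reals all_analysis.
From mathcomp Require Import polyrcf.
From mathcomp Require Import measurable_realfun ring lra.
Set Implicit Arguments.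
Unset Strict Implicit.
Unset Printing Implicit Defensive.
Import Order.TTheory GRing.Theory Num.Theory.
Import numFieldNormedType.Exports.
Local Open Scope classical_set_scope.
Local Open Scope ring_scope.

(** Extend arccos to the whole line by its values 0 and pi outside [-1, 1].  If
[al < x_i < x_j < be] bracket an arc without further roots, then x_i or x_j plus
or minus the integral of psi over the arc is a constant plus or minus the
integral over the fixed interval [al, be] of the clamped arccos of (E - a) / b.
The clamped arccos satisfies |acosc s - acosc t| sqrt |1 - t^2| <= 4 |s - t|,
so the difference quotients in E or a_1 are dominated by a multiple of
1 / sqrt |P|, which is integrable because the roots are simple at a noncritical
energy, and the derivative passes under the integral.  Simple roots persist
under perturbation, hence so does the numbering of the roots.

The position of the roots in each zone is read off u = a + b and l = a - b,
since P = (u - E) (l - E).  With r = sqrt ((1 - x) / x) one has u' = x C(r) for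
a cubic C which decreases and then increases on r > 0; its minimum is given by
g, which yields the shapes of u and l in the regions Z_ij.  The symmetry
(a_1, a_2, E, psi) -> (-a_1, -a_2, -E, psi + pi) halves the cases.  In the zones
of type IV, a point to the left of the saddle would be joined, by turning to the
line psi = 0 or by following its level curve, to the component that the zone
excludes. *)

(** The obstacle is that the roots x_i move with the parameters while the derivative of psi is
    unbounded at them, so differentiation under the integral sign needs a fixed domain and an
    integrable bound uniform in the increment. The bound on [acosc] provides the latter because its
    weight sits at only one of its two arguments: kept at the unperturbed value, it is independent
    of the increment. It has to hold for |t| > 1 too, since the fixed interval sticks out of the arc
    on both sides.

    E and a_1 both enter P through N = a - E, affinely, so one line N + d om serves for both
    derivatives. The sign in the formulas is then a single bit: whether the right-hand root lies on
    psi = 0 or on psi = pi. [pattern] is the interface between the two halves: simple roots, their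
    place in the list and their lines are all that the analysis needs from the geometry.

    The substitution r is chosen because it makes b rational: 1 - x = x r^2 gives b = x^2 r^3. *)

Section ClampedArccos.
Variable R : realType.
Implicit Types s t x y : R.

(** A weak form of Jordan's inequality. With y = x / 2 one has sin x = 2 sin y cos y, and sin y = y
    cos c by the mean value theorem; both cosines have arguments at most pi / 4, so each of their
    squares is at least 1 / 2. *)
Lemma sin_ge_half x : 0 <= x <= pi / 2 -> x / 2 <= sin x.
Proof.
move=> /andP[x0 xpi]; set y := x / 2.
have pi0 := pi_gt0 R.
have [y0|] := ltP 0 y; last first.
  move=> y0; have -> : x = 0 by rewrite /y in y0; lra.
  by rewrite sin0.
have drv z : z \in `]0, y[ -> is_derive z (1 : R) sin (cos z).
  by move=> _; exact: is_derive_sin.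
have cts : {within `[0, y], continuous (@sin R)}.
  by apply: continuous_subspaceT => z; exact: continuous_sin.
have [c /[!in_itv]/= /andP[c0 cy]] := MVT y0 drv cts.
rewrite sin0 !subr0 => siny.
have [y4 c4] : y <= (pi : R) / 4 /\ c <= (pi : R) / 4 by split; rewrite /y in cy *; lra.
have cos_lb (z : R) : 0 <= z -> z <= (pi : R) / 4 -> 1 / 2 <= cos z ^+ 2.
  move=> z0 z4; have : 0 <= cos (z *+ 2).
    by apply: cos_ge0_pihalf; rewrite (mulr2n z); apply/andP; split; lra.
  by rewrite cos_mulr2n mulr2n; lra.
have cosge (z : R) : 0 <= z -> z <= (pi : R) / 4 -> 0 <= cos z.
  by move=> z0 z4; apply: cos_ge0_pihalf; lra.
have hc := cos_lb c (ltW c0) c4; have hy := cos_lb y (ltW y0) y4.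
have gc := cosge c (ltW c0) c4; have gy := cosge y (ltW y0) y4.
have cc : 1 / 2 <= cos y * cos c.
  have half0 : (0 : R) <= 1 / 2 by lra.
  rewrite -(@ler_pXn2r _ 2) ?nnegrE ?mulr_ge0 // [leRHS]exprMn [leLHS]expr2.
  by apply: ler_pM.
have -> : x = y *+ 2 by rewrite /y mulr2n; lra.
rewrite sin_mulr2n siny mulr2n.
have : y * (1 / 2) <= y * (cos y * cos c) by rewrite ler_pM2l.
by nra.
Qed.

Definition clamp s : R := if s < -1 then -1 else if 1 < s then 1 else s.

Definition acosc s : R := acos (clamp s).

Lemma clamp_itv s : -1 <= clamp s <= 1.
Proof. by rewrite /clamp; case: (ltrP s (-1)) => h; case: (ltrP 1 s) => k; lra. Qed.

Lemma clamp_id s : -1 <= s <= 1 -> clamp s = s.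
Proof.
move=> /andP[h k]; rewrite /clamp.
by case: (ltrP s (-1)) => h1; case: (ltrP 1 s) => k1; lra.
Qed.

Lemma clamp_ge1 s : 1 <= s -> clamp s = 1.
Proof.
by move=> h; rewrite /clamp; case: (ltrP s (-1)) => h1; case: (ltrP 1 s) => k1; lra.
Qed.

Lemma clamp_leN1 s : s <= -1 -> clamp s = -1.
Proof.
by move=> h; rewrite /clamp; case: (ltrP s (-1)) => h1; case: (ltrP 1 s) => k1; lra.
Qed.

Lemma acosc_id s : -1 <= s <= 1 -> acosc s = acos s.
Proof. by rewrite /acosc => /clamp_id ->. Qed.

Lemma acosc_ge1 s : 1 <= s -> acosc s = 0.
Proof. by rewrite /acosc => /clamp_ge1 ->; rewrite acos1. Qed.

Lemma acosc_leN1 s : s <= -1 -> acosc s = pi.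
Proof. by rewrite /acosc => /clamp_leN1 ->; rewrite acosN1. Qed.

Lemma acosc_itv s : 0 <= acosc s <= pi.
Proof. by rewrite /acosc acos_ge0 ?acos_lepi ?clamp_itv. Qed.

Lemma cos_acosc s : cos (acosc s) = clamp s.
Proof. by rewrite /acosc acosK // in_itv /= clamp_itv. Qed.

Lemma clamp_lip s t : `|clamp s - clamp t| <= `|s - t|.
Proof.
wlog ts : s t / t <= s => [hw|].
  have [/hw//|st] := leP t s.
  by rewrite distrC [leRHS]distrC hw // ltW.
rewrite (@ger0_norm _ (s - t)) ?subr_ge0 // /clamp.
by case: (ltrP s (-1)) => h1; case: (ltrP 1 s) => k1;
   case: (ltrP t (-1)) => h2; case: (ltrP 1 t) => k2; rewrite ler_norml; lra.
Qed.

Lemma abs_le_4sin x : `|x| <= pi -> `|x| <= 4 * `|sin (x / 2)|.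
Proof.
wlog x0 : x / 0 <= x => [hw xpi|].
  have [/hw->//|x0] := leP 0 x.
  have := hw (- x); rewrite normrN mulNr sinN normrN; apply => //; lra.
rewrite ger0_norm // => xpi.
have h : x / 2 / 2 <= sin (x / 2) by apply: sin_ge_half; lra.
have := ler_norm (sin (x / 2)); lra.
Qed.

(** With m and d the half sum and the half difference, sin^2 m - sin^2 d = sin x sin y, which is
    nonnegative on [0, pi]. *)
Lemma sin_half_le x y : 0 <= x <= pi -> 0 <= y <= pi ->
  `|sin ((x - y) / 2)| <= sin ((x + y) / 2).
Proof.
move=> hx hy; set m := (x + y) / 2; set d := (x - y) / 2.
have m0 : 0 <= sin m by apply: sin_ge0_pi; rewrite /m; lra.
rewrite -(@ler_pXn2r _ 2) ?nnegrE // real_normK ?num_real //.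
have -> : sin m ^+ 2 = sin d ^+ 2 + sin (m + d) * sin (m - d).
  rewrite sinD sinB; have := cos2Dsin2 m; have := cos2Dsin2 d.
  set a := sin m; set b := cos m; set e := sin d; set f := cos d => h1 h2.
  have f2 : f ^+ 2 = 1 - e ^+ 2 by lra.
  have b2 : b ^+ 2 = 1 - a ^+ 2 by lra.
  have -> : (a * f + b * e) * (a * f - b * e) = a ^+ 2 * f ^+ 2 - b ^+ 2 * e ^+ 2.
    by ring.
  by rewrite b2 f2; ring.
have -> : m + d = x by rewrite /m /d; lra.
have -> : m - d = y by rewrite /m /d; lra.
by rewrite lerDl mulr_ge0 // sin_ge0_pi.
Qed.

Lemma cosB_prod x y :
  cos x - cos y = - 2 * sin ((x + y) / 2) * sin ((x - y) / 2).
Proof.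
set m := (x + y) / 2; set d := (x - y) / 2.
have -> : x = m + d by rewrite /m /d; lra.
have -> : y = m - d by rewrite /m /d; lra.
by rewrite cosD cosB; ring.
Qed.

(** For the two angles x, y with half sum m and half difference d, |cos x - cos y| = 2 sin m |sin d|
    >= 2 sin^2 d, while |x - y| <= 4 |sin d|. This gives continuity at -1 and 1 as well, where
    arccos is not differentiable. *)
Lemma acosc_holder s t : (acosc s - acosc t) ^+ 2 <= 8 * `|s - t|.
Proof.
apply: (@le_trans _ _ (8 * `|clamp s - clamp t|)); last first.
  by rewrite ler_pM2l // clamp_lip.
rewrite -!cos_acosc cosB_prod.
have hx := acosc_itv s; have hy := acosc_itv t.
move: (acosc s) (acosc t) hx hy => x y hx hy.
have h1 := sin_half_le hx hy.
have : `|x - y| <= pi by rewrite ler_norml; lra.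
move=> /abs_le_4sin h2.
rewrite -real_normK ?num_real // !normrM normrN.
rewrite (ger0_norm (le_trans (normr_ge0 _) h1)) (@ger0_norm _ 2) //.
have h0 := normr_ge0 (x - y).
move: (`|x - y|) (`|sin ((x - y) / 2)|) h0 (normr_ge0 (sin ((x - y) / 2))) h1 h2.
move=> a k a0 k0 h1 h2.
apply: (@le_trans _ _ ((4 * k) * (4 * k))); first by rewrite expr2 ler_pM.
have : k * k <= sin ((x + y) / 2) * k by rewrite ler_wpM2r.
by lra.
Qed.

(** The weight vanishes where arccos has infinite slope. For t in [-1, 1] it equals sin (acosc t),
    and the factorisation of cos x - cos y gives the bound; for t > 1 the function is 0 at t, and a
    separate estimate yields the same constant. *)
Lemma acosc_lip_sing s t :
  `|acosc s - acosc t| * Num.sqrt `|1 - t ^+ 2| <= 4 * `|s - t|.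
Proof.
wlog t1 : s t / -1 <= t => [hw|].
  have [/hw//|t1] := leP (-1) t.
  have acoscN u : acosc (- u) = pi - acosc u.
    have [u1|u1] := leP u (-1).
      by rewrite (acosc_leN1 u1) acosc_ge1 ?subrr //; lra.
    have [u2|u2] := leP 1 u.
      by rewrite (acosc_ge1 u2) acosc_leN1 ?subr0 //; lra.
    by rewrite !acosc_id ?acosN //; lra.
  have := hw (- s) (- t); rewrite !acoscN sqrrN.
  have -> : pi - acosc s - (pi - acosc t) = - (acosc s - acosc t) by ring.
  have -> : - s - - t = - (s - t) by ring.
  by rewrite !normrN; apply; lra.
have [t2|t2] := leP t 1.
  apply: (@le_trans _ _ (4 * `|clamp s - clamp t|)); last first.
    by rewrite ler_pM2l // clamp_lip.
  have -> : Num.sqrt `|1 - t ^+ 2| = sin (acosc t).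
    rewrite acosc_id ?sin_acos ?t1 ?t2 // ger0_norm // subr_ge0.
    by rewrite -[leRHS]mul1r expr2; nra.
  rewrite -!cos_acosc cosB_prod.
  have hx := acosc_itv s; have hy := acosc_itv t.
  move: (acosc s) (acosc t) hx hy => x y hx hy.
  have h1 := sin_half_le hx hy.
  have : `|x - y| <= pi by rewrite ler_norml; lra.
  move=> /abs_le_4sin h2.
  have siny0 : 0 <= sin y by apply: sin_ge0_pi.
  (* Since y = m - d, sin y <= sin m + |sin d| <= 2 sin m. *)
  have h3 : sin y <= 2 * sin ((x + y) / 2).
    have {1}-> : y = (x + y) / 2 - (x - y) / 2 by lra.
    rewrite sinB.
    set m := (x + y) / 2 in h1 *; set d := (x - y) / 2 in h1 *.
    have sm : 0 <= sin m := le_trans (normr_ge0 _) h1.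
    have : sin m * cos d <= sin m by rewrite ler_piMr ?cos_le1.
    have : - (cos m * sin d) <= `|sin d|.
      rewrite -normrN (le_trans (ler_norm _)) // !normrN normrM.
      by rewrite ler_piMl ?cos_max.
    by lra.
  rewrite !normrM normrN.
  rewrite (ger0_norm (le_trans (normr_ge0 _) h1)) (@ger0_norm _ 2) //.
  have h0 := normr_ge0 (x - y).
  move: (`|sin _|) h1 h2 (normr_ge0 (sin ((x - y) / 2))) => k h1 h2 k0.
  rewrite (@le_trans _ _ (4 * k * (2 * sin ((x + y) / 2)))) //.
    by apply: ler_pM.
  by lra.
rewrite (acosc_ge1 (ltW t2)) subr0.
have [s1|s1] := leP 1 s.
  by rewrite (acosc_ge1 s1) normr0 mul0r mulr_ge0.
apply: (@le_trans _ _ (4 * (t - clamp s))); last first.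
  rewrite ler_pM2l // distrC (le_trans _ (ler_norm _)) //.
  by rewrite lerD2l lerN2 /clamp; case: (ltrP s (-1)) => h; case: (ltrP 1 s) => k; lra.
(* With q = sin (x / 2)^2 and e = t - 1, cos x = 1 - 2 q and x^2 <= 16 q, so the squared claim
   reduces to q e (e + 2) <= (e + 2 q)^2, which holds as q <= 1. *)
rewrite -cos_acosc; have hx := acosc_itv s; move: (acosc s) hx => x hx.
have : `|x| <= pi by rewrite ler_norml; lra.
move=> /abs_le_4sin.
have : cos x = 1 - 2 * sin (x / 2) ^+ 2.
  have {1}-> : x = (x / 2) *+ 2 by rewrite mulr2n; lra.
  by rewrite cos_mulr2n cos2sin2 mulr2n; lra.
move=> ->; rewrite -[in X in _ -> _ <= X](real_normK (num_real (sin _))).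
have x0 := normr_ge0 x.
have : `|sin (x / 2)| <= 1 by exact: sin_max.
move: (`|x|) (`|sin _|) x0 (normr_ge0 (sin (x / 2))) => a k a0 k0 k1 ak.
rewrite ler0_norm; last by nra.
rewrite -(@ler_pXn2r _ 2) ?nnegrE ?mulr_ge0 ?sqrtr_ge0 //; last by nra.
rewrite exprMn sqr_sqrtr; last by nra.
have {ak} : a ^+ 2 <= 16 * k ^+ 2 by nra.
set e := t - 1; have -> : t = e + 1 by rewrite /e; lra.
have e0 : 0 <= e by rewrite /e; lra.
have k2 : 0 <= k ^+ 2 <= 1 by rewrite sqr_ge0 expr_le1.
move: (k ^+ 2) k2 => q /andP[q0 q1] ak.
have -> : - (1 - (e + 1) ^+ 2) = e * (e + 2) by ring.
apply: (@le_trans _ _ (16 * q * (e * (e + 2)))).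
  by rewrite ler_wpM2r // mulr_ge0 //; lra.
have : q * (e * e) <= e * e by rewrite ler_piMl // mulr_ge0.
by nra.
Qed.

Lemma continuous_acosc : continuous acosc.
Proof.
move=> t; apply/cvgrPdist_lt => e e0.
near=> s.
rewrite -(@ltr_pXn2r _ 2) ?nnegrE // ?(ltW e0) // real_normK ?num_real //.
apply: (le_lt_trans (acosc_holder t s)).
rewrite -ltr_pdivlMl //.
near: s; apply: (@cvgr_dist_lt _ _ _ _ _ id t) => //.
by rewrite mulr_gt0 ?invr_gt0 // exprn_gt0.
Unshelve. all: by end_near. Qed.

Lemma is_derive_acosc t : t != 1 -> t != -1 ->
  is_derive t (1 : R) acosc
    (if -1 < t < 1 then - (Num.sqrt (1 - t ^+ 2))^-1 else 0).
Proof.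
move=> t1 tN1; case: ifPn => [ht|].
  have h := is_derive1_acos ht.
  apply: (@near_eq_is_derive _ _ _ (@acos R)).
  have /andP[h1 h2] := ht.
  near=> s; rewrite acosc_id //; apply/andP; split.
    by near: s; exact: lt_le_nbhsr.
  by near: s; exact: lt_le_nbhsl.
rewrite negb_and -!leNgt => /orP[h|h].
  have {}h : t < -1 by rewrite lt_neqAle tN1.
  apply: (@near_eq_is_derive _ _ _ (cst pi)).
  near=> s; rewrite acosc_leN1 //.
  by near: s; exact: lt_le_nbhsl.
have {}h : 1 < t by rewrite lt_neqAle eq_sym t1.
apply: (@near_eq_is_derive _ _ _ (cst 0)).
near=> s; rewrite acosc_ge1 //.
by near: s; exact: lt_le_nbhsr.
Unshelve. all: by end_near. Qed.

End ClampedArccos.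

(** * Integrability of inverse square root singularities *)

Section IntegrableSingularities.
Variable R : realType.
Local Notation mu := (@lebesgue_measure R).

(* Monotone convergence over an exhaustion by compact intervals, on which the
   integral is an increment of the bounded primitive. *)
Lemma integrable_bounded_primitive (a b M : R) (f F : R -> R) : a < b ->
  measurable_fun setT f ->
  (forall x, 0 <= f x) ->
  {in `]a, b[, continuous f} ->
  (forall x, x \in `]a, b[ -> is_derive x (1 : R) F (f x)) ->
  (forall x, x \in `]a, b[ -> `|F x| <= M) ->
  mu.-integrable `[a, b]%classic (EFin \o f).
Proof.
move=> ab mf f0 cf dF FM.
have mEf (D : set R) : measurable_fun D ((EFin \o f) : R -> \bar R).
  by apply/measurable_EFinP; exact: measurable_funS mf.
apply/integrableP; split; first exact: mEf.
under eq_integral do rewrite gee0_abs ?lee_fin //.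
rewrite -[X in (X < _)%E]integral_itv_bndo_bndc //.
rewrite -[X in (X < _)%E]integral_itv_obnd_cbnd //.
(* Denominators start at 3, so that 2 d n < b - a already for n = 0 and every [A n] is
   nondegenerate. *)
pose d n : R := (b - a) / n.+3%:R.
pose A n := `[a + d n, b - d n]%classic.
have ba : 0 < b - a by rewrite subr_gt0.
have d0 n : 0 < d n by rewrite /d divr_gt0.
have dle n : d n *+ 2 < b - a.
  rewrite /d -mulrnAl ltr_pdivrMr // -mulr_natr mulrC [ltRHS]mulrC ltr_pM2r //.
  by rewrite ltr_nat.
have Asub n x : A n x -> x \in `]a, b[.
  rewrite /A /= !in_itv /= => /andP[h1 h2].
  by have dn := d0 n; apply/andP; split; lra.
have Uab : \bigcup_n A n = `]a, b[%classic.
  apply/seteqP; split => x; first by move=> [n _ /Asub].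
  rewrite /= in_itv /= => /andP[ax xb].
  have m0 : 0 < Num.min (x - a) (b - x) by rewrite lt_min !subr_gt0 ax xb.
  have [n hn] := ltr_add_invr (y := 0) (x := Num.min (x - a) (b - x) / (b - a)) (divr_gt0 m0 ba).
  exists n => //; rewrite /A /= in_itv /=.
  suff : d n <= Num.min (x - a) (b - x).
    by rewrite le_min => /andP[h1 h2]; apply/andP; split; lra.
  rewrite /d ler_pdivrMr //.
  move: hn; rewrite add0r ltr_pdivlMr // mulrC ltr_pdivrMr // => /ltW h.
  by apply: (le_trans h); rewrite ler_pM2l // ler_nat; do 2!apply: leqW.
have ndA : nondecreasing_seq A.
  move=> n m nm; apply/subsetPset => x; rewrite /A /= !in_itv /= => /andP[h1 h2].
  have : d m <= d n.
    by rewrite /d ler_pM2l // lef_pV2 ?posrE // ler_nat.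
  by move=> h; apply/andP; split; lra.
have Fle x y : x \in `]a, b[ -> y \in `]a, b[ -> F y - F x <= M + M.
  move=> /FM + /FM; rewrite !ler_norml => /andP[h1 h2] /andP[h3 h4]; lra.
have int_le n : (\int[mu]_(x in A n) (EFin \o f) x <= (M + M)%:E)%E.
  have hab : a + d n < b - d n by have := dle n; rewrite mulr2n; lra.
  have inab x : x \in `[a + d n, b - d n] -> x \in `]a, b[ by move/Asub.
  have cF x : x \in `]a, b[ -> {for x, continuous F}.
    move=> xab; apply: differentiable_continuous; apply/derivable1_diffP.
    by have [] := dF _ xab.
  rewrite (@continuous_FTC2 _ f F) //.
  - by rewrite -EFinB lee_fin; apply: Fle; apply: inab; rewrite in_itv /= lexx ltW.
  - by apply: continuous_in_subspaceT => x /set_mem /Asub; exact: cf.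
  - split.
    + move=> x /subset_itv_oo_cc /inab /dF [] //.
    + by apply: cvg_at_right_filter; apply: cF; apply: inab; rewrite in_itv /= lexx ltW.
    + by apply: cvg_at_left_filter; apply: cF; apply: inab; rewrite in_itv /= lexx ltW.
  - move=> x /subset_itv_oo_cc /inab /dF dFx; rewrite derive1E; exact: derive_val.
rewrite -Uab.
have cvgA : (\int[mu]_(x in A i) (EFin \o f) x @[i --> \oo] -->
    \int[mu]_(x in \bigcup_i A i) (EFin \o f) x)%E.
  apply: ge0_nondecreasing_set_cvg_integral => //.
  - by move=> i; exact: measurable_itv.
  - by move=> i; exact: mEf.
  - by move=> i x _; rewrite lee_fin.
rewrite (@le_lt_trans _ _ (M + M)%:E) ?ltry //.
rewrite -(cvg_lim _ cvgA) //; apply: lime_le; first by apply/cvg_ex; eexists; exact: cvgA.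
exact: nearW.
Qed.

Lemma measurable_inv_sqrt (D : set R) (f : R -> R) : measurable_fun D f ->
  measurable_fun D (fun x => (Num.sqrt (f x))^-1).
Proof.
move=> mf; under eq_fun do rewrite -powR_inv1 ?sqrtr_ge0 //.
apply: (measurableT_comp (measurable_powR _)).
apply: measurableT_comp => //.
by apply: continuous_measurable_fun; exact: sqrt_continuous.
Qed.

Lemma integrable_invsqrt (y a b : R) : a < y -> y < b ->
  mu.-integrable `[a, b]%classic (EFin \o (fun x => (Num.sqrt `|x - y|)^-1)).
Proof.
move=> ay yb; set f : R -> R := fun x : R => (Num.sqrt `|x - y|)^-1.
have mf : measurable_fun setT f.
  apply: measurable_inv_sqrt; apply: measurableT_comp => //.
  exact: measurable_funB.
have f0 x : 0 <= f x by rewrite invr_ge0 sqrtr_ge0.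
have cf x : x != y -> {for x, continuous f}.
  move=> xy; apply: cvgV; first by rewrite gt_eqF // sqrtr_gt0 normr_gt0 subr_eq0.
  apply: continuous_comp; last exact: sqrt_continuous.
  apply: continuous_comp; last exact: norm_continuous.
  by apply: cvgB; [exact: cvg_id|exact: cvg_cst].
(* A primitive on either side of y: s = 1 to the right, s = -1 to the left. *)
pose G (s x : R) := (s * 2) * Num.sqrt (s * (x - y)).
have der (s : R) x : (s = 1) \/ (s = -1) -> 0 < s * (x - y) ->
    is_derive x (1 : R) (G s) (f x).
  move=> hs sxy.
  have e : `|x - y| = s * (x - y).
    by case: hs sxy => -> h; [rewrite mul1r gtr0_norm // -[x - y]mul1r|rewrite mulN1r ltr0_norm //; lra].
  have d1 : is_derive x (1 : R) (fun x => s * (x - y)) s.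
    by apply: is_derive_eq; rewrite /GRing.scale /=; ring.
  have d2 := is_derive1_sqrt sxy.
  have d3 := @is_derive1_comp _ Num.sqrt (fun x => s * (x - y)) x _ _ d2 d1.
  have d4 := @is_deriveZ _ _ _ _ (s * 2) _ _ _ d3.
  apply: (is_derive_eq d4).
  rewrite /f e /GRing.scale /= invfM; set q := (Num.sqrt _)^-1.
  by case: hs => ->; field.
have bnd (s : R) x : (s = 1) \/ (s = -1) -> a <= x <= b -> 
    `|G s x| <= 2 * Num.sqrt (b - a).
  move=> hs /andP[ax xb]; rewrite /G !normrM (ger0_norm (sqrtr_ge0 _)).
  have -> : `|s| = 1 by case: hs => ->; rewrite ?normrN normr1.
  rewrite mul1r (@ger0_norm _ 2) // ler_pM2l // ler_wsqrtr //.
  by case: hs => ->; lra.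
have il : mu.-integrable `[a, y]%classic (EFin \o f).
  apply: (@integrable_bounded_primitive a y (2 * Num.sqrt (b - a)) f (G (-1)) ay mf f0).
  - by move=> x; rewrite in_itv /= => /andP[h1 h2]; apply: cf; rewrite lt_eqF.
  - by move=> x; rewrite in_itv /= => /andP[h1 h2]; apply: der; [right|rewrite mulN1r; lra].
  - by move=> x; rewrite in_itv /= => /andP[h1 h2]; apply: bnd; [right|apply/andP; split; lra].
have ir : mu.-integrable `[y, b]%classic (EFin \o f).
  apply: (@integrable_bounded_primitive y b (2 * Num.sqrt (b - a)) f (G (1)) yb mf f0).
  - by move=> x; rewrite in_itv /= => /andP[h1 h2]; apply: cf; rewrite gt_eqF.
  - by move=> x; rewrite in_itv /= => /andP[h1 h2]; apply: der; [left|rewrite mul1r; lra].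
  - by move=> x; rewrite in_itv /= => /andP[h1 h2]; apply: bnd; [left|apply/andP; split; lra].
have mEf (D : set R) : measurable_fun D ((EFin \o f) : R -> \bar R).
  by apply/measurable_EFinP; exact: measurable_funS mf.
apply/integrableP; split; first exact: mEf.
under eq_integral do rewrite gee0_abs ?lee_fin //.
have -> : `[a, b]%classic = `[a, y]%classic `|` `]y, b]%classic.
  by rewrite -itv_bndbnd_setU // ?bnd_simp ltW.
rewrite ge0_integral_setU //=.
- have abs D : (\int[mu]_(x in D) `|(EFin \o f) x| = \int[mu]_(x in D) (f x)%:E)%E.
    by apply: eq_integral => x _; rewrite gee0_abs ?lee_fin.
  rewrite -!abs.
  apply: lte_add_pinfty; first by have /integrableP[] := il.
  have : mu.-integrable `]y, b]%classic (EFin \o f).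
    by apply: (integrableS _ _ _ ir) => //; exact: subset_itv_oc_cc.
  by case/integrableP.
- exact: mEf.
- by move=> x _; rewrite lee_fin.
- by apply/disj_setPS => x [] /=; rewrite !in_itv /= => /andP[_ h] /andP[]; rewrite ltNge h.
Qed.

End IntegrableSingularities.

(** * Differentiation under the integral sign *)

Section AngleIntegral.
Variable R : realType.
Local Notation mu := (@lebesgue_measure R).

(* Also the derivative for |t| > 1: the root of a negative number is 0, and
   so is the inverse of 0. *)
Definition dacosc (t : R) : R := - (Num.sqrt (1 - t ^+ 2))^-1.

Lemma is_derive_acosc_line (z w : R) : z ^+ 2 != 1 ->
  is_derive (0 : R) (1 : R) (fun d => acosc (z + d * w)) (w * dacosc z).
Proof.
move=> z1.
have [zN1 zp1] : z != -1 /\ z != 1.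
  by split; apply: contra_neq z1 => ->; rewrite ?sqrrN expr1n.
have d1 : is_derive (0 : R) (1 : R) (fun d => z + d * w) w.
  by apply: is_derive_eq; rewrite /GRing.scale /=; ring.
have d2 : is_derive (z + 0 * w) (1 : R) (@acosc R) (dacosc z).
  rewrite mul0r addr0; have h := is_derive_acosc zp1 zN1.
  apply: (is_derive_eq h); rewrite /dacosc; case: ifPn => // hz.
  rewrite ler0_sqrtr ?invr0 ?oppr0 // subr_le0.
  by move: hz; rewrite negb_and -!leNgt => /orP[] hz; nra.
apply: (is_derive_eq (@is_derive1_comp _ (@acosc R) (fun d => z + d * w) 0 _ _ d2 d1)).
by rewrite mulrC.
Qed.

(** Dominated convergence. By [acosc_lip_sing] with t = z x, every difference quotient is at most 4
    |w x| / sqrt |1 - (z x)^2|, a bound free of d, so g dominates all of them at once. The points y1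
    and y2, where (z x)^2 may equal 1, form a null set. *)
Lemma is_derive_angle_integral (al be y1 y2 : R) (z w g : R -> R) :
  let D := `[al, be]%classic in
  measurable_fun D z -> measurable_fun D w ->
  mu.-integrable D (EFin \o g) ->
  (forall x, D x -> x != y1 -> x != y2 -> z x ^+ 2 != 1) ->
  (forall x, D x -> x != y1 -> x != y2 ->
     4 * `|w x| / Num.sqrt `|1 - z x ^+ 2| <= g x) ->
  mu.-integrable D (EFin \o (fun x => w x * dacosc (z x))) /\
  is_derive (0 : R) (1 : R)
    (fun d => \int[mu]_(x in D) acosc (z x + d * w x))
    (\int[mu]_(x in D) (w x * dacosc (z x))).
Proof.
move=> D mz mw ig z1 wg.
have mD : measurable D by exact: measurable_itv.
have mac : measurable_fun setT (@acosc R).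
  by apply: continuous_measurable_fun; exact: continuous_acosc.
have mzd (d : R) : measurable_fun D (fun x => acosc (z x + d * w x)).
  apply: (measurableT_comp mac); apply: measurable_funD => //.
  exact: measurable_funM.
have iac (d : R) : mu.-integrable D (EFin \o (fun x => acosc (z x + d * w x))).
  apply: (@le_integrable _ _ _ mu _ mD _ (EFin \o cst pi)).
  - by apply/measurable_EFinP; exact: mzd.
  - move=> x _ /=; rewrite lee_fin.
    have /andP[a0 api] := acosc_itv (z x + d * w x).
    by rewrite !ger0_norm // (le_trans a0).
  - apply: (@continuous_compact_integrable R (cst pi)).
      exact: segment_compact.
    by apply: continuous_subspaceT => x; exact: cst_continuous.
have ae12 (Q : R -> Prop) : (forall x, x != y1 -> x != y2 -> Q x) ->
    {ae mu, forall x, Q x}.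
  move=> hQ; exists [set y1; y2]; split.
  - by apply: measurableU; exact: measurable_set1.
  - apply: countable_lebesgue_measure0; apply: finite_set_countable.
    exact: finite_set2.
  - move=> x /= nQ; have [->|x1] := eqVneq x y1; first by left.
    have [->|x2] := eqVneq x y2; first by right.
    by case: nQ; exact: hQ.
pose G d := \int[mu]_(x in D) acosc (z x + d * w x).
pose L := \int[mu]_(x in D) (w x * dacosc (z x)).
(* The convergence theorem is about sequences, so the limit is taken along an arbitrary one;
   integrability of the limit comes out of the same application. *)
have key : forall u : R^nat, (forall n, u n != 0) -> u n @[n --> \oo] --> (0 : R) ->
    mu.-integrable D (EFin \o (fun x => w x * dacosc (z x))) /\
    (u n)^-1 *: (G (u n) - G 0) @[n --> \oo] --> L.
  move=> u u0 ucv.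
  pose q n x := (u n)^-1 * (acosc (z x + u n * w x) - acosc (z x + 0 * w x)).
  have mq n : measurable_fun D (q n).
    by apply: measurable_funM => //; apply: measurable_funB; exact: mzd.
  have qcv : {ae mu, forall x, D x -> (EFin \o q n) x @[n --> \oo] --> (EFin \o (fun x => w x * dacosc (z x))) x}.
    apply: ae12 => x x1 x2 Dx.
    apply: cvg_EFin; first exact: nearW.
    have [dv dE] := is_derive_acosc_line (w x) (z1 x Dx x1 x2).
    pose k d := acosc (z x + d * w x).
    have dv' : h^-1 *: (k (h *: (1 : R) + 0) - k 0) @[h --> 0^'] --> w x * dacosc (z x).
      by rewrite -dE; exact: dv.
    have := (cvgr_dnbhsP _ _ _).1 dv' u (conj u0 ucv).
    apply: cvg_trans; apply: near_eq_cvg; apply: nearW => n.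
    by rewrite /q /k addr0 /GRing.scale /= mulr1.
  have qle : {ae mu, forall x n, D x -> (`|(EFin \o q n) x| <= (EFin \o g) x)%E}.
    apply: ae12 => x x1 x2 n Dx /=; rewrite lee_fin.
    apply: le_trans (wg x Dx x1 x2).
    have s0 : 0 < Num.sqrt `|1 - z x ^+ 2|.
      by rewrite sqrtr_gt0 normr_gt0 subr_eq0 eq_sym z1.
    rewrite ler_pdivlMr // /q mul0r addr0 normrM -mulrA normfV.
    rewrite ler_pdivrMl ?normr_gt0 //.
    apply: (le_trans (acosc_lip_sing _ _)).
    by rewrite addrAC subrr add0r normrM mulrCA.
  have mf : measurable_fun D (EFin \o (fun x => w x * dacosc (z x))).
    apply/measurable_EFinP; apply: measurable_funM => //.
    under eq_fun do rewrite /dacosc -mulN1r.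
    apply: measurable_funM => //; apply: measurable_inv_sqrt.
    apply: measurable_funB => //; exact: measurable_funX.
  have [iL _ cv] := @dominated_convergence _ _ _ mu D mD (fun n => EFin \o q n)
    (EFin \o (fun x => w x * dacosc (z x))) (EFin \o g)
    (fun n => (measurable_EFinP _ _).2 (mq n)) mf qcv ig qle.
  split => //.
  have qE n : (u n)^-1 *: (G (u n) - G 0) = fine (\int[mu]_(x in D) (EFin \o q n) x).
    rewrite -[RHS]/(\int[mu]_(x in D) ((u n)^-1 *
      (acosc (z x + u n * w x) - acosc (z x + 0 * w x)))).
    have iB : mu.-integrable D
        (EFin \o (fun x => acosc (z x + u n * w x) - acosc (z x + 0 * w x))).
      exact: (@integrableB _ _ _ mu D mD _ _ (iac (u n)) (iac 0)).
    rewrite (@RintegralZl _ _ _ mu _ _ _ _ iB); last exact: measurable_itv.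
    by rewrite (@RintegralB _ _ _ mu _ _ _ _ (iac (u n)) (iac 0)) //;
      exact: measurable_itv.
  under eq_fun do rewrite qE.
  apply: fine_cvg; rewrite /L /Rintegral fineK //.
  exact: integrable_fin_num.
(* Integrability does not involve the sequence, so any one will do. *)
have [iL _] : mu.-integrable D (EFin \o (fun x => w x * dacosc (z x))) /\
   (harmonic n)^-1 *: (G (harmonic n) - G 0) @[n --> \oo] --> L.
  by apply: key; [move=> n; rewrite gt_eqF // harmonic_gt0|exact: cvg_harmonic].
split => //.
have cv : h^-1 *: (G (h *: (1 : R) + 0) - G 0) @[h --> 0^'] --> L.
  apply/cvgr_dnbhsP => u [u0 ucv].
  have [_] := key u u0 ucv.
  by under [X in _ -> X @ _ --> _]eq_fun do rewrite addr0 /GRing.scale /= mulr1.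
apply: DeriveDef; first by apply/cvg_ex; exists L.
exact: cvg_lim cv.
Qed.

End AngleIntegral.

(** * Persistence of pairs of simple roots *)

Section Wells.
Variable R : realType.
Implicit Types p q : {poly R}.

(** The ends lo and hi themselves belong to the region of positivity: strict signs on compact pieces
    survive small perturbations, and two wells can share an end. *)
Definition well p (lo hi y1 y2 : R) : Prop :=
  [/\ lo < y1 /\ y2 < hi, y1 < y2, p.[y1] = 0 /\ p.[y2] = 0 &
   forall x, lo <= x <= hi ->
     [/\ x < y1 -> 0 < p.[x], y1 < x < y2 -> p.[x] < 0 & y2 < x -> 0 < p.[x]]].

(** The tail is kept in the form [roots p y2 b], so that a second well further right can be peeled
    off in the same way; this is how the third and fourth roots are reached. *)
Lemma roots_well p (a b lo hi y1 y2 : R) : well p lo hi y1 y2 ->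
  a <= lo -> hi <= b -> (forall x, a < x < lo -> p.[x] != 0) ->
  roots p a b = y1 :: y2 :: roots p y2 b.
Proof.
move=> [[lo1 hi2] y12 [py1 py2] sgn] alo hib np.
have p0 : p != 0.
  apply/eqP => p0; have [|h _ _] := sgn lo; first by apply/andP; split; lra.
  by have := h lo1; rewrite p0 horner0 ltxx.
have nroots c d : (forall x, c < x < d -> p.[x] != 0) -> roots p c d = [::].
  move=> h; have := @in_roots R p c d; case: (roots p c d) => // x s /(_ x).
  rewrite mem_head in_itv /= p0 andbT => /esym/andP[/rootP px xcd].
  by have := h x xcd; rewrite px eqxx.
apply/eqP; rewrite roots_cons p0 in_itv /= rootE py1 eqxx /=.
apply/and3P; split; first by apply/andP; split; lra.
  apply/eqP/nroots => x /andP[ax xy1].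
  have [xlo|lox] := ltP x lo; first by rewrite np // ax.
  have [|h _ _] := sgn x; first by apply/andP; split; lra.
  by rewrite gt_eqF // h.
rewrite roots_cons p0 in_itv /= rootE py2 !eqxx /= andbT.
apply/andP; split; first by apply/andP; split; lra.
apply/eqP/nroots => x h12; have /andP[h1 h2] := h12.
have [|_ h _] := sgn x; first by apply/andP; split; lra.
by rewrite lt_eqF // h.
Qed.

Lemma continuous_itv_gt0 (f : R -> R) (a b : R) : continuous f ->
  (forall x, a <= x <= b -> 0 < f x) ->
  exists2 m, 0 < m & forall x, a <= x <= b -> m <= f x.
Proof.
move=> cf f0; have [ab|ba] := leP a b; last first.
  by exists 1 => // x /andP[h1 h2]; lra.
have [c] := @EVT_min R f a b ab (continuous_subspaceT cf).
rewrite in_itv /= => cab cmin; exists (f c); first exact: f0.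
by move=> x xab; apply: cmin; rewrite in_itv.
Qed.

Lemma continuous_itv_bounded (f : R -> R) (a b : R) : continuous f ->
  exists2 M, 0 < M & forall x, a <= x <= b -> `|f x| <= M.
Proof.
move=> cf; have [ab|ba] := leP a b; last first.
  by exists 1 => // x /andP[h1 h2]; lra.
have cn : continuous (fun x => `|f x|).
  by move=> x; apply: continuous_comp; [exact: cf|exact: norm_continuous].
have [c _ cmax] := @EVT_max R (fun x => `|f x|) a b ab (continuous_subspaceT cn).
exists (`|f c| + 1); first by rewrite ltr_wpDl.
move=> x xab; apply: (@le_trans _ _ `|f c|); last by rewrite lerDl.
by apply: cmax; rewrite in_itv.
Qed.

Lemma near0_norm_lt (e : R) : 0 < e -> \forall d \near (0 : R), `|d| < e.
Proof. by move=> e0; exists e => //= d; rewrite /= sub0r normrN. Qed.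

(** The perturbation is quadratic in d because P is the square of an affine expression in d minus a
    fixed term. For |d| < 1 both increments are at most |d| times a bound on the compact
    interval. *)
Lemma near_pos_itv p p1 p2 (a b : R) : (forall x, a <= x <= b -> 0 < p.[x]) ->
  \forall d \near (0 : R), forall x, a <= x <= b ->
    0 < (p + d *: p1 + d ^+ 2 *: p2).[x].
Proof.
move=> ppos; have [m m0 mp] := continuous_itv_gt0 (@continuous_horner R p) ppos.
have [M1 M10 hM1] := continuous_itv_bounded a b (@continuous_horner R p1).
have [M2 M20 hM2] := continuous_itv_bounded a b (@continuous_horner R p2).
near=> d => x xab; rewrite !hornerE.
have d1 : `|d| < 1 by near: d; apply: near0_norm_lt.
have dm : `|d| < m / (M1 + M2).
  by near: d; apply: near0_norm_lt; rewrite divr_gt0 // addr_gt0.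
have e1 : `|d * p1.[x]| <= `|d| * M1 by rewrite normrM ler_wpM2l // hM1.
have e2 : `|d ^+ 2 * p2.[x]| <= `|d| * M2.
  rewrite normrM normrX ler_pM ?hM2 // expr2 ler_piMr // ltW //.
have hm := mp x xab.
have {}dm : `|d| * (M1 + M2) < m by rewrite -ltr_pdivlMr // addr_gt0.
by move: e1 e2; rewrite !ler_norml => /andP[e1 _] /andP[e2 _]; lra.
Unshelve. all: by end_near. Qed.

Lemma deriv_neg_itv p (a b : R) : (forall x, a <= x <= b -> p^`().[x] < 0) ->
  forall x y, a <= x -> x < y -> y <= b -> p.[y] < p.[x].
Proof.
move=> dp x y ax xy yb; have [c] := poly_mvt p xy.
rewrite in_itv /= => /andP[xc cy] e; rewrite -subr_lt0 e pmulr_llt0 ?subr_gt0 //.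
by apply: dp; apply/andP; split; lra.
Qed.

(** All that is required is strict inequalities on closed intervals: for the sign of p away from the
    roots, and for that of p' on two bands, [a, b] and [c, d], each holding one root. Such a
    criterion is stable under perturbation, which the definition of [well] does not show. *)
Lemma well_intro p (lo hi a b c d : R) :
  lo <= a -> a < b -> b < c -> c < d -> d <= hi ->
  (forall x, lo <= x <= a -> 0 < p.[x]) ->
  (forall x, a <= x <= b -> p^`().[x] < 0) ->
  (forall x, b <= x <= c -> p.[x] < 0) ->
  (forall x, c <= x <= d -> 0 < p^`().[x]) ->
  (forall x, d <= x <= hi -> 0 < p.[x]) ->
  exists z1 z2, [/\ a < z1, z2 < d & well p lo hi z1 z2].
Proof.
move=> loa ab bc cd dhi s1 s4 s2 s5 s3.
have mon1 := deriv_neg_itv s4.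
have mon2 x y : c <= x -> x < y -> y <= d -> p.[x] < p.[y].
  have := @deriv_neg_itv (- p) c d _ x y.
  rewrite !hornerN ltrN2; apply => t; rewrite derivN hornerN oppr_lt0; exact: s5.
have qa : 0 < p.[a] by apply: s1; rewrite loa /=.
have qb : p.[b] < 0 by apply: s2; rewrite lexx ltW.
have qc : p.[c] < 0 by apply: s2; rewrite lexx ltW.
have qd : 0 < p.[d] by apply: s3; rewrite lexx.
have m1 : p.[a] * p.[b] < 0 by rewrite pmulr_rlt0.
have [z1 + /rootP pz1] := poly_ivtoo (ltW ab) m1.
have m2 : p.[c] * p.[d] < 0 by rewrite pmulr_llt0.
have [z2 + /rootP pz2] := poly_ivtoo (ltW cd) m2.
rewrite !in_itv /= => /andP[cz2 z2d] /andP[az1 z1b].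
have z12 : z1 < z2 := lt_trans z1b (lt_trans bc cz2).
exists z1, z2; split => //; split => //.
  by rewrite (le_lt_trans loa az1) (lt_le_trans z2d dhi).
move=> x /andP[lox xhi]; split=> [xz|/andP[xz1 xz2]|zx].
- have [h|/ltW h] := leP x a; first by apply: s1; rewrite lox.
  by rewrite -pz1; apply: mon1 => //; exact: ltW.
- have [h|/ltW h] := leP x b.
    by rewrite -pz1; apply: mon1 => //; exact: ltW.
  have [k|/ltW k] := leP x c; first by apply: s2; rewrite h.
  by rewrite -pz2; apply: mon2 => //; exact: ltW.
- have [h|/ltW h] := leP x d.
    by rewrite -pz2; apply: mon2 => //; exact: ltW.
  by apply: s3; rewrite h.
Qed.

Lemma near_well p p1 p2 (lo hi al be y1 y2 : R) : well p lo hi y1 y2 ->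
  p^`().[y1] < 0 -> 0 < p^`().[y2] ->
  lo <= al -> al < y1 -> y2 < be -> be <= hi ->
  \forall d \near (0 : R), exists z1 z2, [/\ al < z1, z2 < be &
    well (p + d *: p1 + d ^+ 2 *: p2) lo hi z1 z2].
Proof.
move=> [[lo1 hi2] y12 [py1 py2] sgn] d1 d2 loal al1 be2 behi.
have cp' := @continuous_horner R p^`().
have [e1 /= e10 he1] : \forall x \near y1, p^`().[x] < 0.
  by apply: (cvgr_lt _ (cp' y1)).
have [e2 /= e20 he2] : \forall x \near y2, 0 < p^`().[x].
  by apply: (cvgr_gt _ (cp' y2)).
(* The halves keep the closed bands inside the neighbourhoods where p' has a sign and inside ]al,
   be[; the third keeps the two bands apart. *)
pose e := Num.min (Num.min (e1 / 2) (e2 / 2))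
  (Num.min (Num.min ((y1 - al) / 2) ((be - y2) / 2)) ((y2 - y1) / 3)).
have : 0 < e by rewrite !lt_min !divr_gt0 // subr_gt0.
have : [/\ e <= e1 / 2, e <= e2 / 2, e <= (y1 - al) / 2, e <= (be - y2) / 2 & e <= (y2 - y1) / 3].
  by rewrite /e; split; rewrite !ge_min lexx ?orbT.
move: e => e [ee1 ee2 eal ebe e12] e0.
have dneg x : y1 - e <= x <= y1 + e -> p^`().[x] < 0.
  by move=> /andP[h1 h2]; apply: he1; rewrite /ball /= ltr_norml; apply/andP; split; lra.
have dpos x : y2 - e <= x <= y2 + e -> 0 < p^`().[x].
  by move=> /andP[h1 h2]; apply: he2; rewrite /ball /= ltr_norml; apply/andP; split; lra.
have qE d : - (p + d *: p1 + d ^+ 2 *: p2) = - p + d *: (- p1) + d ^+ 2 *: (- p2).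
  by rewrite !opprD !scalerN.
have qdE d : (p + d *: p1 + d ^+ 2 *: p2)^`() = p^`() + d *: p1^`() + d ^+ 2 *: p2^`().
  by rewrite !derivD !derivZ.
have [la lb lbc] : [/\ al <= y1 - e, y2 + e <= be & y1 + e < y2 - e] by split; lra.
clear ee1 ee2 eal ebe e12.
have N1 : \forall d \near (0 : R), forall x, lo <= x <= y1 - e ->
    0 < (p + d *: p1 + d ^+ 2 *: p2).[x].
  apply: near_pos_itv => x /andP[h1 h2].
  by have [|h _ _] := sgn x; [apply/andP; split; lra|apply: h; lra].
have N2 : \forall d \near (0 : R), forall x, y1 + e <= x <= y2 - e ->
    0 < (- p + d *: (- p1) + d ^+ 2 *: (- p2)).[x].
  apply: near_pos_itv => x /andP[h1 h2]; rewrite hornerN oppr_gt0.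
  by have [|_ h _] := sgn x; [apply/andP; split; lra|apply: h; apply/andP; split; lra].
have N3 : \forall d \near (0 : R), forall x, y2 + e <= x <= hi ->
    0 < (p + d *: p1 + d ^+ 2 *: p2).[x].
  apply: near_pos_itv => x /andP[h1 h2].
  by have [|_ _ h] := sgn x; [apply/andP; split; lra|apply: h; lra].
have N4 : \forall d \near (0 : R), forall x, y1 - e <= x <= y1 + e ->
    0 < (- p^`() + d *: (- p1^`()) + d ^+ 2 *: (- p2^`())).[x].
  by apply: near_pos_itv => x /dneg; rewrite hornerN oppr_gt0.
have N5 : \forall d \near (0 : R), forall x, y2 - e <= x <= y2 + e ->
    0 < (p^`() + d *: p1^`() + d ^+ 2 *: p2^`()).[x].
  by apply: near_pos_itv => x /dpos.
near=> d.
have s1 : forall x, lo <= x <= y1 - e -> 0 < (p + d *: p1 + d ^+ 2 *: p2).[x].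
  by near: d; exact: N1.
have N2d : forall x, y1 + e <= x <= y2 - e ->
    0 < (- p + d *: (- p1) + d ^+ 2 *: (- p2)).[x] by near: d; exact: N2.
have s3 : forall x, y2 + e <= x <= hi -> 0 < (p + d *: p1 + d ^+ 2 *: p2).[x].
  by near: d; exact: N3.
have N4d : forall x, y1 - e <= x <= y1 + e ->
    0 < (- p^`() + d *: (- p1^`()) + d ^+ 2 *: (- p2^`())).[x].
  by near: d; exact: N4.
have N5d : forall x, y2 - e <= x <= y2 + e ->
    0 < (p^`() + d *: p1^`() + d ^+ 2 *: p2^`()).[x] by near: d; exact: N5.
move: s1 s3; set q := p + _ + _ => s1 s3.
have s2 x : y1 + e <= x <= y2 - e -> q.[x] < 0.
  by move=> hx; rewrite -oppr_gt0 -hornerN qE; exact: N2d.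
have s4 x : y1 - e <= x <= y1 + e -> q^`().[x] < 0.
  move=> hx; rewrite -oppr_gt0 -hornerN /q -derivN qE !derivD !derivZ !derivN.
  exact: N4d.
have s5 x : y2 - e <= x <= y2 + e -> 0 < q^`().[x].
  by move=> hx; rewrite /q qdE; exact: N5d.
have [||||||||||z1 [z2 [az1 z2d wz]]] :=
    @well_intro q lo hi (y1 - e) (y1 + e) (y2 - e) (y2 + e) => //.
- exact: le_trans loal la.
- by rewrite ltrD2l gtrN.

- by rewrite ltrD2l gtrN.
- exact: le_trans lb behi.
exists z1, z2; split=> //; [exact: le_lt_trans la az1|exact: lt_le_trans z2d lb].
Unshelve. all: by end_near. Qed.

End Wells.

(** * Domination by inverse square roots of the distances to the roots *)

Section InverseSqrtPoly.
Variable R : realType.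
Local Notation mu := (@lebesgue_measure R).

(** As the roots are simple, p = q (X - y1) (X - y2) with q bounded away from 0. With s, t the
    square roots of the distances to y1 and y2, s + t >= sqrt (y2 - y1), hence 1 / (s t) <= (1 / s +
    1 / t) / sqrt (y2 - y1): the product of singularities becomes a sum. *)
Lemma invsqrt_poly_le (p : {poly R}) (a b y1 y2 : R) : y1 < y2 ->
  p.[y1] = 0 -> p.[y2] = 0 -> p^`().[y1] != 0 -> p^`().[y2] != 0 ->
  (forall x, a <= x <= b -> x != y1 -> x != y2 -> p.[x] != 0) ->
  exists2 C, 0 <= C & forall x, a <= x <= b -> (Num.sqrt `|p.[x]|)^-1 <=
    C * ((Num.sqrt `|x - y1|)^-1 + (Num.sqrt `|x - y2|)^-1).
Proof.
move=> y12 py1 py2 d1 d2 np.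
have [q pq] : exists q, p = q * ('X - y1%:P) * ('X - y2%:P).
  have /factor_theorem[q1 e1] : root p y1 by apply/rootP.
  have /factor_theorem[q e2] : root q1 y2.
    apply/rootP; move: py2; rewrite e1 !hornerE => /eqP.
    by rewrite mulf_eq0 subr_eq0 (gt_eqF y12) orbF => /eqP.
  by exists q; rewrite e1 e2 mulrAC.
have q0 x : a <= x <= b -> q.[x] != 0.
  move=> xab; have [->|x1] := eqVneq x y1.
    by apply: contra_neq d1 => q0; rewrite pq !(derivM, derivB, derivX, derivC, hornerE) q0; ring.
  have [->|x2] := eqVneq x y2.
    by apply: contra_neq d2 => q0; rewrite pq !(derivM, derivB, derivX, derivC, hornerE) q0; ring.
  by apply: contra_neq (np x xab x1 x2) => q0; rewrite pq !hornerE q0; ring.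
have cq : continuous (fun x => `|q.[x]|).
  move=> x; apply: continuous_comp; last exact: norm_continuous.
  exact: continuous_horner.
have [|m m0 hm] := @continuous_itv_gt0 R _ a b cq.
  by move=> x /q0; rewrite normr_gt0.
pose k := Num.sqrt (y2 - y1).
have k0 : 0 < k by rewrite sqrtr_gt0 subr_gt0.
have sm0 : 0 < Num.sqrt m by rewrite sqrtr_gt0.
exists ((Num.sqrt m)^-1 * k^-1); first by rewrite mulr_ge0 // invr_ge0 ltW.
move=> x xab.
set s := Num.sqrt `|x - y1|; set t := Num.sqrt `|x - y2|.
have s0 : 0 <= s by exact: sqrtr_ge0.
have t0 : 0 <= t by exact: sqrtr_ge0.
have pE : Num.sqrt `|p.[x]| = Num.sqrt `|q.[x]| * s * t.
  by rewrite pq !hornerE !normrM !sqrtrM.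
(* At y1, and likewise at y2, the left side is 0 by the convention on the inverse of 0. *)
have [s00|sN0] := eqVneq s 0.
  by rewrite pE s00 mulr0 mul0r !invr0 add0r !mulr_ge0 ?invr_ge0 // ltW.
have [t00|tN0] := eqVneq t 0.
  by rewrite pE t00 mulr0 !invr0 addr0 !mulr_ge0 ?invr_ge0 // ltW.
have {}s0 : 0 < s by rewrite lt_neqAle eq_sym sN0.
have {}t0 : 0 < t by rewrite lt_neqAle eq_sym tN0.
have kst : k <= s + t.
  rewrite -(@ler_pXn2r _ 2) ?nnegrE ?addr_ge0 ?(ltW k0) ?(ltW s0) ?(ltW t0) //.
  rewrite sqr_sqrtr ?subr_ge0 ?(ltW y12) //.
  have -> : (s + t) ^+ 2 = `|x - y1| + `|x - y2| + 2 * (s * t).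
    by rewrite -(@sqr_sqrtr _ `|x - y1|) // -(@sqr_sqrtr _ `|x - y2|) // /s /t; ring.
  have h1 : 0 < s * t by exact: mulr_gt0.
  have h2 := ler_norm (x - y1); have h3 := ler_norm (- (x - y2)).
  by rewrite normrN in h3; lra.
have -> : s^-1 + t^-1 = (s + t) / (s * t).
  by field; rewrite sN0 tN0.
have st0 : 0 < s * t by exact: mulr_gt0.
rewrite pE -mulrA invfM.
rewrite mulrA ler_pM2r ?invr_gt0 //.
rewrite -[leRHS]mulrA; apply: (@le_trans _ _ (Num.sqrt m)^-1).
  rewrite lef_pV2 ?posrE // ?sqrtr_gt0 ?normr_gt0 ?q0 //.
  by rewrite ler_wsqrtr // hm.
by rewrite -[leLHS]mulr1 ler_pM2l ?invr_gt0 // mulrC ler_pdivlMr // mul1r.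
Qed.

Lemma integrable_invsqrt2 (C a b y1 y2 : R) : a < y1 -> y1 < y2 -> y2 < b ->
  mu.-integrable `[a, b]%classic (EFin \o (fun x =>
    C * ((Num.sqrt `|x - y1|)^-1 + (Num.sqrt `|x - y2|)^-1))).
Proof.
move=> a1 y12 b2.
have i1 := integrable_invsqrt a1 (lt_trans y12 b2).
have i2 := integrable_invsqrt (lt_trans a1 y12) b2.
have mD : measurable (`[a, b]%classic : set (measurableTypeR R)) by exact: measurable_itv.
have i3 := @integrableD _ _ _ mu _ mD _ _ i1 i2.
exact: (@integrableZl _ _ _ mu _ mD C _ i3).
Qed.

End InverseSqrtPoly.

(** * Derivative of the clamped integral around one arc *)

Section PiPoly.
Variable R : realType.
Local Notation mu := (@lebesgue_measure R).
Implicit Types A B E : R.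

Definition num_poly A B E : {poly R} := (B / 2) *: 'X^2 + A *: 'X - E%:P.

Definition P_poly A B E : {poly R} := num_poly A B E ^+ 2 - (1 - 'X) ^+ 3 * 'X.

(* [om = -1] moves the energy, [om = 'X] moves a_1. *)
Definition num_line A B E (om : {poly R}) (d : R) : {poly R} :=
  num_poly A B E + d *: om.

Definition P_line A B E om d : {poly R} :=
  num_line A B E om d ^+ 2 - (1 - 'X) ^+ 3 * 'X.

Lemma num_line_energy A B E d : num_line A B E (-1) d = num_poly A B (E + d).
Proof. by rewrite /num_line /num_poly polyCD scalerN opprD addrA alg_polyC. Qed.

Lemma num_line_slope A B E d : num_line A B E 'X d = num_poly (A + d) B E.
Proof. by rewrite /num_line /num_poly scalerDl addrAC addrA. Qed.

Lemma P_lineE A B E om d : P_line A B E om d =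
  P_poly A B E + d *: (2%:P * num_poly A B E * om) + d ^+ 2 *: om ^+ 2.
Proof.
by rewrite /P_line /P_poly /num_line -!mul_polyC !polyC_exp; ring.
Qed.

Lemma num_polyE A B E x : (num_poly A B E).[x] = afun A B x - E.
Proof. by rewrite /num_poly /afun !hornerE; ring. Qed.

Lemma bfun_gt0 (x : R) : 0 < x < 1 -> 0 < bfun x.
Proof.
move=> /andP[x0 x1]; rewrite sqrtr_gt0 mulr_gt0 // exprn_gt0 //.
by rewrite subr_gt0.
Qed.

Lemma bfun_sqr (x : R) : 0 <= x <= 1 -> bfun x ^+ 2 = (1 - x) ^+ 3 * x.
Proof.
move=> /andP[x0 x1]; rewrite sqr_sqrtr // mulr_ge0 // exprn_ge0 //.
by rewrite subr_ge0.
Qed.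

Lemma P_lineE' A B E om d x : 0 <= x <= 1 ->
  (P_line A B E om d).[x] = (num_line A B E om d).[x] ^+ 2 - bfun x ^+ 2.
Proof. by move=> /bfun_sqr ->; rewrite /P_line !hornerE. Qed.

Definition zfun A B E om d (x : R) : R := - (num_line A B E om d).[x] / bfun x.

Lemma continuous_bfun : continuous (@bfun R).
Proof.
move=> x; apply: continuous_comp; last exact: sqrt_continuous.
have -> : (fun x : R => (1 - x) ^+ 3 * x) = horner ((1 - 'X) ^+ 3 * 'X).
  by apply/funext => y; rewrite !hornerE.
exact: continuous_horner.
Qed.

Lemma continuous_zfun A B E om d x : 0 < x < 1 ->
  {for x, continuous (zfun A B E om d)}.
Proof.
move=> x01; apply: cvgM; first by apply: cvgN; exact: continuous_horner.
by apply: cvgV; [rewrite gt_eqF // bfun_gt0|exact: continuous_bfun].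
Qed.

Lemma zfun_line A B E om d x :
  zfun A B E om d x = zfun A B E om 0 x + d * (- om.[x] / bfun x).
Proof.
rewrite /zfun /num_line !(hornerD, hornerZ) mul0r addr0.
by move: (bfun x)^-1 => b; ring.
Qed.

(** This is [pi] times [W]. Off the arc P >= 0, and there the conventions on roots of negative
    numbers and on the inverse of 0 make it vanish. *)
Definition Vfun A B E (x : R) : R := (Num.sqrt (- (P_poly A B E).[x]))^-1.

(** Since z = -N / b, multiplying 1 - z^2 by b^2 gives -P. Moving b > 0 under the root is legitimate
    for either sign of 1 - z^2. *)
Lemma dacosc_zfun A B E om x : 0 < x < 1 ->
  (bfun x)^-1 * dacosc (zfun A B E om 0 x) = - Vfun A B E x.
Proof.
move=> x01; have b0 := bfun_gt0 x01; have /andP[x0 x1] := x01.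
rewrite /dacosc mulrN /Vfun -invfM; congr (- _^-1).
rewrite -[in LHS](gtr0_norm b0) -sqrtr_sqr -sqrtrM ?sqr_ge0 //; congr Num.sqrt.
have -> : P_poly A B E = P_line A B E om 0 by rewrite /P_line /num_line scale0r addr0.
rewrite P_lineE' ?(ltW x0) ?(ltW x1) // /zfun.
by field; rewrite gt_eqF.
Qed.

Lemma measurable_itv_cont (f : R -> R) (al be : R) : 0 < al -> be < 1 ->
  (forall x, 0 < x < 1 -> {for x, continuous f}) ->
  measurable_fun (`[al, be]%classic : set R) f.
Proof.
move=> al0 be1 cf; apply: subspace_continuous_measurable_fun.
  exact: measurable_itv.
apply: continuous_in_subspaceT => x /set_mem; rewrite /= in_itv /= => /andP[h1 h2].
by apply: cf; apply/andP; split; [exact: lt_le_trans h1|exact: le_lt_trans be1].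
Qed.

(** The increment of the argument is -d om / b, so the quantity to dominate is 4 |om| / sqrt |P|,
    the factor b being absorbed in the root, and [invsqrt_poly_le] applies. *)
Lemma well_arc A B E om lo hi y1 y2 al be :
  well (P_poly A B E) lo hi y1 y2 ->
  (P_poly A B E)^`().[y1] < 0 -> 0 < (P_poly A B E)^`().[y2] ->
  0 <= lo -> hi <= 1 -> lo < al -> al < y1 -> y2 < be -> be < hi ->
  mu.-integrable `[y1, y2]%classic (EFin \o (fun x => om.[x] * Vfun A B E x)) /\
  is_derive (0 : R) (1 : R)
    (fun d => \int[mu]_(x in `[al, be]) acosc (zfun A B E om d x))
    (\int[mu]_(x in `[y1, y2]) (om.[x] * Vfun A B E x)).
Proof.
move=> wP d1 d2 lo0 hi1 loal al1 be2 behi.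
have [_ y12 [py1 py2] sgn] := wP.
have al0 : 0 < al by exact: le_lt_trans loal.
have be1 : be < 1 by exact: lt_le_trans hi1.
have in01 x : al <= x <= be -> 0 < x < 1.
  by move=> /andP[h1 h2]; rewrite (lt_le_trans al0 h1) (le_lt_trans h2 be1).
have lohi x : al <= x <= be -> lo <= x <= hi.
  by move=> /andP[h1 h2]; rewrite (le_trans (ltW loal) h1) (le_trans h2 (ltW behi)).
have np x : al <= x <= be -> x != y1 -> x != y2 -> (P_poly A B E).[x] != 0.
  move=> /lohi /sgn[h1 h2 h3] n1 n2.
  have [xy|xy|xy] := ltgtP x y1; [by rewrite gt_eqF // h1| |by rewrite xy eqxx in n1].
  have [yx|yx|yx] := ltgtP x y2; [by rewrite lt_eqF // h2 // xy
    |by rewrite gt_eqF // h3|by rewrite yx eqxx in n2].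
have [C C0 hC] := invsqrt_poly_le y12 py1 py2 (ltr0_neq0 d1) (lt0r_neq0 d2) np.
have [M M0 hM] := continuous_itv_bounded al be (@continuous_horner R om).
have P0 : P_poly A B E = P_line A B E om 0 by rewrite /P_line /num_line scale0r addr0.
pose D := `[al, be]%classic : set R.
have Dx x : D x -> al <= x <= be by rewrite /D /= in_itv.
have bz x : al <= x <= be -> bfun x ^+ 2 * (1 - zfun A B E om 0 x ^+ 2) = - (P_poly A B E).[x].
  move=> /in01 x01; have b0 := bfun_gt0 x01; have /andP[x0 x1] := x01.
  rewrite P0 P_lineE' ?(ltW x0) ?(ltW x1) // /zfun.
  by field; rewrite gt_eqF.
(* The factor 4 comes from [acosc_lip_sing], M bounds om on [al, be], and C is the constant of
   [invsqrt_poly_le]. *)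
have [] := @is_derive_angle_integral R al be y1 y2 (zfun A B E om 0)
  (fun x => - om.[x] / bfun x)
  (fun x => (4 * M * C) * ((Num.sqrt `|x - y1|)^-1 + (Num.sqrt `|x - y2|)^-1)).
- by apply: measurable_itv_cont => // x; exact: continuous_zfun.
- apply: measurable_itv_cont => // x x01.
  apply: cvgM; first by apply: cvgN; exact: continuous_horner.
  by apply: cvgV; [rewrite gt_eqF // bfun_gt0|exact: continuous_bfun].
- exact: integrable_invsqrt2.
- move=> x /Dx xab n1 n2; apply: contra_neq (np x xab n1 n2) => z1.
  by apply/eqP; rewrite -oppr_eq0 -bz // z1 subrr mulr0.
- move=> x /Dx xab n1 n2.
  have b0 := bfun_gt0 (in01 x xab).
  rewrite normrM normrN normfV (gtr0_norm b0) -!mulrA.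
  rewrite ler_pM2l // [leRHS]mulrC -[leRHS]mulrA.
  have -> : (bfun x)^-1 / Num.sqrt `|1 - zfun A B E om 0 x ^+ 2| =
      (Num.sqrt `|(P_poly A B E).[x]|)^-1.
    rewrite -invfM; congr (_^-1).
    rewrite -[in LHS](gtr0_norm b0) -sqrtr_sqr -sqrtrM ?sqr_ge0 //.
    congr Num.sqrt; rewrite -[in RHS]normrN -bz // normrM.
    by rewrite (ger0_norm (sqr_ge0 (bfun x))).
  rewrite mulrA [leRHS]mulrC.
  by apply: ler_pM; rewrite ?invr_ge0 ?sqrtr_ge0 ?hM ?hC.
have fE x : D x -> - om.[x] / bfun x * dacosc (zfun A B E om 0 x) = om.[x] * Vfun A B E x.
  by move=> /Dx /in01 x01; rewrite -mulrA dacosc_zfun // mulrNN.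
have sub : `[y1, y2]%classic `<=` D.
  move=> x; rewrite /D /= !in_itv /= => /andP[h1 h2].
  by rewrite (le_trans (ltW al1) h1) (le_trans h2 (ltW be2)).
move=> iD dD.
have iD' : mu.-integrable D (EFin \o (fun x => om.[x] * Vfun A B E x)).
  have := iD; apply: eq_integrable; first exact: measurable_itv.
  by move=> x /set_mem Dx0; rewrite /= fE.
split.
  by apply: integrableS iD' => //; exact: measurable_itv.
(* On [al, be] outside [y1, y2] the function [Vfun] vanishes, so the integral over the arc equals
   the one over the fixed interval. *)
have -> : \int[mu]_(x in `[y1, y2]) (om.[x] * Vfun A B E x) =
   \int[mu]_(x in `[al, be]) (- om.[x] / bfun x * dacosc (zfun A B E om 0 x)).
  rewrite Rintegral_mkcond [RHS]Rintegral_mkcond; congr fine.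
  apply: eq_integral => x _; rewrite !patchE.
  case: ifPn => h1; case: ifPn => h2 //.
  - by rewrite fE //; exact: set_mem.
  - by move/negP: h2; case; apply/mem_set/sub; exact: set_mem.
  - have Dx0 := set_mem h2; rewrite fE // /Vfun.
    have /sgn[k1 k2 k3] := lohi _ (Dx _ Dx0).
    rewrite ler0_sqrtr ?invr0 ?mulr0 // oppr_le0.
    have [xy|xy] := ltP x y1; first exact/ltW/k1.
    have [yx|yx] := ltP y2 x; first exact/ltW/k3.
    by case/negP: h1; apply/mem_set; rewrite /= in_itv /= xy yx.
move: dD; congr (is_derive _ _ _ _).
apply/funext => d; apply: eq_Rintegral => x _; by rewrite [in RHS]zfun_line.
Qed.

End PiPoly.

(** * The normalized area as an integral over a fixed interval *)

Section ArcArea.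
Variable R : realType.
Local Notation mu := (@lebesgue_measure R).
Implicit Types N : {poly R}.

Definition zpoly N (x : R) : R := - N.[x] / bfun x.

(* [true] stands for the line psi = 0, [false] for psi = pi. *)
Definition side (b : bool) : R := if b then 0 else pi.

Lemma continuous_zpoly N x : 0 < x < 1 -> {for x, continuous (zpoly N)}.
Proof.
move=> x01; apply: cvgM; first by apply: cvgN; exact: continuous_horner.
by apply: cvgV; [rewrite gt_eqF // bfun_gt0|exact: continuous_bfun].
Qed.

(** P >= 0 says |N| >= b > 0, so the argument -N / b lies outside ]-1, 1[ and the clamped arccos
    takes one of its two extreme values. *)
Lemma acosc_side N (x : R) : 0 < x < 1 ->
  0 <= (N ^+ 2 - (1 - 'X) ^+ 3 * 'X).[x] ->
  acosc (zpoly N x) = side (N.[x] < 0) /\ N.[x] != 0.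
Proof.
move=> x01; have b0 := bfun_gt0 x01; have /andP[x0 x1] := x01.
rewrite !hornerE; have := bfun_sqr (x := x); rewrite (ltW x0) (ltW x1) => <- //.
rewrite subr_ge0 /zpoly /side => h.
have := h; rewrite -[leRHS]real_normK ?num_real // ler_pXn2r ?nnegrE ?(ltW b0) // => h'.
case: ltP => n0.
  rewrite ltr0_norm // in h'; split; last by rewrite lt_eqF.
  by rewrite acosc_ge1 // ler_pdivlMr // mul1r.
rewrite ger0_norm // in h'; split; last by rewrite gt_eqF // (lt_le_trans b0).
by rewrite acosc_leN1 // ler_pdivrMr // mulN1r lerN2.
Qed.

Lemma root_free_sign N (x y : R) : x <= y ->
  (forall z, x <= z <= y -> N.[z] != 0) -> (N.[x] < 0) = (N.[y] < 0).
Proof.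
move=> xy nz.
have nx : N.[x] != 0 by apply: nz; rewrite lexx xy.
have ny : N.[y] != 0 by apply: nz; rewrite lexx xy.
have [h|h] := leP (N.[x] * N.[y]) 0.
  have [z] := polyrcf.poly_ivt xy h; rewrite in_itv /= => /nz + /rootP e.
  by rewrite e eqxx.
have [a|a] := ltP N.[x] 0; first by rewrite nmulr_rgt0 // in h; rewrite h.
rewrite pmulr_rgt0 ?lt0r ?nx ?a // in h.
by move: h => /andP[_ h]; rewrite ltNge h.
Qed.

Lemma integrable_acosc_zpoly N (al be : R) : 0 < al -> be < 1 ->
  mu.-integrable `[al, be]%classic (EFin \o (fun x => acosc (zpoly N x))).
Proof.
move=> al0 be1; apply: (@continuous_compact_integrable R).
  exact: segment_compact.
apply: continuous_in_subspaceT => x /set_mem; rewrite /= in_itv /= => /andP[h1 h2].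
apply: continuous_comp; last exact: continuous_acosc.
by apply: continuous_zpoly; rewrite (lt_le_trans al0 h1) (le_lt_trans h2 be1).
Qed.

Lemma Rintegral_cst_itv (f : R -> R) (k a b : R) : a <= b ->
  (forall x, a <= x <= b -> f x = k) ->
  \int[mu]_(x in `[a, b]) f x = k * (b - a).
Proof.
move=> ab fk; rewrite (@eq_Rintegral _ _ _ _ _ (cst k)); last first.
  by move=> x /set_mem; rewrite /= in_itv /=; exact: fk.
rewrite Rintegral_cst; last exact: measurable_itv.
by rewrite /= lebesgue_measure_itv /= lte_fin; case: ltP => //= h;
  rewrite (le_anti (introT andP (conj ab h))) subrr.
Qed.

(** On either side of the arc N has no zero, hence a constant sign, and [acosc] is constantly 0 or
    pi: the integral over [al, be] is that over the arc plus two rectangles, whose heights are read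
    at al and be. *)
Lemma arc_integral N (lo hi z1 z2 al be : R) :
  well (N ^+ 2 - (1 - 'X) ^+ 3 * 'X) lo hi z1 z2 ->
  0 <= lo -> hi <= 1 -> lo < al -> al < z1 -> z2 < be -> be < hi ->
  [/\ \int[mu]_(x in `[al, be]) acosc (zpoly N x) =
      side (N.[al] < 0) * (z1 - al) +
        \int[mu]_(x in `[z1, z2]) acos (zpoly N x) +
        side (N.[be] < 0) * (be - z2),
      acos (zpoly N z1) = side (N.[al] < 0) &
      mu.-integrable `[z1, z2]%classic (EFin \o (fun x => acos (zpoly N x)))].
Proof.
move=> w lo0 hi1 loal al1 be2 behi; have [_ z12 [pz1 pz2] sgn] := w.
have al0 : 0 < al by exact: le_lt_trans loal.
have be1 : be < 1 by exact: lt_le_trans hi1.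
have albe : al <= be by apply: ltW; apply: (lt_trans al1); exact: lt_trans be2.
have in01 x : al <= x <= be -> 0 < x < 1.
  by move=> /andP[h1 h2]; rewrite (lt_le_trans al0 h1) (le_lt_trans h2 be1).
have lohi x : al <= x <= be -> lo <= x <= hi.
  by move=> /andP[h1 h2]; rewrite (le_trans (ltW loal) h1) (le_trans h2 (ltW behi)).
have outl x : al <= x <= z1 ->
    acosc (zpoly N x) = side (N.[x] < 0) /\ N.[x] != 0.
  move=> /andP[h1 h2].
  have xab : al <= x <= be.
    by rewrite h1 (le_trans h2) // ltW // (lt_trans z12).
  apply: acosc_side; first exact: in01.
  have [h3 _ _] := sgn _ (lohi _ xab).
  by have [xz|zx|->] := ltgtP x z1; [apply/ltW/h3|rewrite leNgt zx in h2|rewrite pz1].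
have outr x : z2 <= x <= be ->
    acosc (zpoly N x) = side (N.[x] < 0) /\ N.[x] != 0.
  move=> /andP[h1 h2].
  have xab : al <= x <= be.
    by rewrite h2 andbT (le_trans _ h1) // ltW // (lt_trans al1).
  apply: acosc_side; first exact: in01.
  have [_ _ h3] := sgn _ (lohi _ xab).
  by have [xz|zx|->] := ltgtP x z2; [rewrite leNgt xz in h1|apply/ltW/h3|rewrite pz2].
have cl x : al <= x <= z1 -> acosc (zpoly N x) = side (N.[al] < 0).
  move=> /andP[h1 h2]; have [-> _] := outl x (introT andP (conj h1 h2)).
  rewrite (@root_free_sign N al x h1) // => z /andP[k1 k2].
  by have [] := outl z (introT andP (conj k1 (le_trans k2 h2))).
have cr x : z2 <= x <= be -> acosc (zpoly N x) = side (N.[be] < 0).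
  move=> /andP[h1 h2]; have [-> _] := outr x (introT andP (conj h1 h2)).
  rewrite (@root_free_sign N x be h2) // => z /andP[k1 k2].
  by have [] := outr z (introT andP (conj (le_trans h1 k1) k2)).
have mid x : z1 <= x <= z2 -> acosc (zpoly N x) = acos (zpoly N x).
  move=> /andP[h1 h2].
  have xab : al <= x <= be.
    by rewrite (le_trans (ltW al1) h1) (le_trans h2 (ltW be2)).
  have x01 := in01 x xab; have b0 := bfun_gt0 x01; have /andP[x0 x1] := x01.
  apply: acosc_id; rewrite -ler_norml -(@ler_pXn2r _ 2) ?nnegrE // expr1n.
  rewrite real_normK ?num_real // /zpoly expr_div_n sqrrN ler_pdivrMr ?exprn_gt0 //.
  rewrite mul1r bfun_sqr ?(ltW x0) ?(ltW x1) // -subr_le0.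
  have -> : N.[x] ^+ 2 - (1 - x) ^+ 3 * x = (N ^+ 2 - (1 - 'X) ^+ 3 * 'X).[x].
    by rewrite !hornerE.
  have [_ h3 _] := sgn _ (lohi _ xab).
  have [xz|zx|->] := ltgtP x z1; [by rewrite leNgt xz in h1| |by rewrite pz1].
  have [xz|zx'|->] := ltgtP x z2; [|by rewrite leNgt zx' in h2|by rewrite pz2].
  by apply/ltW/h3/andP.
have iac := @integrable_acosc_zpoly N.
have imid : mu.-integrable `[z1, z2]%classic (EFin \o (fun x => acosc (zpoly N x))).
  by apply: iac; [exact: lt_trans al1|exact: lt_trans be1].
have midE x : x \in `[z1, z2]%classic -> acosc (zpoly N x) = acos (zpoly N x).
  by move=> /set_mem; rewrite /= in_itv /=; exact: mid.
split; last 2 first.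
- by rewrite -mid ?lexx ?(ltW z12) // cl // lexx ltW.
- move: imid; apply: eq_integrable; first exact: measurable_itv.
  by move=> x /midE /= ->.
have e1 := @Rintegral_itvB R (fun x => acosc (zpoly N x)) (BLeft al) (BRight be) z1 (iac _ _ al0 be1).
have e2 := @Rintegral_itvB R (fun x => acosc (zpoly N x)) (BLeft z1) (BRight be) z2.
rewrite !bnd_simp in e1 e2.
have i1be := iac z1 be (lt_trans al0 al1) be1.
have e1' := e1 (ltW al1) (ltW (lt_trans z12 be2)).
have e2' := e2 i1be (ltW z12) (ltW be2).
rewrite Rintegral_itv_obnd_cbnd in e1'; last first.
  by apply: integrableS i1be => //; exact: subset_itv_oc_cc.
have i2be := iac z2 be (lt_trans al0 (lt_trans al1 z12)) be1.
rewrite Rintegral_itv_obnd_cbnd in e2'; last first.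
  by apply: integrableS i2be => //; exact: subset_itv_oc_cc.
rewrite (@Rintegral_cst_itv _ _ _ _ (ltW be2) cr) in e2'.
rewrite (@Rintegral_cst_itv _ _ _ _ (ltW al1) cl) in e1'.
have midI : \int[mu]_(x in `[z1, z2]) acosc (zpoly N x) =
  \int[mu]_(x in `[z1, z2]) acos (zpoly N x) by exact: eq_Rintegral.
rewrite midI in e2'.
by move/eqP: e1'; rewrite subr_eq => /eqP ->; move/eqP: e2'; rewrite subr_eq => /eqP ->; ring.
Qed.

(** What is left of the area after the rectangles beside the arc are accounted for; b tells whether
    the right-hand root lies on psi = 0. *)
Definition area_const (t : zone_type) (b : bool) (al be : R) : R :=
  match t with
  | TI => 0
  | TIII => be - al
  | _ => if b then al else be
  end.

Definition compatible_ends (t : zone_type) (b1 b2 : bool) : bool :=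
  match t with
  | TI => b1 && b2
  | TIII => ~~ b1 && ~~ b2
  | _ => b1 (+) b2
  end.

Definition arc_area (t : zone_type) (N : {poly R}) (z1 z2 : R) : R :=
  let wrap := if acos (zpoly N z1) == pi
    then z1 + pi^-1 * \int[mu]_(x in `[z1, z2]) acos (zpoly N x)
    else z2 - pi^-1 * \int[mu]_(x in `[z1, z2]) acos (zpoly N x) in
  match t with
  | TI => pi^-1 * \int[mu]_(x in `[z1, z2]) acos (zpoly N x)
  | TIII => pi^-1 * \int[mu]_(x in `[z1, z2]) (pi - acos (zpoly N x))
  | _ => wrap
  end.

(** In each type the terms in z1 and z2 outside the integral cancel against the rectangles pi (z1 -
    al) and pi (be - z2), when present. No derivative of a root is ever needed, and the sign in
    front of the integral depends on the right-hand end alone. *)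
Lemma arc_areaE t N (lo hi z1 z2 al be : R) :
  well (N ^+ 2 - (1 - 'X) ^+ 3 * 'X) lo hi z1 z2 ->
  0 <= lo -> hi <= 1 -> lo < al -> al < z1 -> z2 < be -> be < hi ->
  compatible_ends t (N.[al] < 0) (N.[be] < 0) ->
  arc_area t N z1 z2 = area_const t (N.[be] < 0) al be +
    (-1) ^+ (~~ (N.[be] < 0)) * pi^-1 * \int[mu]_(x in `[al, be]) acosc (zpoly N x).
Proof.
move=> w lo0 hi1 loal al1 be2 behi.
have [-> zs ia] := arc_integral w lo0 hi1 loal al1 be2 behi.
have pi0 : pi != 0 :> R by rewrite gt_eqF ?pi_gt0.
have [_ z12 _ _] := w.
have c3 : \int[mu]_(x in `[z1, z2]) (pi - acos (zpoly N x)) =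
    pi * (z2 - z1) - \int[mu]_(x in `[z1, z2]) acos (zpoly N x).
  rewrite (@RintegralB _ _ _ mu _ (cst pi)) //; first last.
  - apply: (@continuous_compact_integrable R (cst pi)); first exact: segment_compact.
    by apply: continuous_subspaceT => x; exact: cst_continuous.
  - by rewrite (@Rintegral_cst_itv (cst pi) pi) // ltW.
have w12 : pi^-1 * (pi * (z2 - z1)) = z2 - z1 by rewrite mulKf.
move: zs; rewrite /arc_area c3.
move: (\int[mu]_(x in `[z1, z2]) _) => I.
have npi : (0 == pi :> R) = false by rewrite eq_sym (negbTE pi0).
clear c3 w12; rewrite /side; move: pi0 npi; move: (pi : R) => p p0 npi.
move=> zs; case: t; case: (N.[al] < 0) zs; case: (N.[be] < 0) => //= zs _;
  by rewrite ?zs ?eqxx ?npi ?expr0 ?expr1; field; exact: p0.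
Qed.

End ArcArea.

(** * Derivative formulas from the position of the roots *)

Section Pattern.
Variable R : realType.
Local Notation mu := (@lebesgue_measure R).
Implicit Types A B E : R.

(* [iv] selects the third and fourth roots instead of the first two; [b1] and
   [b2] are the lines on which the two roots lie, encoded as in [side]. *)
Definition pattern (iv : bool) A B E (b1 b2 : bool) : Prop :=
  let p := P_poly A B E in
  exists lo hi y1 y2,
  [/\ well p lo hi y1 y2,
      p^`().[y1] < 0 /\ 0 < p^`().[y2],
      0 <= lo /\ hi <= 1,
      ((num_poly A B E).[y1] < 0) = b1 /\ ((num_poly A B E).[y2] < 0) = b2 &
      if iv then exists w1 w2,
        [/\ well p 0 lo w1 w2, p^`().[w1] < 0 & 0 < p^`().[w2]]
      else lo = 0].

Lemma near_sign (n w : R) : n != 0 ->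
  \forall d \near (0 : R), (n + d * w < 0) = (n < 0).
Proof.
move=> n0.
have cv : (fun d : R => n + d * w) d @[d --> (0 : R)] --> n.
  have -> : n = (fun d : R => n + d * w) 0 by rewrite mul0r addr0.
  apply: cvgD; first by rewrite mul0r addr0; exact: cvg_cst.
  by apply: cvgM; [exact: cvg_id|exact: cvg_cst].
case: (ltgtP n 0) n0 => // nn _; near=> d.
  by near: d; exact: (cvgr_lt n).
apply/negbTE; rewrite -leNgt; apply: ltW.
by near: d; exact: (cvgr_gt n).
Unshelve. all: by end_near. Qed.

(** Positions in the list count from 0, hence 2 and 3 for the third and fourth roots. A first well
    filling [0, lo] accounts for exactly two roots before z1. *)
Lemma roots_pair (iv : bool) (p : {poly R}) (lo hi z1 z2 : R) :
  well p lo hi z1 z2 -> 0 <= lo -> hi <= 1 ->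
  (if iv then exists w1 w2, well p 0 lo w1 w2 else lo = 0) ->
  (roots p 0 1)`_(if iv then 2 else 0) = z1 /\
  (roots p 0 1)`_(if iv then 3 else 1) = z2.
Proof.
move=> w lo0 hi1; case: iv => [[w1 [w2 w']]|lo00].
  have [[l1 l2] l3 _ sgn] := w'; have [[k1 k2] k3 _ _] := w.
  rewrite (@roots_well _ p 0 1 0 lo w1 w2 w') //; last 2 first.
  - by apply: ltW; apply: (lt_trans k1); apply: (lt_trans k3); exact: lt_le_trans hi1.
  - by move=> x /andP[h1 h2]; have := lt_trans h1 h2; rewrite ltxx.
  rewrite (@roots_well _ p w2 1 lo hi z1 z2 w) ?(ltW l2) //.
  move=> x /andP[h1 h2]; have [|_ _ h] := sgn x.
    by rewrite (ltW h2) andbT ltW // (lt_trans l1) // (lt_trans l3).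
  by rewrite gt_eqF // h.
rewrite (@roots_well _ p 0 1 lo hi z1 z2 w) // lo00 //.
by move=> x /andP[h1 h2]; have := lt_trans h1 h2; rewrite ltxx.
Qed.

(** For small d the wells persist on the same intervals [lo, hi] and, for the third and fourth
    roots, [0, lo], so the numbering is stable; N also keeps its signs at al and be. Hence
    [arc_areaE] holds with a constant K independent of d. *)
Lemma pattern_arc iv A B E b1 b2 t (om : {poly R}) :
  pattern iv A B E b1 b2 -> compatible_ends t b1 b2 ->
  let r := roots (P_poly A B E) 0 1 in
  let D := `[r`_(if iv then 2 else 0), r`_(if iv then 3 else 1)]%classic in
  exists (K : R) (Phi : R -> R),
  [/\ mu.-integrable D (EFin \o (fun x => om.[x] * Vfun A B E x)),
      is_derive (0 : R) (1 : R) Phi (\int[mu]_(x in D) (om.[x] * Vfun A B E x)) &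
      \forall d \near (0 : R),
        arc_area t (num_line A B E om d)
          (roots (P_line A B E om d) 0 1)`_(if iv then 2 else 0)
          (roots (P_line A B E om d) 0 1)`_(if iv then 3 else 1) =
        K + (-1) ^+ (~~ b2) * pi^-1 * Phi d].
Proof.
move=> [lo [hi [y1 [y2 [w [d1 d2] [lo0 hi1] [s1 s2] hiv]]]]] ct r D.
have [r1 r2] : r`_(if iv then 2 else 0) = y1 /\ r`_(if iv then 3 else 1) = y2.
  apply: (roots_pair w) => //; move: hiv; case: ifP => // _ [w1 [w2 [w' _ _]]].
  by exists w1, w2.
rewrite /D r1 r2 => {D r1 r2 r}.
have [[lo1 hi2] y12 [py1 py2] sgn] := w.
pose al := (lo + y1) / 2; pose be := (y2 + hi) / 2.
have [loal al1 be2 behi] : [/\ lo < al, al < y1, y2 < be & be < hi].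
  by rewrite /al /be; split; lra.
have [iD dD] := well_arc om w d1 d2 lo0 hi1 loal al1 be2 behi.
exists (area_const t b2 al be), (fun d => \int[mu]_(x in `[al, be]) acosc (zfun A B E om d x)).
split => //.
set n0 := num_poly A B E in s1 s2.
have al0 : 0 < al by exact: le_lt_trans loal.
have be1 : be < 1 by exact: lt_le_trans hi1.
have outl x : al <= x <= y1 -> n0.[x] != 0.
  move=> /andP[h1 h2].
  have lohi : lo <= x <= hi by apply/andP; split; lra.
  have x01 : 0 < x < 1 by apply/andP; split; lra.
  suff P0 : 0 <= (n0 ^+ 2 - (1 - 'X) ^+ 3 * 'X).[x].
    by have [] := @acosc_side R n0 x x01 P0.
  have [h3 _ _] := sgn _ lohi.
  by have [xz|zx|->] := ltgtP x y1; [apply/ltW/h3|rewrite leNgt zx in h2|rewrite -/(P_poly A B E) py1].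
have outr x : y2 <= x <= be -> n0.[x] != 0.
  move=> /andP[h1 h2].
  have lohi : lo <= x <= hi by apply/andP; split; lra.
  have x01 : 0 < x < 1 by apply/andP; split; lra.
  suff P0 : 0 <= (n0 ^+ 2 - (1 - 'X) ^+ 3 * 'X).[x].
    by have [] := @acosc_side R n0 x x01 P0.
  have [_ _ h3] := sgn _ lohi.
  by have [xz|zx|->] := ltgtP x y2; [rewrite leNgt xz in h1|apply/ltW/h3|rewrite -/(P_poly A B E) py2].
have sal : (n0.[al] < 0) = b1 by rewrite -s1; apply: root_free_sign => //; exact: ltW.
have sbe : (n0.[be] < 0) = b2 by rewrite -s2; apply/esym/root_free_sign => //; exact: ltW.
have nal : n0.[al] != 0 by apply: outl; rewrite lexx ltW.
have nbe : n0.[be] != 0 by apply: outr; rewrite lexx ltW.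
have N1 := near_sign om.[al] nal; have N2 := near_sign om.[be] nbe.
pose p1 := 2%:P * n0 * om; pose p2 := om ^+ 2.
have N3 := near_well p1 p2 w d1 d2 (ltW loal) al1 be2 (ltW behi).
have N4 : \forall d \near (0 : R), if iv then
   exists w1 w2, well (P_poly A B E + d *: p1 + d ^+ 2 *: p2) 0 lo w1 w2 else lo = 0.
  case: iv hiv => [[w1 [w2 [w' d1' d2']]]|lo00]; last by near=> d.
  have [[l1 l2] _ _ _] := w'.
  near=> d.
  have : exists z1 z2, [/\ 0 < z1, z2 < lo &
      well (P_poly A B E + d *: p1 + d ^+ 2 *: p2) 0 lo z1 z2].
    by near: d; exact: (near_well p1 p2 w' d1' d2' (lexx _) l1 l2 (lexx _)).
  by move=> [z1 [z2 [_ _ wz]]]; exists z1, z2.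
near=> d.
have : exists z1 z2, [/\ al < z1, z2 < be &
    well (P_poly A B E + d *: p1 + d ^+ 2 *: p2) lo hi z1 z2] by near: d.
move=> [z1 [z2 [az1 z2b]]]; rewrite -P_lineE => wz.
have hw : if iv then exists w1 w2, well (P_line A B E om d) 0 lo w1 w2 else lo = 0.
  by rewrite P_lineE; near: d.
have [-> ->] := roots_pair wz lo0 hi1 hw.
have e1 : ((num_line A B E om d).[al] < 0) = b1.
  by rewrite /num_line hornerD hornerZ -sal; near: d.
have e2 : ((num_line A B E om d).[be] < 0) = b2.
  by rewrite /num_line hornerD hornerZ -sbe; near: d.
by rewrite (arc_areaE wz lo0 hi1 loal az1 z2b behi) ?e1 ?e2.
Unshelve. all: by end_near. Qed.

(** E enters N with a minus sign and a_1 with a plus sign, but the derivative of a_1 in I_2 is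
    -sigma / (3 chi I_2^2): both formulas therefore carry the same sign, opposite to that of the
    integral in [arc_areaE]. *)
Lemma pattern_formulas (c : constants R) (t : zone_type) (iv b1 b2 : bool) (E I2 : R) :
  chi c != 0 -> 0 < I2 ->
  pattern iv (a1 c I2) (a2 c) E b1 b2 -> compatible_ends t b1 b2 ->
  iv = (if t is TIV then true else false) ->
  derivative_formulas c t (- (-1) ^+ (~~ b2)) (if iv then 3 else 1)
    (if iv then 4 else 2) E I2.
Proof.
move=> chi0 I20 pat ct ivt.
have areaE e J : area c t e J = arc_area t (num_poly (a1 c J) (a2 c) e)
    (roots (P_poly (a1 c J) (a2 c) e) 0 1)`_(if iv then 2 else 0)
    (roots (P_poly (a1 c J) (a2 c) e) 0 1)`_(if iv then 3 else 1).
  have psiE : psi c e J = (fun x => acos (zpoly (num_poly (a1 c J) (a2 c) e) x)).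
    by apply/funext => x; rewrite /psi /zpoly num_polyE opprB.
  rewrite /area /arc_area /wrap_area /psi_integral /xroot /Ppoly ivt.
  by case: t {pat ct ivt} => /=; rewrite ?psiE.
have WE x : W c E I2 x = pi^-1 * Vfun (a1 c I2) (a2 c) E x.
  rewrite /W /Vfun invfM; congr (_ * (Num.sqrt _)^-1).
  by rewrite /P_poly !hornerE; ring.
have [K1 [F1 [i1 d1 n1]]] := pattern_arc (-1) pat ct.
have [K2 [F2 [i2 d2 n2]]] := pattern_arc 'X pat ct.
set r := roots _ 0 1 in i1 d1 i2 d2.
have xi : xroot c (if iv then 3 else 1) E I2 = r`_(if iv then 2 else 0).
  by rewrite /xroot; case: (iv).
have xj : xroot c (if iv then 4 else 2) E I2 = r`_(if iv then 3 else 1).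
  by rewrite /xroot; case: (iv).
rewrite /derivative_formulas xi xj.
set D := `[_, _]%classic in i1 d1 i2 d2 *.
have mD : measurable (D : set (measurableTypeR R)) by exact: measurable_itv.
have iV : mu.-integrable D (EFin \o Vfun (a1 c I2) (a2 c) E).
  have := @integrableZl _ _ _ mu _ mD (-1) _ i1.
  apply: eq_integrable => // x _ /=.
  by rewrite -EFinM hornerN hornerC !mulN1r opprK.
have iXV : mu.-integrable D (EFin \o (fun x => x * Vfun (a1 c I2) (a2 c) E x)).
  by move: i2; apply: eq_integrable => // x _ /=; rewrite hornerX.
have IW : \int[mu]_(x in D) W c E I2 x =
    pi^-1 * \int[mu]_(x in D) Vfun (a1 c I2) (a2 c) E x.
  rewrite -(@RintegralZl _ _ _ mu _ _ _ mD iV).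
  by apply: eq_Rintegral => x _; rewrite WE.
have IXW : \int[mu]_(x in D) (x * W c E I2 x) =
    pi^-1 * \int[mu]_(x in D) (x * Vfun (a1 c I2) (a2 c) E x).
  rewrite -(@RintegralZl _ _ _ mu _ _ _ mD iXV).
  by apply: eq_Rintegral => x _; rewrite WE mulrCA.
have I1 : \int[mu]_(x in D) ((-1 : {poly R}).[x] * Vfun (a1 c I2) (a2 c) E x) =
    - \int[mu]_(x in D) Vfun (a1 c I2) (a2 c) E x.
  rewrite -[RHS]mulN1r -(@RintegralZl _ _ _ mu _ _ _ mD iV).
  by apply: eq_Rintegral => x _; rewrite hornerN hornerC.
have I2' : \int[mu]_(x in D) ('X.[x] * Vfun (a1 c I2) (a2 c) E x) =
    \int[mu]_(x in D) (x * Vfun (a1 c I2) (a2 c) E x).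
  by apply: eq_Rintegral => x _; rewrite hornerX.
split.
- have := @integrableZl _ _ _ mu _ mD (pi^-1) _ iV.
  by apply: eq_integrable => // x _ /=; rewrite -EFinM WE.
- have := @integrableZl _ _ _ mu _ mD (pi^-1) _ iXV.
  by apply: eq_integrable => // x _ /=; rewrite -EFinM WE mulrCA.
- rewrite IW; rewrite I1 in d1.
  set k := (-1) ^+ _ in n1 *.
  (* The area is only known to agree with this function near E, which is enough for the
     derivative. *)
  pose G (e : R) := K1 + k * pi^-1 * F1 (e - E).
  apply: (@near_eq_is_derive _ _ _ G).
    have cv : (fun e : R => e - E) e @[e --> E] --> (0 : R).
      by rewrite -(subrr E); apply: cvgB; [exact: cvg_id|exact: cvg_cst].
    pose Q (d : R) := arc_area t (num_line (a1 c I2) (a2 c) E (-1) d)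
      (roots (P_line (a1 c I2) (a2 c) E (-1) d) 0 1)`_(if iv then 2 else 0)
      (roots (P_line (a1 c I2) (a2 c) E (-1) d) 0 1)`_(if iv then 3 else 1) =
      K1 + k * pi^-1 * F1 d.
    have N : \forall e \near E, Q (e - E) := cv _ n1.
    near=> e; have : Q (e - E) by near: e.
    rewrite /Q => Qd; rewrite /G -Qd.
    rewrite areaE num_line_energy /P_line num_line_energy /P_poly.
    by rewrite [E + _]addrC subrK.
  have dE : is_derive E (1 : R) (fun e : R => e - E) (1 : R).
    by apply: is_derive_eq; rewrite oppr0 addr0.
  have dF : is_derive (E - E) (1 : R) F1 (- \int[mu]_(x in D) Vfun (a1 c I2) (a2 c) E x).
    by rewrite subrr.
  have dc := @is_derive1_comp _ F1 (fun e => e - E) E _ _ dF dE.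
  have dz := @is_deriveZ _ _ _ _ (k * pi^-1) _ _ _ dc.
  have da := @is_deriveD _ _ _ _ _ _ _ _ _ (is_derive_cst K1 E (1 : R)) dz.
  apply: (is_derive_eq da); rewrite /GRing.scale /=.
  by ring.
- rewrite IXW; rewrite I2' in d2.
  set k := (-1) ^+ _ in n2 *.
  pose dl (J : R) := a1 c J - a1 c I2.
  pose G (J : R) := K2 + k * pi^-1 * F2 (dl J).
  have I2n : I2 != 0 by rewrite gt_eqF.
  have n3 : 3 * I2 * chi c != 0.
    by apply: mulf_neq0 => //; apply: mulf_neq0 => //; rewrite pnatr_eq0.
  have dJ : is_derive I2 (1 : R) dl (- (sigma c / (3 * chi c * I2 ^+ 2))).
    have d3 : is_derive I2 (1 : R) (fun J : R => 3 * J * chi c) (3 * chi c).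
      by apply: is_derive_eq; rewrite /GRing.scale /=; ring.
    have d4 := @is_deriveV _ (fun J : R => 3 * J * chi c) I2 _ _ n3 d3.
    have d5 := @is_deriveZ _ _ _ _ (sigma c) _ _ _ d4.
    have d6 := @is_deriveD _ _ _ _ _ _ _ _ _
      (is_derive_cst (- (2 * G20 c / chi c) + G11 c / (3 * chi c)) I2 (1 : R)) d5.
    have d7 := @is_deriveB _ _ _ _ _ _ _ _ _ d6 (is_derive_cst (a1 c I2) I2 (1 : R)).
    apply: (is_derive_eq d7); rewrite /GRing.scale /=.
    have alg (x y s : R) : x != 0 -> y != 0 ->
        0 + s * (- (3 * y * x) ^- 2 * (3 * x)) - 0 = - (s / (3 * x * y ^+ 2)).
      by move=> x0 y0; field; rewrite x0 y0.
    exact: alg.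
  apply: (@near_eq_is_derive _ _ _ G).
    have cv : dl J @[J --> I2] --> (0 : R).
      have -> : (0 : R) = dl I2 by rewrite /dl subrr.
      apply: differentiable_continuous; apply/derivable1_diffP.
      by have [] := dJ.
    pose Q (d : R) := arc_area t (num_line (a1 c I2) (a2 c) E 'X d)
      (roots (P_line (a1 c I2) (a2 c) E 'X d) 0 1)`_(if iv then 2 else 0)
      (roots (P_line (a1 c I2) (a2 c) E 'X d) 0 1)`_(if iv then 3 else 1) =
      K2 + k * pi^-1 * F2 d.
    have N : \forall J \near I2, Q (dl J) := cv _ n2.
    near=> J; have : Q (dl J) by near: J.
    rewrite /Q => Qd; rewrite /G -Qd.
    rewrite areaE num_line_slope /P_line num_line_slope /P_poly.
    by rewrite /dl [a1 c I2 + _]addrC subrK.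
  have dF : is_derive (dl I2) (1 : R) F2 (\int[mu]_(x in D) (x * Vfun (a1 c I2) (a2 c) E x)).
    by rewrite /dl subrr.
  have dc := @is_derive1_comp _ F2 dl I2 _ _ dF dJ.
  have dz := @is_deriveZ _ _ _ _ (k * pi^-1) _ _ _ dc.
  have da := @is_deriveD _ _ _ _ _ _ _ _ _ (is_derive_cst K2 I2 (1 : R)) dz.
  apply: (is_derive_eq da); rewrite /GRing.scale /=.
  by move: (pi^-1) (sigma c / _) => p s; ring.
Unshelve. all: by end_near. Qed.

End Pattern.

(** * Level crossings of quasiconvex functions *)

Section Crossings.
Variable R : realType.

(** Strict quasiconvexity. It covers strictly monotone functions and decreasing-increasing ones
    alike, so the same crossing lemmas serve for l and for -u in different regions. *)
Definition qconvex (f : R -> R) (a b : R) : Prop :=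
  forall x y z, a <= x -> x < y -> y < z -> z <= b -> f y < Num.max (f x) (f z).

Lemma qconvexW (f : R -> R) (a b a' b' : R) : a <= a' -> b' <= b ->
  qconvex f a b -> qconvex f a' b'.
Proof.
move=> aa bb qf x y z ax xy yz zb.
by apply: qf => //; [exact: le_trans ax|exact: le_trans bb].
Qed.

Lemma qconvex_lt (f : R -> R) (a b E : R) : qconvex f a b ->
  f a < E -> f b < E -> forall x, a <= x <= b -> f x < E.
Proof.
move=> qf fa fb x /andP[]; rewrite le_eqVlt => /predU1P[<- //|ax].
rewrite le_eqVlt => /predU1P[-> //|xb].
by apply: lt_le_trans (qf a x b _ _ _ _) _ => //; rewrite ge_max !ltW.
Qed.

(** Existence is the intermediate value theorem. If f x <= E for some x < c, then c lies between x
    and b, where f is at most E, and quasiconvexity forces f c < E; to the right of c the argument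
    is similar. *)
Lemma crossing_down (f : R -> R) (a b E : R) : continuous f -> qconvex f a b ->
  a <= b -> f b < E -> E < f a ->
  exists2 c, a < c < b & [/\ f c = E,
    forall x, a <= x -> x < c -> E < f x & forall x, c < x -> x <= b -> f x < E].
Proof.
move=> cf qf ab fb fa.
have [|c] := @IVT R f a b E ab (continuous_subspaceT cf).
  by rewrite (min_idPr _) ?(max_idPl _) ?ltW // (lt_trans fb).
rewrite in_itv /= => /andP[ac cb] fc.
have {}ac : a < c by rewrite lt_neqAle ac andbT; apply/eqP => e; rewrite e fc ltxx in fa.
have {}cb : c < b by rewrite lt_neqAle cb andbT; apply/eqP => e; rewrite -e fc ltxx in fb.
exists c; first by rewrite ac.
split=> // x.
- move=> ax xc; rewrite ltNge; apply/negP => fx.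
  have := qf x c b ax xc cb (lexx b); rewrite fc lt_max !ltNge fx.
  by rewrite (ltW fb).
- move=> cx; rewrite le_eqVlt => /predU1P[-> //|xb].
  have := qf c x b (ltW ac) cx xb (lexx b); rewrite fc lt_max => /orP[//|h].
  exact: lt_trans fb.
Qed.

Lemma crossing_up (f : R -> R) (a b E : R) : continuous f -> qconvex f a b ->
  a <= b -> f a < E -> E < f b ->
  exists2 c, a < c < b & [/\ f c = E,
    forall x, a <= x -> x < c -> f x < E & forall x, c < x -> x <= b -> E < f x].
Proof.
move=> cf qf ab fa fb.
have [|c] := @IVT R f a b E ab (continuous_subspaceT cf).
  by rewrite (min_idPl _) ?(max_idPr _) ?ltW // (lt_trans fa).
rewrite in_itv /= => /andP[ac cb] fc.
have {}ac : a < c by rewrite lt_neqAle ac andbT; apply/eqP => e; rewrite e fc ltxx in fa.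
have {}cb : c < b by rewrite lt_neqAle cb andbT; apply/eqP => e; rewrite -e fc ltxx in fb.
exists c; first by rewrite ac.
split=> // x.
- rewrite le_eqVlt => /predU1P[<- //|ax] xc.
  have := qf a x c (lexx a) ax xc (ltW cb); rewrite fc lt_max => /orP[h|//].
  exact: lt_trans fa.
- move=> cx xb; rewrite ltNge; apply/negP => fx.
  have := qf a c x (lexx a) ac cx xb; rewrite fc lt_max !ltNge fx.
  by rewrite (ltW fa).
Qed.

End Crossings.

(** * The branches of F on psi = 0 and psi = pi *)

Section Branches.
Variable R : realType.
Implicit Types A B E : R.

(* F on the lines psi = 0 and psi = pi. *)
Definition ufun A B (x : R) : R := afun A B x + bfun x.
Definition lfun A B (x : R) : R := afun A B x - bfun x.

Definition dbfun (x : R) : R := (1 - x) ^+ 2 * (1 - 4 * x) / (2 * bfun x).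
Definition dufun A B (x : R) : R := B * x + A + dbfun x.
Definition dlfun A B (x : R) : R := B * x + A - dbfun x.

Lemma continuous_afun A B : continuous (afun A B).
Proof.
have -> : afun A B = horner (num_poly A B 0).
  by apply/funext => x; rewrite num_polyE subr0.
exact: continuous_horner.
Qed.

Lemma continuous_ufun A B : continuous (ufun A B).
Proof. by move=> x; apply: cvgD; [exact: continuous_afun|exact: continuous_bfun]. Qed.

Lemma continuous_lfun A B : continuous (lfun A B).
Proof. by move=> x; apply: cvgB; [exact: continuous_afun|exact: continuous_bfun]. Qed.

Lemma bfun0 : bfun 0 = 0 :> R. Proof. by rewrite /bfun mulr0 sqrtr0. Qed.
Lemma bfun1 : bfun 1 = 0 :> R. Proof. by rewrite /bfun subrr expr0n mul0r sqrtr0. Qed.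
Lemma ufun0 A B : ufun A B 0 = 0.
Proof. by rewrite /ufun /afun bfun0; ring. Qed.
Lemma lfun0 A B : lfun A B 0 = 0.
Proof. by rewrite /lfun /afun bfun0; ring. Qed.
Lemma lfun1 A B : lfun A B 1 = ufun A B 1.
Proof. by rewrite /lfun /ufun bfun1 subr0 addr0. Qed.

Lemma lfun_le_ufun A B x : lfun A B x <= ufun A B x.
Proof. by have := sqrtr_ge0 ((1 - x) ^+ 3 * x); rewrite /lfun /ufun -/(bfun x); lra. Qed.

Lemma lfun_lt_ufun A B x : 0 < x < 1 -> lfun A B x < ufun A B x.
Proof. by move=> /bfun_gt0; rewrite /lfun /ufun; lra. Qed.

Lemma P_polyE A B E x : 0 <= x <= 1 ->
  (P_poly A B E).[x] = (ufun A B x - E) * (lfun A B x - E).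
Proof.
move=> /bfun_sqr bx; rewrite /P_poly hornerD hornerN horner_exp num_polyE.
have -> : ((1 - 'X) ^+ 3 * 'X).[x] = bfun x ^+ 2 by rewrite bx !hornerE.
by rewrite /ufun /lfun; ring.
Qed.

Lemma P_poly_deriv A B E x :
  (P_poly A B E)^`().[x] = 2 * (afun A B x - E) * (B * x + A) -
    (1 - x) ^+ 2 * (1 - 4 * x).
Proof.
have d1 : (1 - 'X : {poly R})^`() = - 1 by rewrite derivB derivX -[1]/(1%:P) derivC sub0r.
have d2 : (num_poly A B E)^`() = (B / 2) *: ('X *+ 2) + A%:P.
  rewrite /num_poly derivB derivD !derivZ derivXn derivX derivC subr0.
  by rewrite alg_polyC.
rewrite /P_poly expr2 derivB !derivM !d1 !d2 !derivX.
rewrite !(hornerD, hornerN, hornerM, hornerZ, hornerMn, horner_exp, hornerC, hornerX).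
by rewrite /afun; field.
Qed.

(** Differentiating P = (u - E) (l - E) at a zero of the first factor leaves u' (l - u), and l - u =
    -2 b. So the root is simple unless it is a critical point of its branch. *)
Lemma P_poly_deriv_u A B E x : 0 < x < 1 -> ufun A B x = E ->
  (P_poly A B E)^`().[x] = - (2 * bfun x * dufun A B x).
Proof.
move=> /bfun_gt0 b0 <-; rewrite P_poly_deriv /ufun /dufun /dbfun.
by move: (bfun x) b0 => b b0; field; rewrite gt_eqF.
Qed.

Lemma P_poly_deriv_l A B E x : 0 < x < 1 -> lfun A B x = E ->
  (P_poly A B E)^`().[x] = 2 * bfun x * dlfun A B x.
Proof.
move=> /bfun_gt0 b0 <-; rewrite P_poly_deriv /lfun /dlfun /dbfun.
by move: (bfun x) b0 => b b0; field; rewrite gt_eqF.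
Qed.

(** The signs of p between y1 and y2 already give p' <= 0 at y1 and p' >= 0 at y2; simplicity makes
    both strict. *)
Lemma well_deriv (p : {poly R}) (lo hi y1 y2 : R) : well p lo hi y1 y2 ->
  p^`().[y1] != 0 -> p^`().[y2] != 0 -> p^`().[y1] < 0 /\ 0 < p^`().[y2].
Proof.
have main (q : {poly R}) (y e : R) : 0 < e -> q.[y] = 0 ->
    (forall x, y < x -> x < y + e -> q.[x] < 0) -> q^`().[y] <= 0.
  move=> e0 qy neg; rewrite leNgt; apply/negP => dq.
  have [e1 /= e10 he1] : \forall x \near y, 0 < q^`().[x].
    by apply: (cvgr_gt _ (@continuous_horner R q^`() y)).
  pose d := Num.min (e / 2) (e1 / 2).
  have d0 : 0 < d by rewrite lt_min !divr_gt0.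
  have [de de1] : d <= e / 2 /\ d <= e1 / 2 by rewrite !ge_min !lexx orbT.
  have := @deriv_neg_itv R (- q) y (y + d) _ y (y + d) (lexx _) _ (lexx _).
  rewrite !hornerN ltrN2 qy ltrDl => /(_ _ d0) h.
  have : 0 < q.[y + d].
    apply: h => x /andP[yx xd]; rewrite derivN hornerN oppr_lt0; apply: he1.
    by rewrite /ball /= ltr_norml; apply/andP; split; lra.
  by rewrite ltNge ltW // neg //; lra.
move=> [[lo1 hi2] y12 [p1 p2] sgn] d1 d2; split.
  rewrite lt_neqAle d1 /=; apply: (main _ _ (y2 - y1)) => //; first by rewrite subr_gt0.
  move=> x h1 h2; have [|_ h _] := sgn x; first by apply/andP; split; lra.
  by apply: h; rewrite h1 /=; lra.
rewrite lt_neqAle eq_sym d2 /=; rewrite leNgt; apply/negP => dq.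
have [e1 /= e10 he1] : \forall x \near y2, p^`().[x] < 0.
  by apply: (cvgr_lt _ (@continuous_horner R p^`() y2)).
pose d := Num.min ((y2 - y1) / 2) (e1 / 2).
have d0 : 0 < d by rewrite lt_min !divr_gt0 // subr_gt0.
have [de de1] : d <= (y2 - y1) / 2 /\ d <= e1 / 2 by rewrite !ge_min !lexx orbT.
have h : p.[y2] < p.[y2 - d].
  apply: (@deriv_neg_itv R p (y2 - d) y2) => //; last by lra.
  move=> x /andP[yx xd]; apply: he1.
  by rewrite /ball /= ltr_norml; apply/andP; split; lra.
have [|_ k _] := sgn (y2 - d); first by apply/andP; split; lra.
by move: h; rewrite p2 ltNge ltW // k //; apply/andP; split; lra.
Qed.

(** On [0, 1], P is negative exactly where l < E < u. *)
Lemma well_ul A B E (lo hi y1 y2 : R) :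
  0 <= lo -> hi <= 1 -> lo < y1 -> y1 < y2 -> y2 < hi ->
  (ufun A B y1 = E \/ lfun A B y1 = E) -> (ufun A B y2 = E \/ lfun A B y2 = E) ->
  (forall x, lo <= x -> x < y1 -> ufun A B x < E \/ E < lfun A B x) ->
  (forall x, y1 < x -> x < y2 -> lfun A B x < E /\ E < ufun A B x) ->
  (forall x, y2 < x -> x <= hi -> ufun A B x < E \/ E < lfun A B x) ->
  well (P_poly A B E) lo hi y1 y2.
Proof.
move=> lo0 hi1 lo1 y12 hi2 r1 r2 h1 h2 h3.
have P01 x : lo <= x -> x <= hi ->
    (P_poly A B E).[x] = (ufun A B x - E) * (lfun A B x - E).
  by move=> k1 k2; apply: P_polyE; rewrite (le_trans lo0 k1) (le_trans k2 hi1).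
have pos x : lo <= x -> x <= hi -> ufun A B x < E \/ E < lfun A B x ->
    0 < (P_poly A B E).[x].
  move=> k1 k2 hx; rewrite P01 //; have := lfun_le_ufun A B x => lu.
  case: hx => hx; first by rewrite nmulr_rgt0; lra.
  by rewrite mulr_gt0; lra.
have root x : lo <= x -> x <= hi -> ufun A B x = E \/ lfun A B x = E ->
    (P_poly A B E).[x] = 0.
  by move=> k1 k2; rewrite P01 // => -[->|->]; rewrite subrr ?mul0r ?mulr0.
split => //.
  by split; apply: root => //; lra.
move=> x /andP[k1 k2]; split=> [k|/andP[k k']|k].
- by apply: pos => //; exact: h1.
- by have [l1 l2] := h2 x k k'; rewrite P01 // pmulr_rlt0; lra.
- by apply: pos => //; exact: h3.
Qed.

(** Critical points of F have sin psi = 0, so that E is not a critical value is a condition on the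
    two branches only. *)
Definition noncritical A B E : Prop := forall x, 0 < x < 1 ->
  (ufun A B x = E -> dufun A B x != 0) /\ (lfun A B x = E -> dlfun A B x != 0).

Lemma noncritical_P_deriv A B E x : noncritical A B E -> 0 < x < 1 ->
  ufun A B x = E \/ lfun A B x = E -> (P_poly A B E)^`().[x] != 0.
Proof.
move=> nc x01 [] e; have [h1 h2] := nc x x01; have b0 := bfun_gt0 x01.
  rewrite P_poly_deriv_u // oppr_eq0 mulf_neq0 ?h1 //.
  by rewrite mulf_neq0 ?pnatr_eq0 // gt_eqF.
rewrite P_poly_deriv_l // mulf_neq0 ?h2 //.
by rewrite mulf_neq0 ?pnatr_eq0 // gt_eqF.
Qed.

Lemma noncritical_well_deriv A B E (lo hi y1 y2 : R) : noncritical A B E ->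
  0 <= lo -> hi <= 1 ->
  (ufun A B y1 = E \/ lfun A B y1 = E) -> (ufun A B y2 = E \/ lfun A B y2 = E) ->
  well (P_poly A B E) lo hi y1 y2 ->
  (P_poly A B E)^`().[y1] < 0 /\ 0 < (P_poly A B E)^`().[y2].
Proof.
move=> nc lo0 hi1 r1 r2 w; have [[l1 l2] l3 _ _] := w.
by apply: (well_deriv w); apply: noncritical_P_deriv => //; apply/andP; split; lra.
Qed.

Lemma num_sign_u A B E x : 0 < x < 1 -> ufun A B x = E ->
  ((num_poly A B E).[x] < 0) = true.
Proof. by move=> /bfun_gt0 b0 <-; rewrite num_polyE /ufun; lra. Qed.

Lemma num_sign_l A B E x : 0 < x < 1 -> lfun A B x = E ->
  ((num_poly A B E).[x] < 0) = false.
Proof.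
by move=> /bfun_gt0 b0 <-; rewrite num_polyE /lfun; apply/negbTE; rewrite -leNgt; lra.
Qed.

Definition branch_well A B E (lo hi y1 y2 : R) (b1 b2 : bool) : Prop :=
  [/\ well (P_poly A B E) lo hi y1 y2,
      (if b1 then ufun A B y1 else lfun A B y1) = E &
      (if b2 then ufun A B y2 else lfun A B y2) = E].

Lemma branch_well_pattern A B E (hi y1 y2 : R) b1 b2 : noncritical A B E ->
  hi <= 1 -> branch_well A B E 0 hi y1 y2 b1 b2 -> pattern false A B E b1 b2.
Proof.
move=> nc hi1 [w e1 e2]; have [[l1 l2] l3 _ _] := w.
have k1 : 0 < y1 < 1 by apply/andP; split; lra.
have k2 : 0 < y2 < 1 by apply/andP; split; lra.
exists 0, hi, y1, y2; split => //.
  by apply: (noncritical_well_deriv nc _ _ _ _ w) => //;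
    [case: (b1) e1; [left|right]|case: (b2) e2; [left|right]].
split; first by case: (b1) e1 => e; [exact: num_sign_u|exact: num_sign_l].
by case: (b2) e2 => e; [exact: num_sign_u|exact: num_sign_l].
Qed.

Lemma branch_well_pattern4 A B E (lo hi w1 w2 y1 y2 : R) c1 c2 b1 b2 :
  noncritical A B E -> 0 <= lo -> hi <= 1 ->
  branch_well A B E 0 lo w1 w2 c1 c2 -> branch_well A B E lo hi y1 y2 b1 b2 ->
  pattern true A B E b1 b2.
Proof.
move=> nc lo0 hi1 [w' f1 f2] [w e1 e2]; have [[l1 l2] l3 _ _] := w.
have k1 : 0 < y1 < 1 by apply/andP; split; lra.
have k2 : 0 < y2 < 1 by apply/andP; split; lra.
exists lo, hi, y1, y2; split => //.
- by apply: (noncritical_well_deriv nc _ _ _ _ w) => //;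
    [case: (b1) e1; [left|right]|case: (b2) e2; [left|right]].
- split; first by case: (b1) e1 => e; [exact: num_sign_u|exact: num_sign_l].
  by case: (b2) e2 => e; [exact: num_sign_u|exact: num_sign_l].
- exists w1, w2; have [] := @noncritical_well_deriv A B E 0 lo w1 w2 nc _ _ _ _ w' => //.
  + by lra.
  + by case: (c1) f1; [left|right].
  + by case: (c2) f2; [left|right].
Qed.

Section BranchWells.
Variables A B E : R.
Local Notation u := (ufun A B).
Local Notation l := (lfun A B).
Local Notation nu := (fun x => - ufun A B x).

Let cnu : continuous nu.
Proof. by move=> x; apply: cvgN; exact: continuous_ufun. Qed.

Lemma u_crossing_up (a b : R) : qconvex nu a b -> a <= b -> u a < E -> E < u b ->
  exists2 c, a < c < b & [/\ u c = E,
    forall x, a <= x -> x < c -> u x < E & forall x, c < x -> x <= b -> E < u x].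
Proof.
move=> q ab ua ub.
have [||c h [e h1 h2]] := @crossing_down R nu a b (- E) cnu q ab; rewrite ?ltrN2 //.
exists c => //; split; first exact: oppr_inj.
  by move=> x k1 k2; rewrite -ltrN2 h1.
by move=> x k1 k2; rewrite -ltrN2 h2.
Qed.

Lemma u_crossing_down (a b : R) : qconvex nu a b -> a <= b -> u b < E -> E < u a ->
  exists2 c, a < c < b & [/\ u c = E,
    forall x, a <= x -> x < c -> E < u x & forall x, c < x -> x <= b -> u x < E].
Proof.
move=> q ab ua ub.
have [||c h [e h1 h2]] := @crossing_up R nu a b (- E) cnu q ab; rewrite ?ltrN2 //.
exists c => //; split; first exact: oppr_inj.
  by move=> x k1 k2; rewrite -ltrN2 h1.
by move=> x k1 k2; rewrite -ltrN2 h2.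
Qed.

(** The lower branch starts at 0 < E and satisfies l M <= u M < E, so quasiconvexity keeps it below
    E throughout; the upper branch rises through E before m and falls through it after. M is 1, or
    the saddle when u may rise again beyond it. *)
Lemma well_TI (m M : R) : 0 < m -> m < M -> M <= 1 ->
  qconvex nu 0 M -> qconvex l 0 M -> 0 < E -> u M < E -> E < u m ->
  exists y1 y2, branch_well A B E 0 M y1 y2 true true.
Proof.
move=> m0 mM M1 qu ql E0 uM um.
have lE := qconvex_lt ql (E := E); rewrite lfun0 in lE.
have {}lE := lE E0 (le_lt_trans (lfun_le_ufun A B M) uM).
have [|||| y1 /andP[h1 h2] [e1 k1 k2]] := @u_crossing_up 0 m; rewrite ?ufun0 ?(ltW m0) //.
  exact: qconvexW (lexx _) (ltW mM) qu.
have [|||| y2 /andP[h3 h4] [e2 k3 k4]] := @u_crossing_down m M; rewrite ?(ltW mM) //.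
  exact: qconvexW (ltW m0) (lexx _) qu.
exists y1, y2; split => //; apply: well_ul => //; try by left.
- exact: lt_trans h3.
- by move=> x c1 c2; left; exact: k1.
- move=> x c1 c2; split.
    by apply: lE; rewrite ltW ?(lt_trans h1 c1) //= ltW // (lt_trans c2).
  by have [xm|/ltW mx] := leP x m; [exact: k2|exact: k3].
- by move=> x c1 c2; left; exact: k4.
Qed.

(** Both branches start at 0 > E and come down through E. As l < u inside, the lower one does so
    first, which puts the left root on psi = pi. *)
Lemma well_TII_neg (M : R) : 0 < M -> M <= 1 ->
  qconvex nu 0 M -> qconvex l 0 M -> E < 0 -> u M < E ->
  exists y1 y2, branch_well A B E 0 M y1 y2 false true.
Proof.
move=> M0 M1 qu ql E0 uM.
have lM := le_lt_trans (lfun_le_ufun A B M) uM.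
have [||| y1 /andP[h1 h2] [e1 k1 k2]] := @crossing_down R l 0 M E (@continuous_lfun A B) ql;
  rewrite ?lfun0 ?(ltW M0) //.
have [|||| y2 /andP[h3 h4] [e2 k3 k4]] := @u_crossing_down 0 M; rewrite ?ufun0 ?(ltW M0) //.
have y12 : y1 < y2.
  rewrite ltNge; apply/negP => y21.
  have : l y2 < E by rewrite -e2 lfun_lt_ufun // h3 (lt_le_trans h4).
  move: y21; rewrite le_eqVlt => /predU1P[->|y21]; first by rewrite e1 ltxx.
  by rewrite ltNge ltW // k1 // ltW.
exists y1, y2; split => //; apply: well_ul => //; try by [left|right].
- by move=> x c1 c2; right; exact: k1.
- by move=> x c1 c2; split; [apply: k2 => //; rewrite ltW // (lt_trans c2)|
    apply: k3 => //; rewrite ltW // (lt_trans h1)].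
- by move=> x c1 c2; left; exact: k4.
Qed.

(** The upper branch stays above E, so both roots lie on the lower one, on either side of n. *)
Lemma well_TIII (n : R) : 0 < n -> n < 1 -> qconvex l 0 1 ->
  (forall x, 0 < x -> x < 1 -> E < u x) -> E < 0 -> l n < E -> E < l 1 ->
  exists y1 y2, branch_well A B E 0 1 y1 y2 false false.
Proof.
move=> n0 n1 ql uE E0 ln l1.
have [|||| y1 /andP[h1 h2] [e1 k1 k2]] := @crossing_down R l 0 n E (@continuous_lfun A B);
  rewrite ?lfun0 ?(ltW n0) //.
  exact: qconvexW (lexx _) (ltW n1) ql.
have [|||| y2 /andP[h3 h4] [e2 k3 k4]] := @crossing_up R l n 1 E (@continuous_lfun A B);
  rewrite ?(ltW n1) //.
  exact: qconvexW (ltW n0) (lexx _) ql.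
exists y1, y2; split => //; apply: well_ul => //; try by right.
- exact: lt_trans h3.
- by move=> x c1 c2; right; exact: k1.
- move=> x c1 c2; split; first by have [xm|/ltW mx] := leP x n; [exact: k2|exact: k3].
  by apply: uE; [exact: lt_trans c1|exact: lt_trans h4].
- by move=> x c1 c2; right; exact: k4.
Qed.

(* Both branches cross the level upwards; the upper one does so first. *)
Lemma well_up (a c : R) : 0 <= a -> a < 1 -> qconvex l a 1 ->
  a < c < 1 -> u c = E -> (forall x, a <= x -> x < c -> u x < E) ->
  (forall x, c < x -> x < 1 -> E < u x) -> l a < E -> E < l 1 ->
  exists y2, branch_well A B E a 1 c y2 true false.
Proof.
move=> a0 a1 ql /andP[ac c1] uc k1 k2 la l1.
have [||| y2 /andP[h3 h4] [e2 k3 k4]] := @crossing_up R l a 1 E (@continuous_lfun A B) ql;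
  rewrite ?(ltW a1) //.
have c2 : c < y2.
  rewrite ltNge; apply/negP => y21.
  have : l c < E by rewrite -uc lfun_lt_ufun // (le_lt_trans a0 ac) c1.
  move: y21; rewrite le_eqVlt => /predU1P[<-|y21]; first by rewrite e2 ltxx.
  by rewrite ltNge ltW // k4 // ltW.
exists y2; split => //; apply: well_ul => //; try by [left|right].
- by move=> x d1 d2; left; exact: k1.
- by move=> x d1 d2; split; [apply: k3 => //; rewrite ltW // (lt_trans ac)|
    apply: k2 => //; rewrite (lt_trans d2)].
- by move=> x d1 d2; right; exact: k4.
Qed.

End BranchWells.

End Branches.

(** * Shapes of the branches through a cubic *)

Section Shapes.
Variable R : realType.
Implicit Types A B : R.

Lemma is_derive_bfun (x : R) : 0 < x < 1 -> is_derive x (1 : R) (@bfun R) (dbfun x).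
Proof.
move=> x01; have b0 := bfun_gt0 x01.
pose q : {poly R} := (1 - 'X) ^+ 3 * 'X.
have qE y : q.[y] = (1 - y) ^+ 3 * y by rewrite /q !hornerE.
have q0 : 0 < q.[x] by move: b0; rewrite /bfun sqrtr_gt0 qE.
have d1 := is_derive1_sqrt q0.
have dc := @is_derive1_comp _ Num.sqrt (horner q) x _ _ d1 (is_derive_poly q x).
have -> : @bfun R = Num.sqrt \o horner q by apply/funext => y; rewrite /= qE.
apply: (is_derive_eq dc); rewrite qE -/(bfun x) /dbfun mulrC; congr (_ / _).
have e : (1 - 'X : {poly R})^`() = - 1 by rewrite derivB derivX -[1]/(1%:P) derivC sub0r.
rewrite /q !derivM !e !derivX.
rewrite !(hornerD, hornerN, hornerM, hornerC, hornerX).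
by ring.
Qed.

Lemma is_derive_afun A B (x : R) : is_derive x (1 : R) (afun A B) (B * x + A).
Proof.
have -> : afun A B = horner (num_poly A B 0) by apply/funext => y; rewrite num_polyE subr0.
apply: (is_derive_eq (is_derive_poly (num_poly A B 0) x)).
rewrite /num_poly derivB derivD !derivZ derivXn derivX derivC subr0 alg_polyC.
by rewrite !(hornerD, hornerZ, hornerMn, hornerC, hornerX) mulr2n; field.
Qed.

Lemma is_derive_ufun A B (x : R) : 0 < x < 1 ->
  is_derive x (1 : R) (ufun A B) (dufun A B x).
Proof.
move=> x01; have h := is_derive_bfun x01; have k := is_derive_afun A B x.
exact: (@is_deriveD _ _ _ _ _ _ _ _ _ k h).
Qed.

Lemma lfun_oppE A B x : lfun A B x = - ufun (- A) (- B) x.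
Proof. by rewrite /lfun /ufun /afun; ring. Qed.

Lemma dlfun_oppE A B x : dlfun A B x = - dufun (- A) (- B) x.
Proof. by rewrite /dlfun /dufun; ring. Qed.

Lemma ufun_increasing A B (a b : R) : 0 <= a -> b <= 1 ->
  (forall x, a < x -> x < b -> 0 < dufun A B x) ->
  forall x y, a <= x -> x < y -> y <= b -> ufun A B x < ufun A B y.
Proof.
move=> a0 b1 du x y ax xy yb.
have [z||z] := @MVT R (ufun A B) (dufun A B) x y xy.
- rewrite in_itv /= => /andP[xz zy]; apply: is_derive_ufun.
  by rewrite (le_lt_trans a0 (le_lt_trans ax xz)) (lt_le_trans zy (le_trans yb b1)).
- by apply: continuous_subspaceT => z; exact: continuous_ufun.
rewrite in_itv /= => /andP[xz zy] e; rewrite -subr_gt0 e mulr_gt0 ?subr_gt0 //.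
by apply: du; [exact: le_lt_trans xz|exact: lt_le_trans yb].
Qed.

Lemma ufun_decreasing A B (a b : R) : 0 <= a -> b <= 1 ->
  (forall x, a < x -> x < b -> dufun A B x < 0) ->
  forall x y, a <= x -> x < y -> y <= b -> ufun A B y < ufun A B x.
Proof.
move=> a0 b1 du x y ax xy yb.
have [z||z] := @MVT R (ufun A B) (dufun A B) x y xy.
- rewrite in_itv /= => /andP[xz zy]; apply: is_derive_ufun.
  by rewrite (le_lt_trans a0 (le_lt_trans ax xz)) (lt_le_trans zy (le_trans yb b1)).
- by apply: continuous_subspaceT => z; exact: continuous_ufun.
rewrite in_itv /= => /andP[xz zy] e; rewrite -subr_lt0 e nmulr_rlt0 ?subr_gt0 //.
by apply: du; [exact: le_lt_trans xz|exact: lt_le_trans yb].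
Qed.

Definition cubic A B (r : R) : R := r ^+ 3 / 2 + A * r ^+ 2 - 3 / 2 * r + A + B.

Definition radius (x : R) : R := Num.sqrt ((1 - x) / x).

Lemma radius_gt0 x : 0 < x < 1 -> 0 < radius x.
Proof. by move=> /andP[x0 x1]; rewrite sqrtr_gt0 divr_gt0 // subr_gt0. Qed.

Lemma radius_sqr x : 0 < x < 1 -> x * (1 + radius x ^+ 2) = 1.
Proof.
move=> /andP[x0 x1]; rewrite sqr_sqrtr ?divr_ge0 ?subr_ge0 ?ltW //.
by field; rewrite gt_eqF.
Qed.

(** From x (1 + r^2) = 1 come 1 - x = x r^2, 1 - 4 x = x (r^2 - 3) and b = x^2 r^3, so that u' is x
    times a polynomial in r. *)
Lemma dufun_cubic A B x : 0 < x < 1 -> dufun A B x = x * cubic A B (radius x).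
Proof.
move=> x01; have r0 := radius_gt0 x01; have xr := radius_sqr x01.
have /andP[x0 x1] := x01.
have bE : bfun x = x ^+ 2 * radius x ^+ 3.
  have p0 : 0 <= x ^+ 2 * radius x ^+ 3 by rewrite mulr_ge0 ?exprn_ge0 ?ltW.
  rewrite -[RHS]ger0_norm // -sqrtr_sqr; congr Num.sqrt.
  have -> : 1 - x = x * radius x ^+ 2 by rewrite -{1}xr; ring.
  by ring.
rewrite /dufun /dbfun /cubic bE; move: (radius x) r0 xr => r r0 xr.
have -> : (1 - x) ^+ 2 * (1 - 4 * x) = x ^+ 3 * r ^+ 4 * (r ^+ 2 - 3).
  have -> : 1 - x = x * r ^+ 2 by rewrite -{1}xr; ring.
  have -> : 1 - 4 * x = x * (r ^+ 2 - 3) by rewrite -{1}xr; ring.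
  by ring.
have -> : B * x + A = x * (B + A * (1 + r ^+ 2)) by rewrite -{1}[A]mulr1 -{1}xr; ring.
by field; rewrite !gt_eqF.
Qed.

(** [radius] is decreasing with inverse 1 / (1 + r^2), so signs in r are read backwards in x. *)
Lemma radius_lt x (r : R) : 0 < x < 1 -> 0 < r ->
  (radius x < r) = ((1 + r ^+ 2)^-1 < x).
Proof.
move=> x01 r0; have q0 := radius_gt0 x01; have e := radius_sqr x01.
have /andP[x0 x1] := x01.
have d0 : 0 < 1 + r ^+ 2 by rewrite addr_gt0 // exprn_gt0.
rewrite -[LHS](@ltr_pXn2r _ 2) ?nnegrE ?(ltW q0) ?(ltW r0) //.
rewrite invf_plt ?posrE // -(ltrD2l 1).
by have -> : x^-1 = 1 + radius x ^+ 2; [apply: (mulfI (lt0r_neq0 x0)); rewrite mulfV ?e ?gt_eqF|].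
Qed.

Lemma radius_gt x (r : R) : 0 < x < 1 -> 0 < r ->
  (r < radius x) = (x < (1 + r ^+ 2)^-1).
Proof.
move=> x01 r0; have q0 := radius_gt0 x01; have e := radius_sqr x01.
have /andP[x0 x1] := x01.
have d0 : 0 < 1 + r ^+ 2 by rewrite addr_gt0 // exprn_gt0.
rewrite -[LHS](@ltr_pXn2r _ 2) ?nnegrE ?(ltW q0) ?(ltW r0) //.
rewrite invf_pgt ?posrE // -(ltrD2l 1).
by have -> : x^-1 = 1 + radius x ^+ 2; [apply: (mulfI (lt0r_neq0 x0)); rewrite mulfV ?e ?gt_eqF|].
Qed.

(** C' is (3 r^2 + 4 A r - 3) / 2, with roots r = (s - 2 A) / 3 > 0 and -k, where k = (s + 2 A) / 3;
    their product is -1, whence k r = 1, and their sum gives A. Thus [gfun A] is minus the minimal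
    value of C on r > 0 when B = 0. *)
Lemma cubic_minimum A B : exists r k : R,
  [/\ 0 < r, k * r = 1, A = 3 / 4 * (k - r) & cubic A B r = B - gfun A].
Proof.
pose s := Num.sqrt (9 + 4 * A ^+ 2).
have q0 : 0 <= 9 + 4 * A ^+ 2 by rewrite addr_ge0 // mulr_ge0 // sqr_ge0.
have s2 : s ^+ 2 = 9 + 4 * A ^+ 2 by rewrite sqr_sqrtr.
have s0 : 0 <= s by exact: sqrtr_ge0.
have As : 2 * `|A| < s.
  rewrite -(@ltr_pXn2r _ 2) ?nnegrE ?mulr_ge0 // s2 exprMn real_normK ?num_real //.
  by lra.
have [sA sA'] : 0 < s - 2 * A /\ 0 < s + 2 * A.
  have := ler_norm A; have := ler_norm (- A); rewrite normrN; split; lra.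
have r0 : 0 < (s - 2 * A) / 3 by rewrite divr_gt0.
exists ((s - 2 * A) / 3), ((s + 2 * A) / 3); split => //.
- have -> : (s + 2 * A) / 3 * ((s - 2 * A) / 3) = (s ^+ 2 - 4 * A ^+ 2) / 9 by field.
  by rewrite s2; field.
- by field.
rewrite /gfun -/s /cubic.
have s3 : s ^+ 3 = s * (9 + 4 * A ^+ 2) by rewrite -s2; ring.
have -> : ((s - 2 * A) / 3) ^+ 3 / 2 + A * ((s - 2 * A) / 3) ^+ 2 -
   3 / 2 * ((s - 2 * A) / 3) + A + B = (s ^+ 3 - 6 * A * s ^+ 2 + 12 * A ^+ 2 * s - 8 * A ^+ 3) / 54
   + A * (s ^+ 2 - 4 * A * s + 4 * A ^+ 2) / 9 - (s - 2 * A) / 2 + A + B by field.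
have -> : B - 27^-1 * (s - 2 * A) * (9 - 4 * A ^+ 2 - 4 * A * s) =
  B - (9 * s - 4 * A ^+ 2 * s - 4 * A * s ^+ 2 - 18 * A + 8 * A ^+ 3 + 8 * A ^+ 2 * s) / 27 by field.
by rewrite s3 s2; field.
Qed.

Section Cubic.
(* [AE] says that r is a critical point of the cubic. *)
Variables A B r k : R.
Hypotheses (r0 : 0 < r) (kr : k * r = 1) (AE : A = 3 / 4 * (k - r)).
Local Notation C := (cubic A B).

Let k0 : 0 < k.
Proof. by rewrite -(pmulr_lgt0 _ r0) kr. Qed.

(** Expansion at the critical point r: the relation [AE] removes the linear term, which makes the
    sign of the increment visible. *)
Lemma cubicD t t' : C (r + t') - C (r + t) =
  (t' - t) / 2 * (3 / 2 * (r + k) * (t + t') + t ^+ 2 + t * t' + t' ^+ 2).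
Proof.
have -> : C (r + t') - C (r + t) = (t' - t) / 2 *
  (3 * r ^+ 2 + 3 * r * (t + t') + t ^+ 2 + t * t' + t' ^+ 2
   + 2 * A * (2 * r + t + t') - 3) by rewrite /cubic; field.
congr (_ * _); rewrite AE.
have -> : 3 * r ^+ 2 + 3 * r * (t + t') + t ^+ 2 + t * t' + t' ^+ 2 +
   2 * (3 / 4 * (k - r)) * (2 * r + t + t') - 3 =
   3 * (k * r) - 3 + 3 / 2 * (r + k) * (t + t') + t ^+ 2 + t * t' + t' ^+ 2 by field.
by rewrite kr; ring.
Qed.

Lemma cubic_dec x y : 0 <= x -> x < y -> y <= r -> C y < C x.
Proof.
move=> x0 xy yr; rewrite -subr_lt0.
have {1}-> : y = r + - (r - y) by ring.
have {1}-> : x = r + - (r - x) by ring.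
rewrite cubicD; set s := r - x; set t := r - y.
have [s0 t0 st sr] : [/\ 0 < s, 0 <= t, t < s & s <= r] by rewrite /s /t; split; lra.
rewrite pmulr_rlt0; last by rewrite divr_gt0 //; lra.
(* As s, t <= r, one has s^2 + s t + t^2 <= 3 / 2 r (s + t), averaging the two bounds on s t; the
   term in k makes the inequality strict. *)
have h1 : 0 < k * (s + t) by rewrite mulr_gt0 //; lra.
have h2 : s * s <= r * s by rewrite ler_pM2r.
have h3 : t * t <= r * t by rewrite ler_wpM2r //; lra.
have h4 : s * t <= r * t by rewrite ler_wpM2r.
have h5 : t * s <= r * s by rewrite ler_pM2r //; lra.
by rewrite !expr2; lra.
Qed.

Lemma cubic_inc x y : r <= x -> x < y -> C x < C y.
Proof.
move=> rx xy; rewrite -subr_gt0.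
have {1}-> : y = r + (y - r) by ring.
have {1}-> : x = r + (x - r) by ring.
rewrite cubicD; set s := x - r; set t := y - r.
have [s0 t0 st] : [/\ 0 <= s, 0 < t & s < t] by rewrite /s /t; split; lra.
rewrite mulr_gt0 //; first by rewrite divr_gt0 //; lra.
have rk : 0 < r + k by exact: addr_gt0.
have st0 : 0 < s + t by rewrite ltr_wpDl.
have h1 : 0 < (r + k) * (s + t) by exact: mulr_gt0.
have h2 : 0 <= s * t by rewrite mulr_ge0 // ltW.
have := sqr_ge0 s; have := sqr_ge0 t; lra.
Qed.

Lemma cubic_qconvex b : qconvex C 0 b.
Proof.
move=> x y z x0 xy yz zb; rewrite lt_max.
have [yr|ry] := leP y r; first by rewrite cubic_dec.
by rewrite (@cubic_inc y z) ?orbT // ltW.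
Qed.

Lemma cubic_large : exists2 M, r < M & 0 < C M.
Proof.
(* For t >= 1 the increment C (r + t) - C r is at least t / 2, which is 1 / 2 + |C r|. *)
pose t : R := 1 + 2 * `|C r|.
have t1 : 1 <= t by rewrite lerDl mulr_ge0.
exists (r + t); first by lra.
have := cubicD 0 t; rewrite addr0 subr0 add0r mul0r expr0n /= !addr0 => e.
have h1 : 0 <= (r + k) * t.
  by rewrite mulr_ge0 // ?(le_trans ler01 t1) // addr_ge0 // ltW.
have h2 : 1 <= t ^+ 2 by rewrite expr_ge1 //; lra.
have h3 : t / 2 <= C (r + t) - C r.
  rewrite e -[leLHS]mulr1 ler_pM2l; last by lra.
  by lra.
have := ler_norm (- C r); rewrite normrN => h4.
by rewrite /t in h3 *; lra.
Qed.

Lemma continuous_cubic : continuous C.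
Proof.
have -> : C = horner ((1 / 2) *: 'X^3 + A *: 'X^2 - (3 / 2) *: 'X + (A + B)%:P).
  apply/funext => x; rewrite /cubic.
  by rewrite !(hornerD, hornerN, hornerZ, hornerXn, hornerX, hornerC); field.
exact: continuous_horner.
Qed.

(** The suffix names the shape of u as x grows, which runs r backwards: C is negative near r = 0,
    that is near x = 1, where C 0 = A + B, and positive for large r. *)
Lemma cubic_sign_incdec : B < - A -> exists2 p, 0 < p &
  forall x, 0 < x -> [/\ x < p -> C x < 0, x = p -> C x = 0 & p < x -> 0 < C x].
Proof.
move=> BA; have [M rM CM] := cubic_large.
have C0 : C 0 < 0 by rewrite /cubic !expr0n /= !mulr0; lra.
have [|||p /andP[p0 pM] [Cp h1 h2]] := @crossing_up R C 0 M 0 continuous_cubic (@cubic_qconvex M).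
- by rewrite ltW // (lt_trans r0).
- by [].
- by [].
exists p => // x x0; split=> [xp|-> //|px]; first by apply: h1 => //; exact: ltW.
have [xM|Mx] := leP x M; first exact: h2.
by apply: (lt_trans CM); apply: cubic_inc => //; exact: ltW.
Qed.

Lemma cubic_sign_inc : 0 < C r -> forall x, 0 < x -> 0 < C x.
Proof.
move=> Cr x x0; have [xr|rx|->] := ltgtP x r => //.
  by apply: (lt_trans Cr); apply: cubic_dec => //; exact: ltW.
by apply: (lt_trans Cr); apply: cubic_inc.
Qed.

Lemma cubic_sign_incdecinc : - A < B -> C r < 0 -> exists p1 p2,
  [/\ 0 < p1, p1 < p2 & forall x, 0 < x ->
   [/\ x < p1 -> 0 < C x, x = p1 \/ x = p2 -> C x = 0, p1 < x < p2 -> C x < 0 &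
       p2 < x -> 0 < C x]].
Proof.
move=> AB Cr; have [M rM CM] := cubic_large.
have C0 : 0 < C 0 by rewrite /cubic !expr0n /= !mulr0; lra.
have [|||p1 /andP[p0 pr] [Cp h1 h2]] := @crossing_down R C 0 r 0 continuous_cubic (@cubic_qconvex r).
- exact: ltW.
- by [].
- by [].
have q : qconvex C r M by apply: qconvexW (ltW r0) (lexx _) (@cubic_qconvex M).
have [|||p2 /andP[rp pM] [Cp2 h3 h4]] := @crossing_up R C r M 0 continuous_cubic q.
- exact: ltW.
- by [].
- by [].
exists p1, p2; split => //; first exact: lt_trans rp.
move=> x x0; split=> [xp|[->|->] //|/andP[xp xp']|px].
- by apply: h1 => //; exact: ltW.
- by have [xr|/ltW rx] := leP x r; [exact: h2|exact: h3].
have [xM|Mx] := leP x M; first exact: h4.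
by apply: (lt_trans CM); apply: cubic_inc => //; exact: ltW.
Qed.

End Cubic.

Lemma inv1sqr_itv (p : R) : 0 < p -> 0 < (1 + p ^+ 2)^-1 < 1.
Proof.
move=> p0; have h : 0 < p ^+ 2 by rewrite exprn_gt0.
by rewrite invr_gt0 invf_lt1 ?addr_gt0 // ltrDl h.
Qed.

Lemma radius_inv (p : R) : 0 < p -> radius (1 + p ^+ 2)^-1 = p.
Proof.
move=> p0; have m01 := inv1sqr_itv p0.
by apply/eqP; rewrite eq_le !leNgt radius_lt // radius_gt // !ltxx.
Qed.

Lemma dufun_inc A B : gfun A < B -> forall x, 0 < x < 1 -> 0 < dufun A B x.
Proof.
move=> gB x x01; have [r [k [r0 kr AE Cr]]] := cubic_minimum A B.
have /andP[x0 _] := x01; rewrite dufun_cubic // mulr_gt0 //.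
by apply: (cubic_sign_inc r0 kr AE) => //; [rewrite Cr subr_gt0|exact: radius_gt0].
Qed.

Lemma dufun_incdec A B : B < - A -> exists2 m, 0 < m < 1 &
  forall x, 0 < x < 1 ->
  [/\ x < m -> 0 < dufun A B x, x = m -> dufun A B x = 0 & m < x -> dufun A B x < 0].
Proof.
move=> BA; have [r [k [r0 kr AE Cr]]] := cubic_minimum A B.
have [p p0 sgn] := cubic_sign_incdec r0 kr AE BA.
exists (1 + p ^+ 2)^-1; first exact: inv1sqr_itv.
move=> x x01; have [h1 h2 h3] := sgn _ (radius_gt0 x01); have /andP[x0 _] := x01.
rewrite dufun_cubic //; split=> [xm|xm|mx].
- by rewrite mulr_gt0 // h3 // radius_gt.
- by rewrite h2 ?mulr0 // xm radius_inv.
- by rewrite pmulr_rlt0 // h1 // radius_lt.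
Qed.

(** The larger zero p2 of the cubic gives the smaller critical point m1, since 1 / (1 + r^2)
    decreases in r. *)
Lemma dufun_incdecinc A B : - A < B < gfun A -> exists m1 m2,
  [/\ 0 < m1, m1 < m2, m2 < 1 & forall x, 0 < x < 1 ->
  [/\ x < m1 -> 0 < dufun A B x, x = m1 \/ x = m2 -> dufun A B x = 0,
      m1 < x < m2 -> dufun A B x < 0 & m2 < x -> 0 < dufun A B x]].
Proof.
move=> /andP[AB Bg]; have [r [k [r0 kr AE Cr]]] := cubic_minimum A B.
have [|p1 [p2 [p10 p12 sgn]]] := cubic_sign_incdecinc r0 kr AE AB.
  by rewrite Cr subr_lt0.
have p20 := lt_trans p10 p12.
exists (1 + p2 ^+ 2)^-1, (1 + p1 ^+ 2)^-1; split.
- by have /andP[] := inv1sqr_itv p20.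
- rewrite ltf_pV2 ?posrE ?addr_gt0 ?exprn_gt0 // ltrD2l.
  by rewrite ltr_pXn2r ?nnegrE // ltW.
- by have /andP[] := inv1sqr_itv p10.
move=> x x01; have [h1 h2 h3 h4] := sgn _ (radius_gt0 x01); have /andP[x0 _] := x01.
rewrite dufun_cubic //; split=> [xm|xm|/andP[mx xm]|mx].
- by rewrite mulr_gt0 // h4 // radius_gt.
- rewrite h2 ?mulr0 //; case: xm => ->; rewrite radius_inv //; by [left|right].
- by rewrite pmulr_rlt0 // h3 //; apply/andP; rewrite radius_gt // radius_lt.
- by rewrite mulr_gt0 // h1 // radius_lt.
Qed.

Lemma dec_inc_qconvex (f : R -> R) (a m b : R) :
  (forall x y, a <= x -> x < y -> y <= m -> f y < f x) ->
  (forall x y, m <= x -> x < y -> y <= b -> f x < f y) -> qconvex f a b.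
Proof.
move=> dec inc x y z ax xy yz zb; rewrite lt_max.
by have [ym|/ltW my] := leP y m; [rewrite dec|rewrite (inc y z) ?orbT].
Qed.

End Shapes.

(** * Critical points, the saddle value and the symmetry *)

Section CriticalPoints.
Variable R : realType.
Implicit Types A B : R.

Lemma is_derive_Flift_angle A B (s x : R) :
  is_derive s (1 : R) (fun t => Flift A B (t, x)) (- (bfun x * sin s)).
Proof.
have d := @is_deriveD _ _ _ _ _ _ _ _ _ (is_derive_cst (afun A B x) s (1 : R))
  (@is_deriveZ _ _ _ _ (bfun x) _ _ _ (is_derive_cos s)).
by apply: (is_derive_eq d); rewrite /GRing.scale /= add0r mulrN.
Qed.

Lemma is_derive_Flift_pos A B (s x : R) : 0 < x < 1 ->
  is_derive x (1 : R) (fun y => Flift A B (s, y)) (B * x + A + dbfun x * cos s).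
Proof.
move=> x01.
have d := @is_deriveD _ _ _ _ _ _ _ _ _ (is_derive_afun A B x)
  (@is_deriveZ _ _ _ _ (cos s) _ _ _ (is_derive_bfun x01)).
have -> : (fun y => Flift A B (s, y)) = (afun A B + (cos s) \*: (@bfun R))%R.
  by apply/funext => y; rewrite /Flift /= mulrC.
by apply: (is_derive_eq d); rewrite /GRing.scale /= [cos s * _]mulrC.
Qed.

Lemma criticalE A B (s x : R) : critical A B (s, x) <->
  [/\ 0 < x < 1, sin s = 0 & B * x + A + dbfun x * cos s = 0].
Proof.
split=> [[x01 d1 d2]|[x01 h1 h2]].
  have b0 := bfun_gt0 x01; split => //.
    have [_ e1] := d1; have [_ e2] := is_derive_Flift_angle A B s x.
    rewrite /= in e1; move: e2; rewrite e1 => /esym/eqP; rewrite oppr_eq0 mulf_eq0.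
    by rewrite (gt_eqF b0) => /eqP.
  have [_ e1] := d2; have [_ e2] := is_derive_Flift_pos A B s x01.
  by rewrite /= in e1; move: e2; rewrite e1 => ->.
split; [exact: x01| |].
  by apply: (is_derive_eq (is_derive_Flift_angle A B s x)); rewrite h1 mulr0 oppr0.
by apply: (is_derive_eq (is_derive_Flift_pos A B s x01)).
Qed.

Lemma Flift0 A B x : Flift A B (0, x) = ufun A B x.
Proof. by rewrite /Flift /= cos0 mulr1. Qed.

Lemma Fliftpi A B x : Flift A B (pi, x) = lfun A B x.
Proof. by rewrite /Flift /= cospi mulrN1. Qed.

Lemma Flift_le A B s x : lfun A B x <= Flift A B (s, x) <= ufun A B x.
Proof.
have b0 : 0 <= bfun x by exact: sqrtr_ge0.
rewrite /Flift /lfun /ufun /=; have := cos_le1 s; have := cos_geN1 s; move: (cos s) => c c1 c2.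
by apply/andP; split; nra.
Qed.

Lemma noncritical_level A B E : ~ critical_value A B E -> noncritical A B E.
Proof.
move=> nc x x01; split=> e; apply/eqP => d; apply: nc.
- exists (0, x); last by rewrite Flift0.
  by apply/criticalE; rewrite sin0 cos0 mulr1; split.
- exists (pi, x); last by rewrite Fliftpi.
  by apply/criticalE; rewrite sinpi cospi mulrN1; split.
Qed.

Lemma noncritical_opp A B E : noncritical A B E -> noncritical (- A) (- B) (- E).
Proof.
move=> nc x x01; have [h1 h2] := nc x x01; split=> e.
- have k : dlfun A B x = - dufun (- A) (- B) x := dlfun_oppE A B x.
  by rewrite -oppr_eq0 -k; apply: h2; rewrite lfun_oppE e opprK.
- rewrite dlfun_oppE !opprK oppr_eq0; apply: h1.
  by move: e; rewrite lfun_oppE !opprK => /oppr_inj.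
Qed.

Lemma Flift_opp A B s x : Flift (- A) (- B) (s + pi, x) = - Flift A B (s, x).
Proof. by rewrite /Flift /= cosDpi /afun; ring. Qed.

Lemma Flift_opp' A B s x : Flift (- A) (- B) (s - pi, x) = - Flift A B (s, x).
Proof.
have e : cos (s - pi) = - cos s by rewrite -[in RHS](subrK pi s) cosDpi opprK.
by rewrite /Flift /= e /afun; ring.
Qed.

Lemma near_shift (Q : R * R -> Prop) (d : R) (p : R * R) :
  (\forall q \near p, Q q) ->
  \forall q \near (p.1 + d, p.2), Q (q.1 - d, q.2).
Proof.
move=> /nbhs_ballP[e /= e0 he]; apply/nbhs_ballP; exists e => //= q [].
rewrite /ball /= => h1 h2; apply: he; split; rewrite /ball //=.
by have -> : p.1 - (q.1 - d) = p.1 + d - q.1 by ring.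
Qed.

(** Half turns in both directions are allowed because angles are lifted to the real line: the
    symmetry is undone by the opposite shift. *)
Lemma critical_opp A B s x d : d = pi \/ d = - pi ->
  critical A B (s, x) -> critical (- A) (- B) (s + d, x).
Proof.
move=> hd /criticalE[x01 h1 h2]; apply/criticalE.
have [-> ->] : sin (s + d) = - sin s /\ cos (s + d) = - cos s.
  case: hd => ->; first by rewrite sinDpi cosDpi.
  by rewrite -{2 4}(subrK pi s) sinDpi cosDpi !opprK.
split => //; first by rewrite h1 oppr0.
by rewrite -[RHS]oppr0 -[X in _ = - X]h2; ring.
Qed.

Lemma Flift_shift A B s x d : d = pi \/ d = - pi ->
  Flift (- A) (- B) (s + d, x) = - Flift A B (s, x).
Proof. by case=> ->; [exact: Flift_opp|exact: Flift_opp']. Qed.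

Lemma loc_max_opp A B s x d : d = pi \/ d = - pi ->
  loc_max A B (s, x) -> loc_min (- A) (- B) (s + d, x).
Proof.
move=> hd h; have := near_shift d h; apply: filterS => -[t y] /= k.
rewrite Flift_shift // -[t](subrK d) Flift_shift // lerN2 //.
Qed.

Lemma loc_min_opp A B s x d : d = pi \/ d = - pi ->
  loc_min A B (s, x) -> loc_max (- A) (- B) (s + d, x).
Proof.
move=> hd h; have := near_shift d h; apply: filterS => -[t y] /= k.
rewrite Flift_shift // -[t](subrK d) Flift_shift // lerN2 //.
Qed.

Lemma saddle_opp A B s x d : d = pi \/ d = - pi ->
  saddle A B (s, x) -> saddle (- A) (- B) (s + d, x).
Proof.
move=> hd [h1 h2 h3]; have hd' : - d = pi \/ - d = - pi.
  by case: hd => ->; [right|left]; rewrite ?opprK.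
split; first exact: critical_opp.
- by move=> /(loc_max_opp hd'); rewrite addrK !opprK.
- by move=> /(loc_min_opp hd'); rewrite addrK !opprK.
Qed.

Lemma xmin_opp A B : xmin A B = xmax (- A) (- B).
Proof.
rewrite /xmin /xmax; congr (get _); apply/seteqP; split=> x [h1 h2] /=.
  rewrite -(subrr pi); split; first by apply: critical_opp h1; right.
  by apply: loc_min_opp h2; right.
rewrite -(add0r pi) -[A]opprK -[B]opprK.
by split; [apply: critical_opp h1; left|apply: loc_max_opp h2; left].
Qed.

Section TwoCriticalPoints.
Variables A B m1 m2 n : R.
Hypotheses (m10 : 0 < m1) (m12 : m1 < m2) (m21 : m2 < 1) (n01 : 0 < n < 1).
Hypothesis du : forall x, 0 < x < 1 ->
  [/\ x < m1 -> 0 < dufun A B x, x = m1 \/ x = m2 -> dufun A B x = 0,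
      m1 < x < m2 -> dufun A B x < 0 & m2 < x -> 0 < dufun A B x].
Hypothesis dl : forall x, 0 < x < 1 ->
  [/\ x < n -> dlfun A B x < 0, x = n -> dlfun A B x = 0 & n < x -> 0 < dlfun A B x].
Local Notation u := (ufun A B).
Local Notation l := (lfun A B).

Lemma u_inc1 x y : 0 <= x -> x < y -> y <= m1 -> u x < u y.
Proof.
move: x y; apply: ufun_increasing => // [|x x0 xm]; first by apply/ltW/(lt_trans m12).
have [|h _ _ _] := du (x := x); last exact: h.
by rewrite x0 (lt_trans xm) // (lt_trans m12).
Qed.

Lemma u_dec x y : m1 <= x -> x < y -> y <= m2 -> u y < u x.
Proof.
move: x y; apply: ufun_decreasing => [||x x0 xm]; [exact: ltW|exact: ltW|].
have [|_ _ h _] := du (x := x); last by apply: h; rewrite x0.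
by rewrite (lt_trans m10) // (lt_trans xm).
Qed.

Lemma u_inc2 x y : m2 <= x -> x < y -> y <= 1 -> u x < u y.
Proof.
move: x y; apply: ufun_increasing => // [|x x0 xm]; first by apply/ltW/(lt_trans m10).
have [|_ _ _ h] := du (x := x); last exact: h.
by rewrite xm andbT (lt_trans _ x0) // (lt_trans m10).
Qed.

Lemma l_dec x y : 0 <= x -> x < y -> y <= n -> l y < l x.
Proof.
have /andP[n0 n1] := n01.
rewrite !lfun_oppE ltrN2; move: x y; apply: ufun_increasing => [||x x0 xn] //; first exact: ltW.
have x01 : 0 < x < 1 by rewrite x0 (lt_trans xn).
by have [h _ _] := dl x01; rewrite -oppr_lt0 -dlfun_oppE h.
Qed.

Lemma l_inc x y : n <= x -> x < y -> y <= 1 -> l x < l y.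
Proof.
have /andP[n0 n1] := n01.
rewrite !lfun_oppE ltrN2; move: x y; apply: ufun_decreasing => [||x x0 xn] //; first exact: ltW.
have x01 : 0 < x < 1 by rewrite xn andbT (lt_trans n0).
by have [_ _ h] := dl x01; rewrite -oppr_gt0 -dlfun_oppE h.
Qed.

Lemma u_le_max x : 0 <= x -> x <= m2 -> u x <= u m1.
Proof.
move=> x0 xm; have [h|h|->] := ltgtP x m1 => //; apply: ltW.
  exact: u_inc1.
exact: u_dec.
Qed.

Lemma l_ge_min x : 0 <= x -> x <= 1 -> l n <= l x.
Proof.
move=> x0 xm; have [h|h|->] := ltgtP x n => //; apply: ltW.
  exact: l_dec.
exact: l_inc.
Qed.

Lemma near_snd_itv (s x a b : R) : a < x -> x < b ->
  \forall q \near (s, x), a < q.2 /\ q.2 < b.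
Proof.
move=> ax xb.
have cv : (fun q : R * R => q.2) q @[q --> (s, x)] --> x by exact: cvg_snd.
have h1 : \forall q \near (s, x), a < q.2 by exact: (cvgr_gt _ cv).
have h2 : \forall q \near (s, x), q.2 < b by exact: (cvgr_lt _ cv).
near=> q; split; by near: q.
Unshelve. all: by end_near. Qed.

Lemma loc_max_m1 s : cos s = 1 -> loc_max A B (s, m1).
Proof.
move=> cs; have := near_snd_itv s m10 m12; apply: filterS => -[t y] /= [y0 ym].
have -> : Flift A B (s, m1) = u m1 by rewrite /Flift /= cs mulr1.
have /andP[_ h] := Flift_le A B t y; apply: (le_trans h).
by apply: u_le_max; exact: ltW.
Qed.

Lemma loc_min_n s : cos s = - 1 -> loc_min A B (s, n).
Proof.
have /andP[n0 n1] := n01.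
move=> cs; have := near_snd_itv s n0 n1; apply: filterS => -[t y] /= [y0 ym].
have -> : Flift A B (s, n) = l n by rewrite /Flift /= cs mulrN1.
have /andP[h _] := Flift_le A B t y; apply: (le_trans _ h).
by apply: l_ge_min; exact: ltW.
Qed.

Lemma critical_m (m : R) : m = m1 \/ m = m2 -> critical A B (0, m).
Proof.
move=> hm; apply/criticalE; rewrite sin0 cos0 mulr1.
have m01 : 0 < m < 1.
  case: hm => ->; first by rewrite m10 (lt_trans m12).
  by rewrite m21 andbT (lt_trans m10).
by split => //; have [_ h _ _] := du m01; exact: h.
Qed.

Lemma near_nbhs_ex (Q : R * R -> Prop) (p : R * R) : (\forall q \near p, Q q) ->
  exists2 e : R, 0 < e & forall q : R * R, `|q.1 - p.1| < e -> `|q.2 - p.2| < e -> Q q.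
Proof.
move=> /nbhs_ballP[e /= e0 he]; exists e => // q h1 h2.
by apply: he; split; rewrite /ball /= distrC.
Qed.

Lemma not_loc_max_m2 s : cos s = 1 -> ~ loc_max A B (s, m2).
Proof.
move=> cs /near_nbhs_ex[e e0 he].
pose d := Num.min (e / 2) ((1 - m2) / 2).
have d0 : 0 < d by rewrite lt_min !divr_gt0 // subr_gt0.
have [de d1] : d <= e / 2 /\ d <= (1 - m2) / 2 by rewrite !ge_min !lexx orbT.
have de' : d < e by lra.
have : Flift A B (s, m2 + d) <= Flift A B (s, m2).
  apply: he => /=; first by rewrite subrr normr0.
  by rewrite addrAC subrr add0r gtr0_norm.
rewrite /Flift /= cs !mulr1 -!/(ufun A B _) leNgt.
by rewrite u_inc2 // ?ltrDl //; lra.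
Qed.

(** F decreases as the angle leaves 0, since b > 0 at m2. *)
Lemma not_loc_min_m2 : ~ loc_min A B (0, m2).
Proof.
move=> /near_nbhs_ex[e e0 he].
have pi0 := pi_gt0 R.
pose d := Num.min (e / 2) (pi / 2).
have d0 : 0 < d by rewrite lt_min !divr_gt0.
have [de d1] : d <= e / 2 /\ d <= pi / 2 by rewrite !ge_min !lexx orbT.
have de' : d < e by lra.
have : Flift A B (0, m2) <= Flift A B (d, m2).
  by apply: he => /=; [rewrite subr0 gtr0_norm|rewrite subrr normr0].
have m201 : 0 < m2 < 1 by rewrite m21 andbT (lt_trans m10).
have b0 := bfun_gt0 m201.
rewrite /Flift /= cos0 mulr1 lerD2l leNgt => /negP; apply.
rewrite -[ltRHS]mulr1 ltr_pM2l // lt_neqAle cos_le1 andbT.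
apply/eqP => c1; have : sin d = 0 by apply: cos1sin0; rewrite c1 normr1.
apply/eqP; rewrite gt_eqF // sin_gt0_pi // d0 /=.
by apply: (le_lt_trans d1); rewrite ltr_pdivrMr // ltr_pMr // ltr1n.
Qed.

(** At a critical point cos s is 1 or -1. In the first case x is m1, a maximum, or m2; in the second
    x = n, a minimum. Only m2 remains, at all angles congruent to 0 and with a single value of F, so
    the choice made in [Esad] is determined. *)
Lemma saddle_values : [set e : R | exists2 p, saddle A B p & Flift A B p = e] = [set u m2].
Proof.
apply/seteqP; split=> e /=; last first.
  move=> ->; exists (0, m2); last by rewrite Flift0.
  split; [by apply: critical_m; right|by apply: not_loc_max_m2; rewrite cos0|exact: not_loc_min_m2].
move=> [[s x] [/criticalE[x01 sn dx] nmax nmin] <-].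
have := sin0cos1 sn => c1.
have [c0|c0] := leP 0 (cos s).
  have {c1}c1 : cos s = 1 by rewrite ger0_norm in c1.
  have : dufun A B x = 0 by rewrite /dufun -[RHS]dx c1 mulr1.
  have [h1 h2 h3 h4] := du x01.
  have [xm|mx|xm] := ltgtP x m1.
  - by have := h1 xm => /[swap] ->; rewrite ltxx.
  - have [xm2|mx2|->] := ltgtP x m2.
    + by have := h3 (introT andP (conj mx xm2)) => /[swap] ->; rewrite ltxx.
    + by have := h4 mx2 => /[swap] ->; rewrite ltxx.
    + by rewrite /Flift /= c1 mulr1.
  - by case: nmax; rewrite xm; exact: loc_max_m1.
have {c1}c1 : cos s = - 1 by rewrite ltr0_norm // in c1; rewrite -c1 opprK.
have : dlfun A B x = 0 by rewrite /dlfun -[RHS]dx c1 mulrN1.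
have [h1 h2 h3] := dl x01.
have [xm|mx|xm] := ltgtP x n.
- by have := h1 xm => /[swap] ->; rewrite ltxx.
- by have := h3 mx => /[swap] ->; rewrite ltxx.
- by case: nmin; rewrite xm; exact: loc_min_n.
Qed.

Lemma EsadE : Esad A B = u m2.
Proof.
rewrite /Esad saddle_values.
by have /= := getPex (ex_intro [set u m2] (u m2) erefl).
Qed.

Lemma Esad_oppE : Esad (- A) (- B) = - u m2.
Proof.
rewrite /Esad.
have -> : [set e : R | exists2 p, saddle (- A) (- B) p & Flift (- A) (- B) p = e] = [set - u m2].
  apply/seteqP; split=> e /=.
    move=> [[s x] sp <-].
    have : [set e : R | exists2 p, saddle A B p & Flift A B p = e] (- Flift (- A) (- B) (s, x)).
      exists (s + pi, x); last by rewrite -Flift_opp !opprK.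
      by have := @saddle_opp (- A) (- B) s x pi (or_introl erefl) sp; rewrite !opprK.
    by rewrite saddle_values /= => <-; rewrite opprK.
  move=> ->.
  have : [set e : R | exists2 p, saddle A B p & Flift A B p = e] (u m2) by rewrite saddle_values.
  move=> [[s x] sp <-]; exists (s + pi, x); last by rewrite Flift_opp.
  by apply: saddle_opp sp; left.
by have /= := getPex (ex_intro [set - u m2] (- u m2) erefl).
Qed.

Lemma xmaxE : xmax A B = m1.
Proof.
have ex : exists x : R, [set x | critical A B (0, x) /\ loc_max A B (0, x)] x.
  by exists m1; split; [apply: critical_m; left|apply: loc_max_m1; rewrite cos0].
have [/criticalE[x01 _ dx] lm] := getPex ex.
rewrite /xmax; move: (get _) x01 dx lm => x x01.
rewrite cos0 mulr1 -/(dufun A B x) => dx lm.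
have [h1 h2 h3 h4] := du x01.
have [xm|mx|//] := ltgtP x m1.
  by have := h1 xm; rewrite dx ltxx.
have [xm2|mx2|xm2] := ltgtP x m2.
- by have := h3 (introT andP (conj mx xm2)); rewrite dx ltxx.
- by have := h4 mx2; rewrite dx ltxx.
- by move: lm; rewrite xm2 => /not_loc_max_m2; rewrite cos0 => /(_ erefl).
Qed.

End TwoCriticalPoints.

End CriticalPoints.

(** * Components of energy regions on the cylinder *)

Section Circle.
Variable R : realType.

Lemma ang_eq (s t : R) (k : int) : s - t = k%:~R * (pi *+ 2) -> ang s = ang t.
Proof.
move=> e; apply/eqmodP => /=; rewrite /angle_rel e mulfK; first exact: intr_int.
by rewrite mulrn_eq0 negb_or /= gt_eqF // pi_gt0.
Qed.

Lemma ang_eqP (s t : R) : ang s = ang t -> exists k : int, s - t = k%:~R * (pi *+ 2).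
Proof.
move=> /eqmodP /= /intrP[k e]; exists k; rewrite -e divfK //.
by rewrite mulrn_eq0 negb_or /= gt_eqF // pi_gt0.
Qed.

Lemma cos_ang (s t : R) : ang s = ang t -> cos s = cos t.
Proof.
move=> /ang_eqP[k e]; have -> : s = t + k%:~R * (pi *+ 2) by rewrite -e addrC subrK.
case: k {e} => n.
  elim: n => [|n IH]; first by rewrite mul0r addr0.
  by rewrite -[RHS]IH -addn1 PoszD rmorphD /= mulrDl mul1r addrA cosD2pi.
rewrite NegzE rmorphN /= mulNr.
elim: n.+1 => [|m IH]; first by rewrite mul0r subr0.
rewrite -[LHS]cosD2pi -[RHS]IH; congr cos.
by rewrite -addn1 PoszD rmorphD /= mulrDl mul1r; ring.
Qed.

Lemma F_ang A B (s x : R) : F A B (ang s, x) = Flift A B (s, x).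
Proof.
rewrite /F /Flift /=; congr (_ + _ * _); apply: cos_ang.
by rewrite /ang reprK.
Qed.

Lemma ang_repr (c : circle R) : ang (repr c) = c.
Proof. by rewrite /ang reprK. Qed.

Lemma continuous_ang : continuous (@ang R).
Proof. exact: pi_continuous. Qed.

Lemma ang_reduce (s : R) : exists2 t, ang t = ang s & - pi <= t <= pi.
Proof.
have pi0 := pi_gt0 R; have p2 : 0 < (pi : R) *+ 2 by rewrite mulrn_wgt0.
pose k := Num.floor ((s + pi) / (pi *+ 2)).
exists (s - k%:~R * (pi *+ 2)).
  by apply: (@ang_eq _ _ (- k)); rewrite rmorphN /= mulNr; ring.
have /andP[h1 h2] := Num.Theory.real_floor_itv (num_real ((s + pi) / (pi *+ 2))).
rewrite -/k ler_pdivlMr // in h1; rewrite -/k ltr_pdivrMr // in h2.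
rewrite rmorphD /= mulrDl mul1r in h2.
move: (k%:~R * _) h1 h2 => q h1 h2; rewrite mulr2n in h2.
by apply/andP; split; lra.
Qed.

Lemma path_component (T : topologicalType) (S : set T) (f : R -> T) (a b : R) :
  a <= b -> {within `[a, b], continuous f} -> (forall t, a <= t <= b -> S (f t)) ->
  connected_component S (f a) (f b).
Proof.
move=> ab cf Sf; exists (f @` `[a, b]%classic).
  split.
  - by exists a => //; rewrite /= in_itv /= lexx.
  - by move=> _ [t /= tab <-]; apply: Sf; rewrite in_itv /= in tab.
  - by apply: connected_continuous_connected => //; exact: segment_connected.
by exists b => //; rewrite /= in_itv /= lexx ab.
Qed.

Lemma cos_scale (s t : R) : - pi <= s <= pi -> 0 <= t <= 1 -> cos s <= cos (t * s).
Proof.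
wlog s0 : s / 0 <= s => [hw|/andP[_ spi] /andP[t0 t1]].
  have [/hw//|s0 /andP[h1 h2] t01] := leP 0 s.
  by rewrite -cosN -[leRHS]cosN -mulrN; apply: hw => //; lra.
have ts : t * s <= s by rewrite ler_piMl.
have ts0 : 0 <= t * s by rewrite mulr_ge0.
rewrite leNgt ltr_cos ?in_itv /= ?s0 ?ts0 ?spi ?(le_trans ts) //.
by rewrite -leNgt.
Qed.

Lemma continuous_pair (T : topologicalType) (f : R -> T) (g : R -> R) (x : R) :
  {for x, continuous f} -> {for x, continuous g} ->
  {for x, continuous (fun y => (f y, g y))}.
Proof. by move=> cf cg; exact: (cvg_pair cf cg). Qed.

(* Component of a superlevel set, up to a rotation by th: turn to the line
   psi = 0, where F increases, and follow that line. *)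
Lemma superlevel_component A B (th m1 m2 Es : R) (S : set (circle R * R)) :
  0 < m1 -> m1 < m2 -> m2 < 1 ->
  (forall x y, 0 <= x -> x < y -> y <= m1 -> ufun A B x < ufun A B y) ->
  (forall x y, m1 <= x -> x < y -> y <= m2 -> ufun A B y < ufun A B x) ->
  (forall s y, 0 < y < 1 -> Es < Flift A B (s, y) -> S (ang (s + th), y)) ->
  forall s x, 0 < x -> x < m2 -> Es < Flift A B (s, x) ->
    connected_component S (ang th, m1) (ang (s + th), x).
Proof.
move=> m10 m12 m21 inc dec hS s x x0 xm EF.
have [t ts tpi] := ang_reduce s.
have {ts} tsth : ang (t + th) = ang (s + th).
  have [k e] := ang_eqP ts; apply: (@ang_eq _ _ k); rewrite -e; ring.
have cts : cos t = cos s.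
  have [k e] := ang_eqP tsth; apply: cos_ang; apply: (@ang_eq _ _ k).
  by rewrite -e; ring.
rewrite -tsth; have x01 : 0 < x < 1 by rewrite x0 (lt_trans xm).
have b0 := bfun_gt0 x01.
have {}EF : Es < Flift A B (t, x) by move: EF; rewrite /Flift /= cts.
have Eu : Es < ufun A B x by have /andP[_ h] := Flift_le A B t x; exact: lt_le_trans h.
have line y : 0 < y < 1 -> Es < ufun A B y -> S (ang th, y).
  by move=> y01 h; rewrite -[th]add0r; apply: hS => //; rewrite Flift0.
have cline (a b : R) : {within `[a, b], continuous (fun y : R => (ang th, y))}.
  apply: continuous_subspaceT => y.
  by apply: (@continuous_pair _ (fun=> ang th) id); [exact: cvg_cst|exact: cvg_id].
(* Between x and m1 the upper branch stays above its value at x, by monotonicity on either side of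
   m1. *)
have step1 : connected_component S (ang th, m1) (ang th, x).
  have [xm1|m1x] := leP x m1.
    apply/connected_component_sym.
    apply: (@path_component _ S (fun y => (ang th, y)) x m1 xm1) => //.
    move=> y /andP[xy ym]; apply: line; first by rewrite (lt_le_trans x0 xy) (le_lt_trans ym) // (lt_trans m12).
    move: xy; rewrite le_eqVlt => /predU1P[<- //|xy].
    by apply: (lt_trans Eu); apply: inc => //; exact: ltW.
  apply: (@path_component _ S (fun y => (ang th, y)) m1 x (ltW m1x)) => //.
  move=> y /andP[my yx]; apply: line; first by rewrite (lt_le_trans m10 my) (le_lt_trans yx) // (lt_trans xm).
  move: yx; rewrite le_eqVlt => /predU1P[-> //|yx].
  by apply: (lt_trans Eu); apply: dec => //; exact: ltW.
apply: (connected_component_trans step1).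
have -> : (ang th, x) = (ang (0 * t + th), x) by rewrite mul0r add0r.
rewrite -[in X in connected_component S _ X](mul1r t).
apply: (@path_component _ S (fun r => (ang (r * t + th), x)) 0 1 ler01).
  apply: continuous_subspaceT => y.
  apply: (@continuous_pair _ (fun r => ang (r * t + th)) (fun=> x)); last exact: cvg_cst.
  apply: continuous_comp; last exact: continuous_ang.
  by apply: cvgD; [apply: cvgM; [exact: cvg_id|exact: cvg_cst]|exact: cvg_cst].
move=> r r01; apply: hS => //; apply: (lt_le_trans EF).
by rewrite /Flift /= lerD2l ler_pM2l // cos_scale.
Qed.

(* Follow the level curve to the line psi = pi, then that line down to x = 0. *)
Lemma level_component A B (th E Es y1 : R) (S : set (circle R * R)) :
  0 < y1 -> Es < E -> E < 0 -> lfun A B y1 = E ->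
  (forall y, 0 < y -> y < y1 -> E < lfun A B y < 0) ->
  (forall s y, 0 < y < 1 -> Es < Flift A B (s, y) -> Flift A B (s, y) < 0 ->
     S (ang (s + th), y)) ->
  forall s x, y1 <= x -> x < 1 -> Flift A B (s, x) = E ->
    (forall y, y1 <= y <= x -> lfun A B y <= E <= ufun A B y) ->
    closure (connected_component S (ang (s + th), x)) (ang (pi + th), 0).
Proof.
move=> y10 EsE E0 ly1 ly hS s x y1x x1 Fs lu.
have [t ts tpi] := ang_reduce s.
have tsth : ang (t + th) = ang (s + th).
  have [k e] := ang_eqP ts; apply: (@ang_eq _ _ k); rewrite -e; ring.
have cts : cos t = cos s by exact: cos_ang.
rewrite -tsth.
have {}Fs : Flift A B (t, x) = E by move: Fs; rewrite /Flift /= cts.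
pose N := num_poly A B E.
(* The arccos only reaches angles in [0, pi]; eps puts the curve on the side of t. *)
pose eps : R := if 0 <= t then 1 else -1.
pose f y := (ang (eps * acosc (zpoly N y) + th), y).
have in01 y : y1 <= y <= x -> 0 < y < 1.
  by move=> /andP[h1 h2]; rewrite (lt_le_trans y10 h1) (le_lt_trans h2 x1).
have cosN1 (r : R) : cos (eps * r) = cos r.
  by rewrite /eps; case: ifP; rewrite ?mul1r // mulN1r cosN.
have zE y : 0 < y < 1 -> bfun y * zpoly N y = E - afun A B y.
  by move=> /bfun_gt0 b0; rewrite /zpoly num_polyE; field; rewrite gt_eqF.
have zitv y : y1 <= y <= x -> -1 <= zpoly N y <= 1.
  move=> yy; have y01 := in01 y yy; have b0 := bfun_gt0 y01.
  have /andP[h1 h2] := lu y yy; have e := zE y y01.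
  apply/andP; split; rewrite -(ler_pM2l b0) e.
    by move: h1; rewrite /lfun; lra.
  by move: h2; rewrite /ufun; lra.
have Ff y : y1 <= y <= x -> Flift A B (eps * acosc (zpoly N y), y) = E.
  move=> yy; rewrite /Flift /= cosN1 cos_acosc clamp_id ?zitv // zE ?in01 //.
  by rewrite addrC subrK.
have fx : f x = (ang (t + th), x).
  rewrite /f; congr (ang (_ + _), _).
  have xx : y1 <= x <= x by rewrite y1x lexx.
  have b0 := bfun_gt0 (in01 x xx).
  have -> : zpoly N x = cos t.
    by apply: (mulfI (lt0r_neq0 b0)); rewrite zE ?in01 // -Fs /Flift /=; ring.
  rewrite acosc_id ?cos_geN1 ?cos_le1 // /eps; move: tpi => /andP[h1 h2].
  case: ifPn => [t0|]; first by rewrite cosK ?mul1r // in_itv /= t0.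
  by rewrite -ltNge => t0; rewrite cosKN ?mulN1r ?opprK // h1 ltW.
have fy1 : f y1 = (ang (pi + th), y1).
  have yy : y1 <= y1 <= x by rewrite lexx.
  have b0 := bfun_gt0 (in01 y1 yy).
  have -> : f y1 = (ang (eps * pi + th), y1).
    rewrite /f; congr (ang (_ * _ + _), _).
    rewrite acosc_leN1 // -(ler_pM2l b0) zE ?in01 // -ly1 /lfun; lra.
  (* For eps = -1 the curve ends at -pi, the same point of the circle as pi. *)
  congr (_, _); rewrite /eps; case: ifP => _; first by rewrite mul1r.
  by apply: (@ang_eq _ _ (-1)); rewrite mulN1r mulN1r mulr2n; ring.
have comp1 : connected_component S (ang (t + th), x) (ang (pi + th), y1).
  apply/connected_component_sym; rewrite -fx -fy1; apply: path_component => //.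
    apply: continuous_in_subspaceT => y /set_mem; rewrite /= in_itv /= => yy.
    apply: (@continuous_pair _ (fun y => ang (eps * acosc (zpoly N y) + th)) id);
      last exact: cvg_id.
    apply: continuous_comp; last exact: continuous_ang.
    apply: cvgD; last exact: cvg_cst.
    apply: cvgM; first exact: cvg_cst.
    apply: continuous_comp; last exact: continuous_acosc.
    by apply: continuous_zpoly; exact: in01.
  by move=> y yy; apply: hS; rewrite ?in01 ?Ff.
have y1x' := lt_le_trans y10 y1x.
have comp2 y : 0 < y -> y < y1 -> connected_component S (ang (t + th), x) (ang (pi + th), y).
  move=> y0 yy1; apply: (connected_component_trans comp1).
  apply/connected_component_sym.
  apply: (@path_component _ S (fun y => (ang (pi + th), y)) y y1 (ltW yy1)).
    apply: continuous_subspaceT => z.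
    by apply: (@continuous_pair _ (fun=> ang (pi + th)) id); [exact: cvg_cst|exact: cvg_id].
  move=> z /andP[yz zy1]; have z0 := lt_le_trans y0 yz.
  have [h1 h2] : E <= lfun A B z /\ lfun A B z < 0.
    move: zy1; rewrite le_eqVlt => /predU1P[->|zy1]; first by rewrite ly1.
    by have /andP[h1 h2] := ly z z0 zy1; split => //; exact: ltW.
  apply: hS; rewrite ?Fliftpi //; last exact: lt_le_trans h1.
  by rewrite z0 (le_lt_trans zy1) // (le_lt_trans y1x).
(* The target lies on the boundary x = 0, so it is only approached, along the points (pi + th, y)
   with small y > 0. *)
move=> U Unb.
have cg : (fun y : R => (ang (pi + th), y)) y @[y --> (0 : R)] --> (ang (pi + th), 0 : R).
  by apply: (@continuous_pair _ (fun=> ang (pi + th)) id 0); [exact: cvg_cst|exact: cvg_id].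
have [e /= e0 he] : \forall y \near (0 : R), U (ang (pi + th), y) := cg _ Unb.
pose y := Num.min (e / 2) (y1 / 2).
have y0 : 0 < y by rewrite lt_min !divr_gt0.
have [ye yy1] : y <= e / 2 /\ y <= y1 / 2 by rewrite !ge_min !lexx orbT.
exists (ang (pi + th), y); split; first by apply: comp2 => //; lra.
by apply: he; rewrite /= sub0r normrN gtr0_norm //; lra.
Qed.

End Circle.

(** * Reading the roots off in each zone *)

Section Zones.
Variable R : realType.
Implicit Types A B E : R.

(** P involves only the square of N and is unchanged, while N changes sign; at a root inside ]0, 1[
    it is nonzero because b > 0, so the two strict sign tests are exchanged. *)
Lemma pattern_opp iv A B E b1 b2 :
  pattern iv (- A) (- B) (- E) (~~ b1) (~~ b2) -> pattern iv A B E b1 b2.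
Proof.
have nE : num_poly (- A) (- B) (- E) = - num_poly A B E.
  by rewrite /num_poly polyCN mulNr !scaleNr !opprD !opprK.
have pE : P_poly (- A) (- B) (- E) = P_poly A B E by rewrite /P_poly nE sqrrN.
move=> [lo [hi [y1 [y2 []]]]]; rewrite !pE nE => w d [lo0 hi1] [s1 s2] hiv.
have [[l1 l2] l3 [p1 p2] _] := w.
have flip y : 0 < y < 1 -> (P_poly A B E).[y] = 0 ->
    ((num_poly A B E).[y] < 0) = ~~ ((- num_poly A B E).[y] < 0).
  move=> y01 py; have [_ n0] : acosc (zpoly (num_poly A B E) y) =
      side R ((num_poly A B E).[y] < 0) /\ (num_poly A B E).[y] != 0.
    by apply: acosc_side => //; rewrite -/(P_poly A B E) py.
  by rewrite hornerN oppr_lt0 -leNgt lt_neqAle n0.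
exists lo, hi, y1, y2; split=> //.
by rewrite !flip ?s1 ?s2 ?negbK //; apply/andP; split; lra.
Qed.

(** For B = 0 the cubic equals A at 0 and -g(A) at its minimum, which is smaller. Applied to -A,
    this places Z_10 below the line a_2 = -a_1. *)
Lemma gfun_gtN A : - A < gfun A.
Proof.
have [r [k [r0 kr AE Cr]]] := cubic_minimum A 0.
have := cubic_dec 0 r0 kr AE (lexx 0) r0 (lexx r).
by rewrite Cr /cubic !expr0n /= !mulr0; lra.
Qed.

Section Z10.
Variables A B E : R.
Hypotheses (zone10 : B < - gfun (- A)) (nc : noncritical A B E).

Let BA : B < - A.
Proof. by apply: (lt_trans zone10); rewrite ltrN2 -{1}[A]opprK gfun_gtN. Qed.

Let l_dec x y : 0 <= x -> x < y -> y <= 1 -> lfun A B y < lfun A B x.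
Proof.
rewrite !lfun_oppE ltrN2; move: x y; apply: ufun_increasing => // x x0 x1.
by apply: dufun_inc; [rewrite ltrNr|rewrite x0].
Qed.

Let ql M : M <= 1 -> qconvex (lfun A B) 0 M.
Proof.
move=> M1 x y z x0 xy yz zM; rewrite lt_max l_dec //.
by rewrite (le_trans _ M1) // ltW // (lt_le_trans yz).
Qed.

Let u_shape : exists2 m, 0 < m < 1 & qconvex (fun x => - ufun A B x) 0 1 /\
  (forall x, 0 <= x -> x <= 1 -> ufun A B x <= ufun A B m) /\ dufun A B m = 0.
Proof.
have [m /andP[m0 m1] du] := dufun_incdec BA; exists m; first by rewrite m0.
have inc x y : 0 <= x -> x < y -> y <= m -> ufun A B x < ufun A B y.
  move: x y; apply: ufun_increasing => // [|x x0 xm]; first exact: ltW.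
  by have [|h _ _] := du x; [rewrite x0 (lt_trans xm)|exact: h].
have dec x y : m <= x -> x < y -> y <= 1 -> ufun A B y < ufun A B x.
  move: x y; apply: ufun_decreasing => // [|x mx x1]; first exact: ltW.
  by have [|_ _ h] := du x; [rewrite x1 (lt_trans m0)|exact: h].
split; last split.
- apply: (@dec_inc_qconvex _ _ 0 m 1) => x y h1 h2 h3; rewrite ltrN2.
    exact: inc.
  exact: dec.
- move=> x x0 x1; have [h|h|-> //] := ltgtP x m; apply: ltW.
    exact: inc.
  exact: dec.
- by have [|_ h _] := du m; [rewrite m0|exact: h].
Qed.

Let u1 : ufun A B 1 < 0.
Proof. by rewrite -lfun1 -(lfun0 A B) l_dec. Qed.

(** A point of the zone only gives E <= u x; equality with the maximal value u m is excluded because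
    m is a critical point. *)
Lemma pattern_Z10_TI x : 0 < x < 1 -> E <= ufun A B x -> 0 < E ->
  pattern false A B E true true.
Proof.
move=> /andP[x0 x1] Eu E0; have [m m01 [qu [um dm]]] := u_shape.
have /andP[m0 m1] := m01.
have Em : E < ufun A B m.
  rewrite lt_neqAle (le_trans Eu (um x (ltW x0) (ltW x1))) andbT.
  apply/eqP => e; have [h _] := nc m01.
  by have := h (esym e); rewrite dm eqxx.
have [y1 [y2 w]] := well_TI m0 m1 (lexx 1) qu (ql (lexx 1)) E0 (lt_trans u1 E0) Em.
exact: branch_well_pattern nc (lexx 1) w.
Qed.

Lemma pattern_Z10_TII x : 0 < x < 1 -> lfun A B x <= E -> E < 0 ->
  pattern false A B E false true.
Proof.
move=> /andP[x0 x1] lE E0; have [m m01 [qu _]] := u_shape.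
have u1E : ufun A B 1 < E.
  by rewrite -lfun1; apply: (lt_le_trans _ lE); apply: l_dec => //; exact: ltW.
have [y1 [y2 w]] := well_TII_neg ltr01 (lexx 1) qu (ql (lexx 1)) E0 u1E.
exact: branch_well_pattern nc (lexx 1) w.
Qed.

End Z10.

(** The lower branch is minus an upper branch at (-A, -B), for which -A < B is the condition of the
    increasing-decreasing shape. *)
Lemma Z21_critical A B : - A < B < gfun A -> exists m1 m2 n,
  [/\ 0 < m1, m1 < m2, m2 < 1 /\ 0 < n < 1,
   forall x, 0 < x < 1 ->
    [/\ x < m1 -> 0 < dufun A B x, x = m1 \/ x = m2 -> dufun A B x = 0,
      m1 < x < m2 -> dufun A B x < 0 & m2 < x -> 0 < dufun A B x] &
   forall x, 0 < x < 1 ->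
    [/\ x < n -> dlfun A B x < 0, x = n -> dlfun A B x = 0 & n < x -> 0 < dlfun A B x]].
Proof.
move=> AB; have [m1 [m2 [h1 h2 h3 h4]]] := dufun_incdecinc AB.
have [|n n01 dn] := @dufun_incdec R (- A) (- B).
  by rewrite opprK; have /andP[h _] := AB; lra.
exists m1, m2, n; split => // x x01; have [k1 k2 k3] := dn x x01.
by rewrite dlfun_oppE; split=> h; rewrite ?oppr_lt0 ?oppr_gt0 ?k1 ?k3 // k2 // oppr0.
Qed.

Section Z21.
Variables A B m1 m2 n : R.
Hypotheses (m10 : 0 < m1) (m12 : m1 < m2) (m21 : m2 < 1) (n01 : 0 < n < 1).
Hypothesis du : forall x, 0 < x < 1 ->
  [/\ x < m1 -> 0 < dufun A B x, x = m1 \/ x = m2 -> dufun A B x = 0,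
      m1 < x < m2 -> dufun A B x < 0 & m2 < x -> 0 < dufun A B x].
Hypothesis dl : forall x, 0 < x < 1 ->
  [/\ x < n -> dlfun A B x < 0, x = n -> dlfun A B x = 0 & n < x -> 0 < dlfun A B x].
Local Notation u := (ufun A B).
Local Notation l := (lfun A B).

Let inc1 := u_inc1 m12 m21 du.
Let dec1 := u_dec m10 m21 du.
Let inc2 := u_inc2 m10 m12 du.
Let decl := l_dec n01 dl.
Let incl := l_inc n01 dl.

Let m20 : 0 < m2. Proof. exact: lt_trans m12. Qed.

Let qu : qconvex (fun x => - u x) 0 m2.
Proof.
apply: (@dec_inc_qconvex _ _ 0 m1 m2) => x y h1 h2 h3; rewrite ltrN2.
  exact: inc1.
exact: dec1.
Qed.

Let qu2 : qconvex (fun x => - u x) m2 1.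
Proof.
move=> x y z mx xy yz z1; rewrite lt_max ltrN2; apply/orP; left.
by apply: inc2 => //; apply: ltW; exact: lt_le_trans z1.
Qed.

Let ql : qconvex l 0 1.
Proof. by apply: dec_inc_qconvex; [exact: decl|exact: incl]. Qed.

Let qlm : qconvex l 0 m2.
Proof. exact: qconvexW (lexx _) (ltW m21) ql. Qed.

Let u_ge E : E < 0 -> E < u m2 -> forall x, 0 < x -> x < 1 -> E < u x.
Proof.
move=> E0 Em x x0 x1; have [xm|mx|-> //] := ltgtP x m2.
  have := qconvex_lt qu (E := - E); rewrite ufun0 oppr0 oppr_gt0 ltrN2.
  by move=> /(_ E0 Em x); rewrite ltrN2; apply; rewrite !ltW.
by apply: (lt_trans Em); apply: inc2 => //; exact: ltW.
Qed.

Section Level.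
Variable E : R.
Hypothesis nc : noncritical A B E.

(** The well is taken on [0, m2] only, since past the saddle u may cross E once more. *)
Lemma pattern_Z21_TI : 0 < E -> u m2 < E -> E < u m1 -> pattern false A B E true true.
Proof.
move=> E0 uE Eu.
have [y1 [y2 w]] := well_TI m10 m12 (ltW m21) qu qlm E0 uE Eu.
exact: branch_well_pattern nc (ltW m21) w.
Qed.

(** After its first crossing u never returns to E, because its local minimum u m2 exceeds E. *)
Lemma pattern_Z21_TII_pos : 0 < E -> E < u m2 -> pattern false A B E true false.
Proof.
move=> E0 Eu; have Em1 : E < u m1 by apply: (lt_trans Eu); apply: dec1.
have [||||c /andP[c0 cm] [uc h1 h2]] := @u_crossing_up R A B E 0 m1; rewrite ?ufun0 ?(ltW m10) //.
  exact: qconvexW (lexx _) (ltW m12) qu.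
have h3 x : c < x -> x < 1 -> E < u x.
  move=> cx x1; have [xm|/ltW mx] := leP x m1; first exact: h2.
  have [xm2|/ltW mx2] := leP x m2.
    move: xm2; rewrite le_eqVlt => /predU1P[-> //|xm2].
    by apply: (lt_trans Eu); exact: dec1.
  move: mx2; rewrite le_eqVlt => /predU1P[<- //|mx2].
  by apply: (lt_trans Eu); apply: inc2 => //; exact: ltW.
have c01 : 0 < c < 1 by rewrite c0 (lt_trans cm) // (lt_trans m12).
have [||y2 w] := @well_up R A B E 0 c (lexx 0) ltr01 ql c01 uc h1 h3.
- by rewrite lfun0.
- by rewrite lfun1 (lt_trans Eu) // inc2.
exact: branch_well_pattern nc (lexx 1) w.
Qed.

Lemma pattern_Z21_TII_neg : u m2 < E -> E < 0 -> pattern false A B E false true.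
Proof.
move=> uE E0.
have [y1 [y2 w]] := well_TII_neg m20 (ltW m21) qu qlm E0 uE.
exact: branch_well_pattern nc (ltW m21) w.
Qed.

Lemma pattern_Z21_TIII x : 0 < x < 1 -> l x <= E -> E < 0 -> E < u m2 ->
  pattern false A B E false false.
Proof.
move=> /andP[x0 x1] lE E0 Eu; have /andP[n0 n1] := n01.
have ln : l n < E.
  rewrite lt_neqAle (le_trans (l_ge_min n01 dl (ltW x0) (ltW x1)) lE) andbT.
  apply/eqP => e; have [_ h] := nc n01; have [_ k _] := dl n01.
  by have := h e; rewrite k // eqxx.
have [|y1 [y2 w]] := well_TIII n0 n1 ql (u_ge E0 Eu) E0 ln.
  by rewrite lfun1 (lt_trans Eu) // inc2.
exact: branch_well_pattern nc (lexx 1) w.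
Qed.

(** Left of m2 there are two roots, both on psi = 0 if E > 0, one on each line if E < 0; only their
    presence matters here. The other two come from [well_up] on [m2, 1], where E < u 1 = l 1 makes
    both branches reach the level. *)
Lemma pattern_Z21_TIV : E != 0 -> u m2 < E -> E < u m1 -> E < u 1 ->
  pattern true A B E true false.
Proof.
move=> E0 uE Eu E1.
have [c1 [c2 [w1 [w2 ww]]]] : exists c1 c2 w1 w2, branch_well A B E 0 m2 w1 w2 c1 c2.
  case: (ltgtP E 0) E0 => // E0 _.
    by have [y1 [y2 w]] := well_TII_neg m20 (ltW m21) qu qlm E0 uE; exists false, true, y1, y2.
  by have [y1 [y2 w]] := well_TI m10 m12 (ltW m21) qu qlm E0 uE Eu; exists true, true, y1, y2.
have [|||c cm [uc h1 h2]] := @u_crossing_up R A B E m2 1 qu2; rewrite ?(ltW m21) //.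
have h3 x : c < x -> x < 1 -> E < u x by move=> cx /ltW; exact: h2.
have [||y2 w] := @well_up R A B E m2 c (ltW m20) m21 (qconvexW (ltW m20) (lexx 1) ql) cm uc h1 h3.
- exact: le_lt_trans (lfun_le_ufun A B m2) uE.
- by rewrite lfun1.
exact: (branch_well_pattern4 nc (ltW m20) (lexx 1) ww w).
Qed.

Lemma beyond_saddle s x : 0 < x < 1 -> Flift A B (s, x) = E -> u m2 < E ->
  m2 <= x -> E < u 1.
Proof.
move=> /andP[x0 x1] FE uE; have /andP[_ h] := Flift_le A B s x.
rewrite FE in h; rewrite le_eqVlt => /predU1P[e|mx].
  by move: uE; rewrite e ltNge h.
by apply: (le_lt_trans h); apply: inc2 (ltW mx) x1 (lexx 1).
Qed.

(** The angle th is 0 in Z_21; in Z_12, where this is applied to the opposite parameters, it is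
    pi. *)
Lemma outside_superlevel_component th (S : set (circle R * R)) s x :
  (forall s y, 0 < y < 1 -> u m2 < Flift A B (s, y) -> S (ang (s + th), y)) ->
  0 < x < 1 -> Flift A B (s, x) = E -> u m2 < E ->
  ~ connected_component S (ang th, m1) (ang (s + th), x) -> E < u 1.
Proof.
move=> hS x01 FE uE nc'; apply: (beyond_saddle x01 FE uE).
rewrite leNgt; apply/negP => xm; apply: nc'.
apply: (superlevel_component m10 m12 m21 inc1 dec1 hS) => //; last by rewrite FE.
by have /andP[] := x01.
Qed.

Lemma outside_level_component th (S : set (circle R * R)) s x :
  (forall s y, 0 < y < 1 -> u m2 < Flift A B (s, y) -> Flift A B (s, y) < 0 ->
     S (ang (s + th), y)) ->
  0 < x < 1 -> Flift A B (s, x) = E -> u m2 < E -> E < 0 ->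
  ~ closure (connected_component S (ang (s + th), x)) (ang (pi + th), 0) ->
  E < u 1.
Proof.
move=> hS x01 FE uE E0 nc'; apply: (beyond_saddle x01 FE uE).
rewrite leNgt; apply/negP => xm; apply: nc'.
have /andP[x0 x1] := x01; have /andP[lx ux] := Flift_le A B s x; rewrite FE in lx ux.
have lm := le_lt_trans (lfun_le_ufun A B m2) uE.
(* y1 and y2 are the points where the level E is met on psi = pi and psi = 0 left of the saddle; x
   lies between them. *)
have [|||y1 /andP[y10 ym] [ly1 h1 h2]] := @crossing_down R l 0 m2 E (@continuous_lfun R A B) qlm;
  rewrite ?lfun0 ?(ltW m20) //.
have [|||y2 /andP[y20 ym2] [uy2 k1 k2]] := @u_crossing_down R A B E 0 m2 qu;
  rewrite ?ufun0 ?(ltW m20) //.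
have y1x : y1 <= x.
  by rewrite leNgt; apply/negP => xy; have := h1 x (ltW x0) xy; rewrite ltNge lx.
have xy2 : x <= y2.
  by rewrite leNgt; apply/negP => yx; have := k2 x yx (ltW xm); rewrite ltNge ux.
apply: (@level_component R A B th E (u m2) y1 S) => //.
- move=> y y0 yy1; rewrite h1 ?(ltW y0) //=.
  have := ql (lexx 0) y0 yy1 (ltW (lt_trans ym m21)).
  by rewrite lfun0 ly1 lt_max => /orP[//|h]; exact: lt_trans E0.
- move=> y /andP[y1y yx]; apply/andP; split.
    move: y1y; rewrite le_eqVlt => /predU1P[<-|y1y]; first by rewrite ly1.
    by apply/ltW/h2 => //; exact: le_trans (ltW xm).
  move: (le_trans yx xy2); rewrite le_eqVlt => /predU1P[->|yy2]; first by rewrite uy2.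
  by apply/ltW/k1 => //; exact: ltW (lt_le_trans y10 y1y).
Qed.

End Level.

End Z21.

Definition zone_ends (r : region) (t : zone_type) : bool * bool :=
  match t, r with
  | TI, _ => (true, true)
  | TIII, _ => (false, false)
  | TII, (Z01 | Z21p | Z12p) => (true, false)
  | TII, _ => (false, true)
  | TIV, (Z21p | Z21m) => (true, false)
  | TIV, _ => (false, true)
  end.

Definition is_TIV (t : zone_type) : bool := if t is TIV then true else false.

Definition zone_pattern_for A B E (r : region) (t : zone_type) : Prop :=
  pattern (is_TIV t) A B E (zone_ends r t).1 (zone_ends r t).2.

Lemma zone_pattern_Z10 A B E t p : noncritical A B E -> in_region A B Z10 ->
  zone A B Z10 t p -> F A B p = E -> zone_pattern_for A B E Z10 t.
Proof.
move=> nc reg; have /andP[lF uF] := Flift_le A B (repr p.1) p.2.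
case: t => //= -[x01 FE] e; rewrite -/(F A B p) e in lF uF; rewrite e in FE.
  exact: pattern_Z10_TI x01 uF FE.
exact: pattern_Z10_TII x01 lF FE.
Qed.

Lemma zone_pattern_Z01 A B E t p : noncritical A B E -> in_region A B Z01 ->
  zone A B Z01 t p -> F A B p = E -> zone_pattern_for A B E Z01 t.
Proof.
move=> /noncritical_opp nc reg; have /andP[lF uF] := Flift_le A B (repr p.1) p.2.
have reg' : - B < - gfun (- (- A)) by rewrite opprK ltrN2.
case: t => //= -[x01 FE] e; rewrite -/(F A B p) e in lF uF; rewrite e in FE.
  apply: pattern_opp; apply: (pattern_Z10_TII reg' nc x01); last by rewrite oppr_lt0.
  by rewrite lfun_oppE !opprK lerN2.
apply: pattern_opp; apply: (pattern_Z10_TI reg' nc x01); last by rewrite oppr_gt0.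
by move: lF; rewrite lfun_oppE lerNl.
Qed.

Lemma zone_pattern_Z21p A B E t p : noncritical A B E -> E != 0 -> in_region A B Z21p ->
  zone A B Z21p t p -> F A B p = E -> loops_exist A B Z21p E ->
  zone_pattern_for A B E Z21p t.
Proof.
move=> nc E0 [reg es0] zp FE loops.
have [m1 [m2 [n [m10 m12 [m21 n01] du dl]]]] := Z21_critical reg.
have esE := EsadE m10 m12 m21 n01 du dl.
have xE := xmaxE m10 m12 m21 du.
have /andP[lF uF] := Flift_le A B (repr p.1) p.2.
move: loops; rewrite /= Flift0 xE => Em1.
case: t zp => /=; rewrite ?esE ?xE in es0 *.
- move=> /connected_component_sub[_]; rewrite FE => Eu.
  by apply: (pattern_Z21_TI m10 m12 m21 n01 du dl nc) => //; exact: lt_trans Eu.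
- move=> [_ /andP[]]; rewrite FE => h1 h2.
  exact: (pattern_Z21_TII_pos m10 m12 m21 n01 du dl nc).
- move=> [x01]; rewrite FE => h; rewrite -/(F A B p) FE in lF uF.
  by apply: (pattern_Z21_TIII m10 m12 m21 n01 du dl nc x01 lF) => //; exact: lt_trans es0.
- move=> [[x01 Eu] ncmp]; rewrite FE in Eu.
  apply: (pattern_Z21_TIV m10 m12 m21 n01 du dl nc) => //.
  apply: (outside_superlevel_component m10 m12 m21 du (th := 0)
    (S := [set q | phase_space q /\ F A B q > ufun A B m2]) _ x01 FE Eu).
    move=> s y y01 h; rewrite addr0; split => //; first by rewrite F_ang.
  by rewrite addr0 ang_repr => h; apply: ncmp; case: (p) h.
Qed.

Lemma zone_pattern_Z21m A B E t p : noncritical A B E -> E != 0 -> in_region A B Z21m ->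
  zone A B Z21m t p -> F A B p = E -> loops_exist A B Z21m E ->
  zone_pattern_for A B E Z21m t.
Proof.
move=> nc E0 [reg es0] zp FE loops.
have [m1 [m2 [n [m10 m12 [m21 n01] du dl]]]] := Z21_critical reg.
have esE := EsadE m10 m12 m21 n01 du dl.
have xE := xmaxE m10 m12 m21 du.
have /andP[lF uF] := Flift_le A B (repr p.1) p.2.
move: loops; rewrite /= Flift0 xE => Em1.
case: t zp => /=; rewrite ?esE ?xE in es0 *.
- move=> [_]; rewrite FE => Eu.
  by apply: (pattern_Z21_TI m10 m12 m21 n01 du dl nc) => //; exact: lt_trans Eu.
- move=> [[_ /andP[]]]; rewrite FE => h1 h2 _.
  exact: (pattern_Z21_TII_neg m10 m12 m21 n01 du dl nc).
- move=> [x01]; rewrite FE => h; rewrite -/(F A B p) FE in lF uF.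
  by apply: (pattern_Z21_TIII m10 m12 m21 n01 du dl nc x01 lF) => //; exact: lt_trans es0.
- move=> [[x01 /andP[Eu En]] ncmp].
  have Ap := conj x01 (introT andP (conj Eu En)).
  rewrite FE in Eu En.
  apply: (pattern_Z21_TIV m10 m12 m21 n01 du dl nc) => //.
  apply: (outside_level_component m10 m12 m21 n01 du dl (th := 0)
    (S := [set q | phase_space q /\ ufun A B m2 < F A B q < 0]) _ x01 FE Eu En).
    move=> s y y01 h h'; rewrite addr0; split => //; first by rewrite F_ang h.
  rewrite !addr0 ang_repr => h; apply: ncmp; split; first exact: Ap.
  by case: (p) h.
Qed.

Lemma F_opp A B s y : F A B (ang (s + pi), y) = - Flift (- A) (- B) (s, y).
Proof. by rewrite F_ang -Flift_opp !opprK. Qed.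

(** The symmetry turns Z_12^- into Z_21^+ and exchanges types I and III, as maxima become minima. *)
Lemma zone_pattern_Z12m A B E t p : noncritical A B E -> E != 0 -> in_region A B Z12m ->
  zone A B Z12m t p -> F A B p = E -> loops_exist A B Z12m E ->
  zone_pattern_for A B E Z12m t.
Proof.
move=> /noncritical_opp nc; rewrite -oppr_eq0 => E0 [reg es0] zp FE loops.
have reg' : - - A < - B < gfun (- A) by move: reg => /andP[h1 h2]; apply/andP; split; lra.
have [m1 [m2 [n [m10 m12 [m21 n01] du dl]]]] := Z21_critical reg'.
have esE : Esad A B = - ufun (- A) (- B) m2.
  by have := Esad_oppE m10 m12 m21 n01 du dl; rewrite !opprK.
have xE : xmin A B = m1 by rewrite xmin_opp (xmaxE m10 m12 m21 du).
have FE' : Flift (- A) (- B) (repr p.1 - pi, p.2) = - E by rewrite Flift_opp' -FE.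
have /andP[lF uF] := Flift_le (- A) (- B) (repr p.1 - pi) p.2; rewrite FE' in lF uF.
move: loops; rewrite /= Fliftpi lfun_oppE xE ltrNl => Em1.
case: t zp => /=; rewrite ?esE ?xE in es0 *; rewrite ?oppr_lt0 in es0.
- move=> [x01]; rewrite FE => h; apply: pattern_opp.
  by apply: (pattern_Z21_TIII m10 m12 m21 n01 du dl nc x01 lF);
    [rewrite oppr_lt0|rewrite (lt_trans _ es0) // oppr_lt0].
- move=> [_ /andP[]]; rewrite FE => h1 h2; apply: pattern_opp.
  by apply: (pattern_Z21_TII_pos m10 m12 m21 n01 du dl nc); [rewrite oppr_gt0|rewrite ltrNl].
- move=> /connected_component_sub[_]; rewrite FE ltrNr => Eu; apply: pattern_opp.
  by apply: (pattern_Z21_TI m10 m12 m21 n01 du dl nc) => //; exact: lt_trans Eu.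
- move=> [[x01 Eu] ncmp]; rewrite FE ltrNr in Eu; apply: pattern_opp.
  apply: (pattern_Z21_TIV m10 m12 m21 n01 du dl nc) => //.
  apply: (outside_superlevel_component m10 m12 m21 du (th := pi)
    (S := [set q | phase_space q /\ F A B q < - ufun (- A) (- B) m2]) _ x01 FE' Eu).
    by move=> s y y01 h; split => //; rewrite F_opp ltrN2.
  by rewrite subrK ang_repr => h; apply: ncmp; case: (p) h.
Qed.

(** The symmetric region is Z_21^-, since the saddle value changes sign. *)
Lemma zone_pattern_Z12p A B E t p : noncritical A B E -> E != 0 -> in_region A B Z12p ->
  zone A B Z12p t p -> F A B p = E -> loops_exist A B Z12p E ->
  zone_pattern_for A B E Z12p t.
Proof.
move=> /noncritical_opp nc; rewrite -oppr_eq0 => E0 [reg es0] zp FE loops.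
have reg' : - - A < - B < gfun (- A) by move: reg => /andP[h1 h2]; apply/andP; split; lra.
have [m1 [m2 [n [m10 m12 [m21 n01] du dl]]]] := Z21_critical reg'.
have esE : Esad A B = - ufun (- A) (- B) m2.
  by have := Esad_oppE m10 m12 m21 n01 du dl; rewrite !opprK.
have xE : xmin A B = m1 by rewrite xmin_opp (xmaxE m10 m12 m21 du).
have FE' : Flift (- A) (- B) (repr p.1 - pi, p.2) = - E by rewrite Flift_opp' -FE.
have /andP[lF uF] := Flift_le (- A) (- B) (repr p.1 - pi) p.2; rewrite FE' in lF uF.
move: loops; rewrite /= Fliftpi lfun_oppE xE ltrNl => Em1.
case: t zp => /=; rewrite ?esE ?xE in es0 *; rewrite ?oppr_gt0 in es0.
- move=> [x01]; rewrite FE => h; apply: pattern_opp.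
  apply: (pattern_Z21_TIII m10 m12 m21 n01 du dl nc x01 lF); last by rewrite ltrNl.
  by rewrite (lt_trans _ es0) // ltrNl.
- move=> [[_ /andP[]]]; rewrite FE => h1 h2 _; apply: pattern_opp.
  by apply: (pattern_Z21_TII_neg m10 m12 m21 n01 du dl nc); [rewrite ltrNr|rewrite oppr_lt0].
- move=> [x01]; rewrite FE => h; apply: pattern_opp.
  apply: (pattern_Z21_TI m10 m12 m21 n01 du dl nc) => //; first by rewrite oppr_gt0.
  by rewrite (lt_trans es0) // oppr_gt0.
- move=> [[x01 /andP[En Eu]] ncmp].
  have Ap := conj x01 (introT andP (conj En Eu)).
  rewrite FE in Eu En; rewrite ltrNr in Eu; rewrite -oppr_lt0 in En.
  apply: pattern_opp; apply: (pattern_Z21_TIV m10 m12 m21 n01 du dl nc) => //.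
  apply: (outside_level_component m10 m12 m21 n01 du dl (th := pi)
    (S := [set q | phase_space q /\ 0 < F A B q < - ufun (- A) (- B) m2]) _ x01 FE' Eu En).
    by move=> s y y01 h h'; split => //; rewrite F_opp oppr_gt0 h' ltrN2.
  (* The boundary point (pi, 0) of the symmetric zone is rotated by pi onto (0, 0). *)
  have -> : ang (pi + pi) = ang 0 :> circle R by apply: (@ang_eq _ _ _ 1); rewrite mul1r subr0 mulr2n.
  rewrite subrK ang_repr => h; apply: ncmp; split; first exact: Ap.
  by case: (p) h.
Qed.

End Zones.

Theorem proposition2 (R : realType) (c : constants R) (r : region)
    (t : zone_type) (E I2 : R) :
  0 < om_m c < om_p c -> chi c != 0 -> 0 < I2 ->
  in_region (a1 c I2) (a2 c) r ->
  (exists2 p, zone (a1 c I2) (a2 c) r t p & F (a1 c I2) (a2 c) p = E) ->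
  E != 0 ->
  ~ critical_value (a1 c I2) (a2 c) E ->
  loops_exist (a1 c I2) (a2 c) r E ->
  (t <> TIV -> derivative_formulas c t (zone_sign r t) 1 2 E I2) /\
  (t = TIV -> derivative_formulas c t (zone_sign r t) 3 4 E I2).
Proof.
move=> _ chi0 I20 reg [p zp FE] E0 /noncritical_level nc loops.
have pat : zone_pattern_for (a1 c I2) (a2 c) E r t.
  case: r reg zp loops => reg zp loops.
  - exact: zone_pattern_Z10 zp FE.
  - exact: zone_pattern_Z01 zp FE.
  - exact: zone_pattern_Z21p zp FE loops.
  - exact: zone_pattern_Z21m zp FE loops.
  - exact: zone_pattern_Z12p zp FE loops.
  - exact: zone_pattern_Z12m zp FE loops.
have ct : compatible_ends t (zone_ends r t).1 (zone_ends r t).2 by case: t r {reg zp loops pat} => -[].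
have := pattern_formulas chi0 I20 pat ct erefl.
(* The right-hand root decides: minus if it lies on psi = 0, plus if it lies on psi = pi. *)
have -> : - (-1) ^+ (~~ (zone_ends r t).2) = zone_sign r t :> R.
  by case: t r {reg zp loops pat ct} => -[] /=; rewrite ?expr0 ?expr1 ?opprK.
by case: t {reg zp loops pat ct}.
Qed.
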